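(* Let $F_n$ be a maximizer of the extremal problem, let $(\mathbf a,\mathbf b)$ be the gap containing $x_*$, and let $D_n^0=(F_n)_0+D_n^\infty-(F_n)_\infty$. Then: (i) every $x$ with $D_n^0(x)>0$ lies in $\overline{\mathbb R}$; (ii) $F_n$ is real; (iii) for any distinct $x_1,x_2\in\overline{\mathbb R}$ with $D_n^0(x_1)\ge1$, $D_n^0(x_2)\ge1$, there is $y\in\mathsf E\cap(x_1,x_2)$ with $|F_n(y)|=1$; (iv) $D_n^0\le1$; (v) each gap contains at most one point $x$ with $D_n^0(x)>0$; (vi) $D_n^0(x)=0$ for all $x\in(\mathbf a,\mathbf b)$; (vii) the maximizer is unique; (viii) if $F_n$ is nonconstant, then $\{z\in\overline{\mathbb C}:F_n(z)\in[-1,1]\}\subset\overline{\mathbb R}$; in particular all solutions of $F_n(z)=\pm1$ lie in $\overline{\mathbb R}$; (ix) if $F_n$ is nonconstant of degree $m$, then $F_n^{-1}((-1,1))$ has exactly $m$ connected components (open bands), $F_n$ is strictly monotone on each of them (with respect to the cyclic orientation of $\overline{\mathbb R}$) and maps each onto $(-1,1)$, and the endpoints of the open bands are exactly all the points where $F_n=\pm1$; (x) $F_n(\mathbf a)=(-1)^{\sum_{\mathbf c\in(\mathbf a,x_* )}D_n^\infty(\mathbf c)}$ and $F_n(\mathbf b)=(-1)^{\sum_{\mathbf c\in[x_*,\mathbf b)}D_n^\infty(\mathbf c)}$; (xi) for any gap $(\mathbf a_i,\mathbf b_i)$ containing a point $\mathbf c_i$ with $D_n^\infty(\mathbf c_i)>0$,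 at least one of $|F_n(\mathbf a_i)|=1$, $|F_n(\mathbf b_i)|=1$ holds; and if moreover $D_n^0(\mathbf c_i)=1$, then $|F_n(\mathbf a_i)|=|F_n(\mathbf b_i)|=1$.
   Context: Let $\mathsf E\subset\overline{\mathbb R}$ be a compact proper subset with infinitely many points; gaps are connected components of $\overline{\mathbb R}\setminus\mathsf E$, each of the form $(\mathbf a,\mathbf b)$ with $\mathbf a,\mathbf b\in\mathsf E$ in cyclic interval notation: a sequence $(t_0,\dots,t_m)$, $m\ge 2$, is cyclically ordered if it has no repetitions and some $f\in\mathrm{PSL}(2,\mathbb R)$ satisfies $f(t_0)=\infty$, $f(t_1)<\dots<f(t_m)$; for distinct $a,b$, $(a,b)=\{c:(a,c,b)\text{ cyclically ordered}\}$, $[a,b)=(a,b)\cup\{a\}$. Divisors are finitely supported $D:\overline{\mathbb C}\to\mathbb Z$, integral if $D\ge0$; for rational $f$, $(f)_\infty$ and $(f)_0$ are its polar and zero divisors ($0$ for constants) and $\deg f=\deg(f)_\infty$; $\mathcal L(D)=\{f\text{ rational}:(f)_\infty\le D\}$. For $\mathbf c\in\overline{\mathbb R}$, $r(z,\mathbf c)=1/(\mathbf c-z)$ if $\mathbf c\neq\infty$, $r(z,\infty)=z$. Fix $n\ge1$, an integral divisor $D_n^\infty$ of degree $n$ supported in $\overline{\mathbb R}\setminus\mathsf E$, and $x_*\in\overline{\mathbb R}\setminus\mathsf E$; $d_n=D_n^\infty(x_* )$, $\mathcal L_n=\mathcal L(D_n^\infty)$. The extremal problem maximizes $\Re\lim_{x\to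 x_*}F(x)/r(x,x_* )^{d_n}$ over $F\in\mathcal L_n$ with $\sup_{\mathsf E}|F|\le1$. A function is real if $F(\bar z)=\overline{F(z)}$. *)

(* Defs.v *)
(* MathComp + MathComp-Analysis (R : realType), complex numbers R[i]
   from mathcomp-real-closed. *)
From HB Require Import structures.
From mathcomp Require Import all_boot all_order all_algebra.
From mathcomp Require Import all_classical all_reals all_analysis.
From mathcomp Require Import complex.
Set Implicit Arguments. Unset Strict Implicit. Unset Printing Implicit Defensive.
Import Order.TTheory GRing.Theory Num.Theory.
Import numFieldNormedType.Exports.
Local Open Scope classical_set_scope.
Local Open Scope ring_scope.
Local Open Scope complex_scope.

Section Defs.
Variable R : realType.

(** The extended real line  R̄ = R ∪ {∞}  (None = ∞), with the topology of the
    one-point compactification of R. *)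
Definition Rbar := one_point_compactification R.

(** The Riemann sphere  Ĉ = C ∪ {∞}  (None = ∞). *)
Definition Cbar := option R[i].

(** inclusion R̄ ⊂ Ĉ *)
Definition emb (x : Rbar) : Cbar :=
  match x with Some r => Some (r%:C) | None => None end.

(** Action of the Möbius map x ↦ (al x + be)/(ga x + de) on R̄. *)
Definition mob (al be ga de : R) (x : Rbar) : Rbar :=
  match x with
  | Some r => if ga * r + de == 0 then None else Some ((al * r + be) / (ga * r + de))
  | None => if ga == 0 then None else Some (al / ga)
  end.

Definition ltRbar (u v : Rbar) : bool :=
  match u, v with Some x, Some y => x < y | _, _ => false end.

(** (t_0,...,t_m), m >= 2, cyclically ordered: no repetitions and some
    f ∈ PSL(2,R) (a Möbius map with real coefficients of determinant 1)
    with f(t_0) = ∞ and f(t_1) < ... < f(t_m). *)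
Definition cyc_ordered (t : seq Rbar) : Prop :=
  match t with
  | [::] => False
  | t0 :: ts =>
      (2 <= size ts)%N /\ uniq t /\
      exists al be ga de : R, al * de - be * ga = 1 /\
        mob al be ga de t0 = None /\ sorted ltRbar (map (mob al be ga de) ts)
  end.

(** cyclic open interval (a,b) = {c : (a,c,b) cyclically ordered} *)
Definition oint (a b : Rbar) : set Rbar := [set c | cyc_ordered [:: a; c; b]].

(** a gap of E: an open cyclic interval (a,b) with a,b ∈ E, a <> b, disjoint
    from E (i.e. a connected component of R̄ \ E). *)
Definition is_gap (E : set Rbar) (a b : Rbar) : Prop :=
  E a /\ E b /\ a <> b /\ oint a b `&` E = set0.

(** Rational functions on Ĉ, in lowest terms: numerator p, monic denominator q,
    p and q coprime. *)
Definition ratfun_ok (pq : {poly R[i]} * {poly R[i]}) : bool :=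
  (pq.2 \is monic) && coprimep pq.1 pq.2.
Definition ratfun := {pq : {poly R[i]} * {poly R[i]} | ratfun_ok pq}.

Definition rnum (F : ratfun) : {poly R[i]} := (sval F).1.
Definition rden (F : ratfun) : {poly R[i]} := (sval F).2.

(** value of F at a point of Ĉ (None = ∞) *)
Definition rval (F : ratfun) (z : Cbar) : Cbar :=
  let p := rnum F in let q := rden F in
  match z with
  | Some w => if q.[w] != 0 then Some (p.[w] / q.[w]) else None
  | None =>
      if (size p < size q)%N then Some 0
      else if size p == size q then Some (lead_coef p / lead_coef q)
      else None
  end.

(** polar divisor (F)_∞ and zero divisor (F)_0 (both 0 for constants) *)
Definition poldiv (F : ratfun) (z : Cbar) : nat :=
  match z with
  | Some w => mup w (rden F)
  | None => (size (rnum F) - size (rden F))%N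
  end.
Definition zerodiv (F : ratfun) (z : Cbar) : nat :=
  if rnum F == 0 then 0%N else
  match z with
  | Some w => mup w (rnum F)
  | None => (size (rden F) - size (rnum F))%N
  end.

(** deg F = deg (F)_∞ = (number of finite poles, i.e. deg q, as C is
    algebraically closed and p,q coprime) + (order of the pole at ∞). *)
Definition rdeg (F : ratfun) : nat :=
  ((size (rden F)).-1 + (size (rnum F) - size (rden F)))%N.

(** F is real: F(conj z) = conj (F z) *)
Definition conjCbar (z : Cbar) : Cbar := omap (fun w => w^*) z.
Definition is_real_ratfun (F : ratfun) : Prop :=
  forall z : Cbar, rval F (conjCbar z) = conjCbar (rval F z).

(** Integral divisors supported in R̄ are given as finite multisets (lists)
    of points of R̄; D(z) = multiplicity of z. *)
Definition divR (s : seq Rbar) (c : Rbar) : nat := count (pred1 c) s.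
Definition divC (s : seq Rbar) (z : Cbar) : nat := count (fun t => emb t == z) s.

(** r(x, c) for real x *)
Definition rr (x : R) (c : Rbar) : R[i] :=
  match c with Some c' => ((c' - x)%:C)^-1 | None => x%:C end.

(** real x is within delta of c (punctured neighbourhood in R̄) *)
Definition near_pt (c : Rbar) (delta x : R) : Prop :=
  match c with
  | Some c' => x != c' /\ `|x - c'| < delta
  | None => delta^-1 < `|x|
  end.

(** lim_{x -> xs} F(x) / r(x,xs)^d = L *)
Definition lim_quot (F : ratfun) (xs : Rbar) (d : nat) (L : R[i]) : Prop :=
  forall eps : R, 0 < eps -> exists delta : R, 0 < delta /\
    forall x : R, near_pt xs delta x ->
      exists w, rval F (Some x%:C) = Some w /\
                `|w / rr x xs ^+ d - L| < eps%:C.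

(** Admissible: F ∈ L(D_n^∞) and sup_E |F| <= 1 *)
Definition admissible (E : set Rbar) (s : seq Rbar) (F : ratfun) : Prop :=
  (forall z : Cbar, (poldiv F z <= divC s z)%N) /\
  (forall y : Rbar, E y -> exists w, rval F (emb y) = Some w /\ `|w| <= 1).

(** F is a maximizer of Re lim_{x->xs} F(x)/r(x,xs)^{d_n}, d_n = D_n^∞(xs) *)
Definition is_maximizer (E : set Rbar) (s : seq Rbar) (xs : Rbar) (F : ratfun) : Prop :=
  admissible E s F /\
  exists L, lim_quot F xs (divR s xs) L /\
    forall G L', admissible E s G -> lim_quot G xs (divR s xs) L' ->
      complex.Re L' <= complex.Re L.

(** D_n^0 = (F)_0 + D_n^∞ - (F)_∞ *)
Definition D0 (s : seq Rbar) (F : ratfun) (z : Cbar) : int :=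
  (zerodiv F z)%:Z + (divC s z)%:Z - (poldiv F z)%:Z.

Definition absone (v : Cbar) : Prop := exists w, v = Some w /\ `|w| = 1.
Definition in_open_band (v : Cbar) : Prop := exists w, v = Some w /\ -1 < w < 1.
Definition in_closed_band (v : Cbar) : Prop := exists w, v = Some w /\ -1 <= w <= 1.
Definition ltCbar (u v : Cbar) : bool :=
  match u, v with Some x, Some y => x < y | _, _ => false end.

End Defs.

(* Main.v *)
(** Send [xs] to infinity by the Moebius map [r(., xs)]: the set [E] becomes a
    compact subset [K] of the real line, a function of [L(D_n)] becomes [P / Q]
    with [P] a polynomial of degree at most [n] and [Q] the monic real polynomial
    of the finite poles, the limit to be maximized is the [n]-th coefficient of
    [P], and [D_n^0] is the divisor of zeros of [P] as a form of degree [n].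

    If [S] is a nonconstant real factor of a maximal [P], then [S] changes sign on
    the points of [K] where [|P| = |Q|]: otherwise [P - e * (P / S)] does better.
    Hence the zeros of [P] are real and simple, and [n + 1] such points interlace
    them.  At these points [P - t Q], for [|t| < 1], has the alternating signs of
    [P], so that it has one simple zero in each of the [n] cells and no other
    zero.  Dividing out the common zeros of [P] and [Q] leaves [p / q] of degree
    [m] with the same property for [m] cells, each of which contains exactly one
    open band; letting [t] tend to [1] or [-1], the zeros of [p - q] and of
    [p + q] are exactly the ends of the bands.  Real parts and averages of
    maximizers are maximizers which touch [+-1] at [n + 1] points, which gives
    reality and uniqueness. *)
Require Import Defs.
From HB Require Import structures.
From mathcomp Require Import all_boot all_order all_algebra.
From mathcomp Require Import all_classical all_reals all_analysis.
From mathcomp Require Import complex.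
From mathcomp Require Import ring lra zify.
Import Order.TTheory GRing.Theory Num.Theory.
Import numFieldNormedType.Exports.
Local Open Scope classical_set_scope.
Local Open Scope ring_scope.
Local Open Scope card_scope.
Local Open Scope complex_scope.

Set Implicit Arguments.
Unset Strict Implicit.
Unset Printing Implicit Defensive.

(** * Weighted extremal polynomials *)

Section RealPolynomials.
Context {R : realType}.
Implicit Types (K : set R) (P Q S h : {poly R}).

(** All rigidity comes from one perturbation: [h] of degree below [n] does not affect the top
    coefficient of [P - e * h], and if [h * P > 0] wherever [|P| = |Q|], then [|P - e * h| < |Q|] on
    [K] with room to rescale. Nothing is ever differentiated: simplicity, location and monotonicity
    are all read off from the fact that a polynomial of degree at most [n] with [n + 1] alternating
    signs has exactly one zero per cell.

    Two obstacles shape the rest. A common zero of [P] and [Q] is a zero of [P - t Q] for every [t],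
    so its cell need carry no band; bands are therefore studied after cancellation, while statements
    about [E] keep all [n + 1] oscillation points. For [t = 1] and [t = -1] the value of [P - t Q]
    may vanish at oscillation points, the sign count fails, and the band ends are only reached by a
    limit.

    Infinity is an ordinary point for the divisors. Polynomials are therefore read as forms of a
    fixed degree, a deficit of degree being a zero at infinity; a positive top coefficient of
    [p - t q] then says that [F_n] does not take the value [t] at [x_*]. *)

Lemma ler_norm_sqr (u v : R) : (`|u| <= `|v|) = (u ^+ 2 <= v ^+ 2).
Proof.
by rewrite -[in RHS](real_normK (num_real u)) -[in RHS](real_normK (num_real v))
  ler_sqr ?nnegrE.
Qed.

Lemma horner_bounded_compact K P : compact K ->
  exists2 M : R, 0 < M & forall y, K y -> `|P.[y]| <= M.
Proof.
move=> cK; have [K0|/set0P K0] := eqVneq K set0.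
  by exists 1 => // y; rewrite K0.
have [c _ cM] := @compact_EVT_max _ _ (fun x => (P * P).[x]) K K0 cK
  (continuous_subspaceT (@continuous_horner R (P * P))).
exists (`|P.[c]| + 1); first by rewrite ltr_wpDl.
move=> y Ky; have := cM y (mem_set Ky); rewrite !hornerM -!expr2 -ler_norm_sqr.
by move=> /le_trans; apply; rewrite lerDl.
Qed.

(** The maximum of the two functions turns a covering of [K] by two open conditions into the minimum
    of one continuous function, hence a single constant for both. *)
Lemma horner_max_pos_compact K P Q : compact K ->
  (forall y, K y -> 0 < P.[y] \/ 0 < Q.[y]) ->
  exists2 d : R, 0 < d & forall y, K y -> d <= P.[y] \/ d <= Q.[y].
Proof.
move=> cK PQ; have [K0|/set0P K0] := eqVneq K set0.
  by exists 1 => // y; rewrite K0.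
have ct : continuous (fun x : R => Num.max P.[x] Q.[x]).
  move=> x; apply: (@continuous_max R R (fun x => P.[x]) (fun x => Q.[x]));
    exact: continuous_horner.
have [c cK' cm] := @compact_EVT_min _ _ _ K K0 cK (continuous_subspaceT ct).
exists (Num.max P.[c] Q.[c]).
  by rewrite lt_max; apply/orP; apply: PQ; exact: set_mem.
by move=> y Ky; apply/orP; rewrite -le_max; apply: cm; rewrite inE.
Qed.

Lemma horner_pos_compact K P : compact K -> (forall y, K y -> 0 < P.[y]) ->
  exists2 d : R, 0 < d & forall y, K y -> d <= P.[y].
Proof.
move=> cK P0; have [|d d0 dP] := @horner_max_pos_compact K P P cK.
  by move=> y Ky; left; exact: P0.
by exists d => // y /dP[].
Qed.

Lemma horner_ivt P (u v : R) : u < v -> P.[u] * P.[v] < 0 ->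
  exists2 z, u < z < v & P.[z] = 0.
Proof.
move=> uv PuPv.
have [z zuv /rootP Pz] : exists2 z, u <= z <= v & root (P.[v] *: P) z.
  apply: poly_ivt; first exact: ltW.
  by rewrite !hornerZ mulrC (ltW PuPv) -expr2 sqr_ge0.
have Pv : P.[v] != 0 by apply: contraTneq PuPv => ->; rewrite mulr0 ltxx.
have Pz0 : P.[z] = 0 by move/eqP: Pz; rewrite hornerZ mulf_eq0 (negPf Pv) => /eqP.
have uz : u != z by apply: contraTneq PuPv => ->; rewrite Pz0 mul0r ltxx.
have zv : z != v by apply: contraTneq PuPv => <-; rewrite Pz0 mulr0 ltxx.
by exists z => //; rewrite !lt_neqAle uz zv.
Qed.

Lemma poly_eq_of_many_roots (T : idomainType) (f g : {poly T}) (rs : seq T) :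
  uniq rs -> (size f <= size rs)%N -> (size g <= size rs)%N ->
  (forall x, x \in rs -> f.[x] = g.[x]) -> f = g.
Proof.
move=> urs sf sg fg; apply/eqP; rewrite -subr_eq0; apply/negPn/negP => nz.
have /(max_poly_roots nz)/(_ urs) : all (root (f - g)) rs.
  by apply/allP => x xr; rewrite rootE !hornerE fg ?subrr.
have := size_polyD f (- g); rewrite size_polyN => h1 h2.
by have := leq_trans h2 h1; rewrite ltnNge geq_max sf sg.
Qed.

(* The extremal problem in the coordinate where [xs] is at infinity: the
   normalized limit of [P / Q] there is the coefficient [P`_n]. *)
Definition wextremal K Q (n : nat) P :=
  [/\ (size P <= n.+1)%N,
      forall y, K y -> `|P.[y]| <= `|Q.[y]| &
      forall G : {poly R}, (size G <= n.+1)%N ->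
        (forall y, K y -> `|G.[y]| <= `|Q.[y]|) -> G`_n <= P`_n].

Section Extremal.
Variables (K : set R) (Q : {poly R}) (n : nat) (P : {poly R}).
Hypotheses (cK : compact K) (Q0 : forall y, K y -> Q.[y] != 0).
Hypothesis (maxP : wextremal K Q n P).

Definition touch y := K y /\ `|P.[y]| = `|Q.[y]|.

Lemma Q2_pos y : K y -> 0 < (Q * Q).[y].
Proof. by move=> /Q0 Qy; rewrite hornerM -expr2 exprn_even_gt0. Qed.

(** The competitor is a small multiple of ['X^n]: on [K], [|Q|] is bounded away from 0 and ['X^n] is
    bounded. *)
Lemma lead_pos : 0 < P`_n.
Proof.
have [d d0 dQ] := horner_pos_compact cK Q2_pos.
have [M M0 XM] := @horner_bounded_compact K ('X^n) cK.
have c0 : 0 < Num.sqrt d / M by rewrite divr_gt0 // sqrtr_gt0.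
case: maxP => _ _ /(_ ((Num.sqrt d / M) *: 'X^n)).
rewrite coefZ coefXn eqxx mulr1 => /(_ _ _)/(lt_le_trans c0); apply.
  by rewrite (leq_trans (size_scale_leq _ _))// size_polyXn.
move=> y Ky; rewrite hornerZ normrM gtr0_norm//.
have : Num.sqrt d <= `|Q.[y]|.
  rewrite -(@ler_pXn2r _ 2%N)// ?nnegrE ?sqrtr_ge0// sqr_sqrtr ?(ltW d0)//.
  by rewrite real_normK ?num_real// expr2 -hornerM dQ.
apply: le_trans; rewrite -mulrA ger_pMr ?sqrtr_gt0//.
by rewrite ler_pdivrMl// mulr1 XM.
Qed.

Lemma P_neq0 : P != 0.
Proof. by apply: contraTneq lead_pos => ->; rewrite coef0 ltxx. Qed.

Lemma size_P : size P = n.+1.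
Proof.
apply/eqP; rewrite eqn_leq; case: maxP => -> _ _ /=; rewrite ltnNge.
by apply: contraTN lead_pos => sP; rewrite nth_default ?ltxx.
Qed.

Lemma touch_neq0 y : touch y -> P.[y] != 0.
Proof. by case=> Ky PQ; rewrite -normr_eq0 PQ normr_eq0 Q0. Qed.

(* For small [e > 0], [P - e h] keeps the top coefficient of [P] and is
   strictly dominated by [Q] on [K]; rescaling it beats [P]. *)
Lemma no_descent_direction h : (size h <= n)%N ->
  (forall y, touch y -> 0 < h.[y] * P.[y]) -> False.
Proof.
move=> sh hP; case: (maxP) => sP PQ Pmax.
pose g := Q * Q - P * P.
have PQ2 y : K y -> 0 <= g.[y].
  by move=> /PQ; rewrite !hornerE -!expr2 subr_ge0 ler_norm_sqr.
have [|d d0 dg] := @horner_max_pos_compact K g (h * P) cK.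
  move=> y Ky; have := PQ2 y Ky; rewrite le_eqVlt => /orP[/eqP gy|]; last by left.
  right; rewrite hornerM; apply: hP; split => //.
  move: gy; rewrite !hornerE -!expr2 => /esym/eqP; rewrite subr_eq0 => /eqP gy.
  by apply/eqP; rewrite -(@eqrXn2 _ 2%N)// !real_normK ?num_real// gy.
have [C C0 hC] := @horner_bounded_compact K (h * P) cK.
have [H H0 hH] := @horner_bounded_compact K (h * h) cK.
(* The bound on [e * H] serves the points where [h * P >= d]; the last bound serves those where
   [Q^2 - P^2 >= d]. *)
have [e [e0 e1 e2]] : exists e : R, [/\ 0 < e, e * H < d & 2 * e * C + e * e * H < d].
  pose e := Num.min 1 (d / (2 * (2 * C + H))).
  have D0 : 0 < 2 * (2 * C + H) by rewrite mulr_gt0// addr_gt0// mulr_gt0.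
  have e0 : 0 < e by rewrite lt_min ltr01 divr_gt0.
  have e1 : e <= 1 by rewrite ge_min lexx.
  have e2 : e * (2 * (2 * C + H)) <= d.
    by rewrite -ler_pdivlMr// ge_min lexx orbT.
  have eH : 0 < e * H by rewrite mulr_gt0.
  have eC : 0 < e * C by rewrite mulr_gt0.
  have eeH : e * (e * H) <= e * H by rewrite ger_pMl.
  exists e; split => //; nra.
pose G := P - e *: h.
have GQ y : K y -> 0 < (Q * Q - G * G).[y].
  move=> Ky; have := PQ2 y Ky; have := hC y Ky; have := hH y Ky.
  have := dg y Ky; rewrite !hornerE => gy.
  set q := Q.[y] in gy *; set p := P.[y] in gy *; set k := h.[y] in gy *.
  rewrite -!expr2 ger0_norm ?sqr_ge0// ler_norml => kH /andP[C1 C2] qp.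
  have kk : 0 <= k ^+ 2 by exact: sqr_ge0.
  have ekk : e * k ^+ 2 <= e * H by rewrite ler_pM2l.
  have eekk : e * (e * k ^+ 2) <= e * (e * H) by rewrite ler_pM2l.
  case: gy => [gd|kd].
    have : e * (- C) <= e * (k * p) by rewrite ler_pM2l.
    by nra.
  have : e * d <= e * (k * p) by rewrite ler_pM2l.
  have : e * (e * H) < e * d by rewrite ltr_pM2l.
  have : 0 < e * d by rewrite mulr_gt0.
  by nra.
have [r r0 rG] := horner_pos_compact cK GQ.
have [M M0 GM] := @horner_bounded_compact K (G * G) cK.
(* The 3 comes from [(1 + t)^2 <= 1 + 3 t] for [0 <= t <= 1]. *)
pose t := Num.min 1 (r / (3 * M)).
have M30 : 0 < 3 * M by rewrite mulr_gt0.
have t0 : 0 < t by rewrite lt_min ltr01 divr_gt0.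
have t1 : t <= 1 by rewrite ge_min lexx.
have t2 : t * (3 * M) <= r by rewrite -ler_pdivlMr// ge_min lexx orbT.
have := Pmax ((1 + t) *: G).
rewrite coefZ coefB coefZ [h`_n]nth_default// mulr0 subr0.
have sG : (size ((1 + t) *: G) <= n.+1)%N.
  rewrite (leq_trans (size_scale_leq _ _))// (leq_trans (size_polyD _ _))//.
  by rewrite geq_max sP size_polyN (leq_trans (size_scale_leq _ _))// leqW.
move=> /(_ sG); have P0 := lead_pos => PP.
suff /PP : forall y, K y -> `|((1 + t) *: G).[y]| <= `|Q.[y]|.
  by rewrite ger_pMl// gerDl leNgt t0.
move=> y Ky; rewrite ler_norm_sqr hornerZ.
have := rG y Ky; have := GM y Ky; move: (G) => G'.
rewrite !(hornerD, hornerN, hornerM) -!expr2 ger0_norm ?sqr_ge0//.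
move: G'.[y] Q.[y] => {}G' q G'M rq.
have G'0 : 0 <= G' ^+ 2 by exact: sqr_ge0.
have tG : t * G' ^+ 2 <= t * M by rewrite ler_pM2l.
have ttG : t * (t * G' ^+ 2) <= t * G' ^+ 2 by rewrite ler_piMl// mulr_ge0// ltW.
by nra.
Qed.

(** Writing [P = h * S] gives [h * P = h^2 * S], and [P] does not vanish at touching points; if [S]
    were never negative there, [h] would be a descent direction of degree below [n]. *)
Lemma factor_changes_sign S : S %| P -> (1 < size S)%N ->
  exists2 y, touch y & S.[y] < 0.
Proof.
move=> /dvdpP[h hS] sS; apply: contrapT => nS.
have h0 : h != 0 by apply: contra_neq P_neq0; rewrite hS => ->; rewrite mul0r.
have S0 : S != 0 by rewrite -size_poly_gt0 ltnW.
apply: (@no_descent_direction h).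
  by have := size_P; rewrite hS size_mul// ; move: sS; move: (size h) (size S) => a b; lia.
move=> y ty; have := touch_neq0 ty; rewrite hS hornerM mulf_eq0 => /norP[hy Sy].
rewrite mulrA -expr2 mulr_gt0// ?exprn_even_gt0// lt_neqAle eq_sym Sy leNgt.
by apply/negP => Sy'; apply: nS; exists y.
Qed.

Lemma factor_changes_sign_pos S : S %| P -> (1 < size S)%N ->
  exists2 y, touch y & 0 < S.[y].
Proof.
move=> SP sS; have [||y ty] := @factor_changes_sign (- S).
- by rewrite (eqp_dvdl _ (d2 := S))// -scaleN1r eqp_scale// oppr_eq0 oner_eq0.
- by rewrite size_polyN.
by rewrite hornerN oppr_lt0 => Sy; exists y.
Qed.

End Extremal.
End RealPolynomials.

(** * Alternation *)

Section Alternation.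
Context {R : realType}.
Implicit Types (P Q S f : {poly R}) (X Y Z : nat -> R).

Lemma prod_XsubC_uniq (s : seq R) :
  (forall z, ~~ (('X - z%:P) * ('X - z%:P) %| \prod_(x <- s) ('X - x%:P))) ->
  uniq s.
Proof.
elim: s => //= a s IH; rewrite big_cons => ns; apply/andP; split.
  apply/negP => /perm_to_rem pas; have /negP := ns a; apply.
  by rewrite dvdp_mul2l ?polyXsubC_eq0// (perm_big _ pas)/= big_cons dvdp_mulr.
apply: IH => z; apply: contra (ns z); exact: dvdp_mull.
Qed.

(** The remainder modulo the real quadratic with zeros [a + ib] and [a - ib] has degree at most 1,
    and a real polynomial of that degree with a nonreal zero is 0. *)
Lemma nonreal_root_dvdp P (a b : R) : b != 0 ->
  root (map_poly (real_complex R) P) (a +i* b) ->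
  ('X - a%:P) * ('X - a%:P) + (b * b)%:P %| P.
Proof.
move=> b0; set S := _ + _; set c := _ +i* _ => Pc.
have sXX : size (('X - a%:P) * ('X - a%:P)) = 3%N.
  by rewrite size_mul ?polyXsubC_eq0// size_XsubC.
have sS : size S = 3%N.
  by rewrite size_polyDl// sXX (leq_ltn_trans (size_polyC_leq1 _)).
have cS : (map_poly (real_complex R) S).[c] = 0.
  rewrite /S rmorphD/= rmorphM/= map_polyXsubC map_polyC/= !hornerE.
  by apply/eqP; rewrite eq_complex/=; apply/andP; split; apply/eqP; ring.
apply/modp_eq0P.
have sr : (size (P %% S)%R <= 2)%N by rewrite -ltnS -sS ltn_modp -size_poly_eq0 sS.
have : (map_poly (real_complex R) (P %% S)).[c] = 0.
  move: Pc; rewrite rootE {1}(divp_eq P S) rmorphD rmorphM/= hornerD hornerM cS.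
  by rewrite mulr0 add0r => /eqP.
rewrite (@horner_coef_wide _ 2) ?size_map_poly// 2!big_ord_recl big_ord0 addr0.
rewrite !coef_map/= expr0 mulr1 expr1 => /eqP.
rewrite eq_complex/= !(mul0r, mulr0, subr0, addr0, add0r) => /andP[].
move=> + /eqP/eqP; rewrite mulf_eq0 (negPf b0) orbF => /[swap] /eqP r1.
rewrite r1 mul0r addr0 => /eqP r0.
apply/polyP => i; rewrite coef0; case: i => [//|[//|i]].
by rewrite nth_default// (leq_trans sr).
Qed.

Section Roots.
Variables (K : set R) (Q : {poly R}) (n : nat) (P : {poly R}).
Hypotheses (cK : compact K) (Q0 : forall y, K y -> Q.[y] != 0).
Hypothesis (maxP : wextremal K Q n P).

Lemma wextremal_roots_real (c : R[i]) :
  root (map_poly (real_complex R) P) c -> c = (complex.Re c)%:C.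
Proof.
case: c => a b; have [->//|b0 Pc] := eqVneq b 0.
have [|y _] := factor_changes_sign cK Q0 maxP (nonreal_root_dvdp b0 Pc).
  rewrite size_polyDl; rewrite size_mul ?polyXsubC_eq0// !size_XsubC//.
  by rewrite (leq_ltn_trans (size_polyC_leq1 _)).
by rewrite !hornerE -!expr2 ltNge addr_ge0 ?sqr_ge0.
Qed.

(** A nonreal zero would give a positive quadratic factor of [P] and a repeated zero a square one;
    neither is ever negative. *)
Lemma wextremal_factored : exists s : seq R,
  [/\ size s = n, sorted <%R s & P = P`_n *: \prod_(x <- s) ('X - x%:P)].
Proof.
have l0 := lead_pos cK Q0 maxP; have sP := size_P cK Q0 maxP.
have [r Pr] := closed_field_poly_normal (map_poly (real_complex R) P).
have lc : lead_coef (map_poly (real_complex R) P) = (P`_n)%:C.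
  by rewrite lead_coef_map lead_coefE sP.
have rr : [seq (complex.Re c)%:C | c <- r] = r.
  rewrite -[RHS]map_id; apply/eq_in_map => c cr; apply/esym.
  apply: wextremal_roots_real; rewrite Pr rootZ ?root_prod_XsubC//.
  by rewrite lc eq_complex/= eqxx andbT gt_eqF.
pose s := [seq complex.Re c | c <- r].
have Ps : P = P`_n *: \prod_(x <- s) ('X - x%:P).
  apply: (map_inj_poly (f := real_complex R)) => //; first exact: complexI.
  rewrite {1}Pr lc map_polyZ/= rmorph_prod/= big_map; congr (_ *: _).
  rewrite -{1}rr big_map; apply: eq_bigr => c _.
  by rewrite map_polyXsubC.
have us : uniq s.
  apply: prod_XsubC_uniq => z; apply/negP => zz.
  have [||y _] := @factor_changes_sign _ _ _ _ _ cK Q0 maxP (('X - z%:P) * ('X - z%:P)).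
  - by rewrite Ps dvdpZr// gt_eqF.
  - by rewrite size_mul ?polyXsubC_eq0// !size_XsubC.
  by rewrite !hornerE -expr2 ltNge sqr_ge0.
exists (sort <=%R s); split.
- rewrite size_sort; move: sP; rewrite Ps size_scale ?gt_eqF//.
  by rewrite size_prod_XsubC => -[].
- by rewrite lt_sorted_uniq_le sort_uniq us sort_le_sorted.
by rewrite {1}Ps; congr (_ *: _); apply: perm_big; rewrite perm_sym perm_sort.
Qed.

End Roots.

Lemma prod_lt_sign (Z : nat -> R) (u : R) i n : (i <= n)%N ->
  (forall k, (k < i)%N -> Z k < u) -> (forall k, (i <= k < n)%N -> u < Z k) ->
  0 < (-1) ^+ (n - i) * \prod_(k < n) (u - Z k).
Proof.
move=> lin lo; rewrite -(subnKC lin) addKn; elim: (n - i)%N => [|m IH] hi.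
  rewrite mul1r; apply: prodr_gt0 => k _; rewrite subr_gt0 lo//.
  by case: k => k /=; rewrite addn0.
move: hi; rewrite addnS => hi; rewrite big_ord_recr/= exprS.
set e := (-1) ^+ m; set p := \prod_(_ < _) _.
have -> : -1 * e * (p * (u - Z (i + m)%N)) = e * p * (Z (i + m)%N - u) by ring.
rewrite mulr_gt0//; last by rewrite subr_gt0 hi// leq_addr ltnSn.
by apply: IH => k /andP[ik km]; apply: hi; rewrite ik ltnS ltnW.
Qed.

Section Cells.
Variables (n : nat) (Y : nat -> R).
Hypothesis Yinc : forall i j, (i < j <= n)%N -> Y i < Y j.

Definition alternates f := forall i, (i <= n)%N -> 0 < (-1) ^+ (n - i) * f.[Y i].

(** The intermediate value theorem gives one zero per cell, and the degree leaves no other. Since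
    [Y n] lies to the right of all zeros, the top coefficient has the sign of [f] at [Y n]. *)
Lemma alternates_roots f : (size f <= n.+1)%N -> alternates f ->
  exists Z, [/\ forall i, (i < n)%N -> Y i < Z i < Y i.+1,
    f = f`_n *: \prod_(i < n) ('X - (Z i)%:P) & 0 < f`_n].
Proof.
move=> sf af.
have ex i : exists z, (i < n)%N -> Y i < z < Y i.+1 /\ f.[z] = 0.
  have [ltin|] := boolP (i < n)%N; last by exists 0.
  have [||z zi fz] := @horner_ivt _ f (Y i) (Y i.+1).
  - by apply: Yinc; rewrite ltnSn ltin.
  - have := af i (ltnW ltin); have := af i.+1 ltin.
    rewrite -(subnSK ltin) exprS.
    have : (-1) ^+ (n - i.+1) * (-1) ^+ (n - i.+1) = 1 :> R by rewrite -expr2 sqrr_sign.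
    move: (_ ^+ _) f.[Y i] f.[Y i.+1] => e p q ee eq ep.
    have := mulr_gt0 eq ep.
    have -> : e * q * (-1 * e * p) = - (e * e) * (p * q) by ring.
    by rewrite ee mulN1r oppr_gt0.
  by exists z.
have {ex} [Z HZ] := choice ex.
have Zi i : (i < n)%N -> Y i < Z i < Y i.+1 by move=> /HZ[].
have f0 : f != 0 by apply: contraTneq (af 0%N isT) => ->; rewrite horner0 mulr0 ltxx.
have Zinc i j : (i < j)%N -> (j < n)%N -> Z i < Z j.
  move=> ij jn; have /andP[_ iz] := Zi i (ltn_trans ij jn).
  have /andP[jz _] := Zi j jn; rewrite (lt_trans iz)// (le_lt_trans _ jz)//.
  move: ij; rewrite leq_eqVlt => /orP[/eqP->//|ij].
  by rewrite ltW// Yinc// ij ltnW.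
have uZ : uniq (mkseq Z n).
  rewrite map_inj_in_uniq ?iota_uniq// => i j; rewrite !mem_iota !add0n/=.
  move=> jn kn; have [ij|ji|//] := ltngtP i j.
    by have := Zinc i j ij kn => /[swap] ->; rewrite ltxx.
  by have := Zinc j i ji jn => /[swap] ->; rewrite ltxx.
have aZ : all (root f) (mkseq Z n).
  rewrite all_map; apply/allP => i; rewrite mem_iota add0n => /= ltin.
  by apply/rootP; case: (HZ i ltin).
have szf : size f = n.+1.
  apply/eqP; rewrite eqn_leq sf/=.
  by have := max_poly_roots f0 aZ uZ; rewrite size_mkseq.
have fE : f = f`_n *: \prod_(i < n) ('X - (Z i)%:P).
  have := @all_roots_prod_XsubC _ f (mkseq Z n); rewrite size_mkseq lead_coefE szf.
  rewrite uniq_rootsE => /(_ erefl aZ uZ) {1}->.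
  by rewrite big_map -(big_mkord xpredT (fun i => 'X - (Z i)%:P)) /index_iota subn0.
exists Z; split => //; have := af n (leqnn n); rewrite subnn mul1r {1}fE hornerZ.
have : 0 < \prod_(i < n) (Y n - Z i).
  apply: prodr_gt0 => i _; rewrite subr_gt0; have /andP[_] := Zi i (ltn_ord i).
  move/lt_le_trans; apply; have := ltn_ord i; rewrite leq_eqVlt => /orP[/eqP->//|ij].
  by rewrite ltW// Yinc// ij leqnn.
rewrite horner_prod; under [X in _ * X]eq_bigr do rewrite hornerXsubC.
by move=> p0; rewrite pmulr_lgt0.
Qed.
End Cells.

End Alternation.

(** * Equioscillation systems *)

Section AlternationSystem.
Context {R : realType}.
Implicit Types (P Q S f : {poly R}) (X Y Z : nat -> R) (K : set R).

(* [P] vanishes at [X i] between [Y i] and [Y i.+1], and [P / Q] equioscillates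
   between [-1] and [1], up to the signs of [Q], at the [n.+1] points [Y i]. *)
Record altsys (n : nat) P Q X Y : Prop := Altsys {
  alt_lt : forall i, (i < n)%N -> Y i < X i < Y i.+1;
  alt_touch : forall i, (i <= n)%N -> `|P.[Y i]| = `|Q.[Y i]|;
  alt_factor : P = P`_n *: \prod_(i < n) ('X - (X i)%:P);
  alt_lead : 0 < P`_n;
  alt_size : (size Q <= n.+1)%N }.

(** Each oscillation point comes from a suitable factor of [P]: the linear factors of the extreme
    zeros give the two outer points, and the product of two consecutive linear factors, negative
    only between its zeros, gives the inner ones. *)
Lemma wextremal_altsys K Q n P : compact K -> (forall y, K y -> Q.[y] != 0) ->
  (size Q <= n.+1)%N -> (0 < n)%N -> wextremal K Q n P ->
  exists X Y, altsys n P Q X Y /\ forall i, (i <= n)%N -> touch K Q P (Y i).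
Proof.
move=> cK Q0 sQ n0 maxP; have l0 := lead_pos cK Q0 maxP.
have [s [ss sos Ps]] := wextremal_factored cK Q0 maxP.
have PX : P = P`_n *: \prod_(i < n) ('X - (nth 0 s i)%:P).
  rewrite {1}Ps; congr (_ *: _); rewrite (big_nth 0) ss.
  by rewrite -(big_mkord xpredT (fun i => 'X - (nth 0 s i)%:P)).
have Xlt i j : (i < j < n)%N -> nth 0 s i < nth 0 s j.
  move=> /andP[ij jn]; rewrite (sorted_ltn_nth lt_trans)// inE ss//.
  exact: ltn_trans jn.
have dX i : (i < n)%N -> ('X - (nth 0 s i)%:P) %| P.
  move=> ltin; rewrite dvdp_XsubCl rootE PX hornerZ horner_prod (bigD1 (Ordinal ltin))//=.
  by rewrite hornerXsubC subrr mul0r mulr0.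
have ex i : exists y, (i <= n)%N -> [/\ touch K Q P y,
    (0 < i)%N -> nth 0 s i.-1 < y & (i < n)%N -> y < nth 0 s i].
  case: i => [|i].
    have [|y ty] := factor_changes_sign cK Q0 maxP (dX 0%N n0).
      by rewrite size_XsubC.
    by rewrite hornerXsubC subr_lt0 => yx; exists y.
  have [ltin|nin] := boolP (i.+1 < n)%N; last first.
    have [ltin|] := boolP (i < n)%N; last by exists 0.
    have [|y ty] := factor_changes_sign_pos cK Q0 maxP (dX i ltin).
      by rewrite size_XsubC.
    by rewrite hornerXsubC subr_gt0 => yx; exists y.
  have xx : nth 0 s i < nth 0 s i.+1 by apply: Xlt; rewrite ltnSn.
  have [||y ty] := @factor_changes_sign _ _ _ _ _ cK Q0 maxP
      (('X - (nth 0 s i)%:P) * ('X - (nth 0 s i.+1)%:P)).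
  - rewrite Gauss_dvdp ?dX ?(ltnW ltin)// coprimep_XsubC root_XsubC.
    by rewrite gt_eqF.
  - by rewrite size_mul ?polyXsubC_eq0// !size_XsubC.
  rewrite !hornerE => yxx; exists y => _; split => //= _.
    rewrite ltNge; apply/negP => yx; move: yxx; rewrite ltNge.
    by rewrite mulr_le0 ?subr_le0// (le_trans yx)// ltW.
  rewrite ltNge; apply/negP => yx; move: yxx; rewrite ltNge.
  by rewrite mulr_ge0 ?subr_ge0// (le_trans _ yx)// ltW.
have {ex} [Y HY] := choice ex.
exists (nth 0 s), Y; split; last by move=> i /HY[].
split => //.
- move=> i ltin; have [_ _ ->//] := HY i (ltnW ltin).
  by have [_ /(_ isT) ->] := HY i.+1 ltin.
- by move=> i /HY[[]].
Qed.

Section Theory.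
Variables (n : nat) (P Q : {poly R}) (X Y : nat -> R).
Hypothesis H : altsys n P Q X Y.

Lemma alt_inc i j : (i < j <= n)%N -> Y i < Y j.
Proof.
elim: j => [|j IH]; first by rewrite andbC.
rewrite ltnS leq_eqVlt => /andP[/orP[/eqP->|ij] jn].
  by have /andP[/lt_trans] := alt_lt H jn; apply.
by have /andP[/lt_trans h /h] := alt_lt H jn; apply: lt_trans; rewrite IH// ij ltnW.
Qed.

Lemma alt_inc_le i j : (i <= j <= n)%N -> Y i <= Y j.
Proof.
move=> /andP[]; rewrite leq_eqVlt => /orP[/eqP-> _ //|ij jn].
by rewrite ltW// alt_inc// ij.
Qed.

Lemma alternates_P : alternates n Y P.
Proof.
move=> i lin; rewrite (alt_factor H) hornerZ horner_prod.
under [X in _ * (_ * X)]eq_bigr do rewrite hornerXsubC.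
rewrite mulrCA mulr_gt0// ?(alt_lead H)//; apply: prod_lt_sign => // k.
  move=> ki; have /andP[_ /lt_le_trans] := alt_lt H (leq_trans ki lin); apply.
  by rewrite alt_inc_le// ki.
move=> /andP[ik kn]; have /andP[h _] := alt_lt H kn; apply: le_lt_trans h.
by rewrite alt_inc_le// ik ltnW.
Qed.

Lemma alt_neq0 i : (i <= n)%N -> P.[Y i] != 0.
Proof.
by move=> /alternates_P; apply: contraTneq => ->; rewrite mulr0 ltxx.
Qed.

(** At an oscillation point [|t Q| < |Q| = |P|], so the sign of [P] decides. *)
Lemma alternates_pencil (t : R) : `|t| < 1 -> alternates n Y (P - t *: Q).
Proof.
move=> t1 i lin; have Pi := alternates_P lin.
have p0 : 0 < `|P.[Y i]| by rewrite normr_gt0 alt_neq0.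
have e1 : `|(-1) ^+ (n - i) : R| = 1 by rewrite normrX normrN1 expr1n.
have : `|(-1) ^+ (n - i) * (t * Q.[Y i])| < (-1) ^+ (n - i) * P.[Y i].
  rewrite -[ltRHS]gtr0_norm// !normrM e1 !mul1r -(alt_touch H lin).
  by rewrite gtr_pMl.
rewrite hornerD hornerN hornerZ mulrBr subr_gt0.
by apply: le_lt_trans; rewrite ler_norm.
Qed.

Lemma size_pencil (t : R) : (size (P - t *: Q)%R <= n.+1)%N.
Proof.
rewrite (leq_trans (size_polyD _ _))// geq_max size_polyN.
rewrite (leq_trans (size_scale_leq _ _)) ?(alt_size H)// andbT.
rewrite (alt_factor H) (leq_trans (size_scale_leq _ _))//.
by rewrite size_prod_XsubC /index_enum unlock -enumT size_enum_ord.
Qed.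

End Theory.
End AlternationSystem.

(** * Zeros of the pencil [P - t Q] for [|t| < 1] *)

Section Pencil.
Context {R : realType}.
Variables (n : nat) (P Q : {poly R}) (X Y : nat -> R).
Hypothesis H : altsys n P Q X Y.
Implicit Types t : R.

Lemma pencil_roots t : `|t| < 1 ->
  exists Z, [/\ forall i, (i < n)%N -> Y i < Z i < Y i.+1,
    P - t *: Q = (P - t *: Q)`_n *: \prod_(i < n) ('X - (Z i)%:P) &
    0 < (P - t *: Q)`_n].
Proof.
move=> t1; apply: alternates_roots.
- exact: alt_inc H.
- exact: size_pencil H t.
- by apply: (alternates_pencil H).
Qed.

Lemma pencil_eval t (Z : nat -> R) u :
  P - t *: Q = (P - t *: Q)`_n *: \prod_(i < n) ('X - (Z i)%:P) ->
  (P - t *: Q).[u] = (P - t *: Q)`_n * \prod_(i < n) (u - Z i).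
Proof.
move=> ZE; rewrite {1}ZE hornerZ horner_prod; congr (_ * _).
by apply: eq_bigr => i _; rewrite hornerXsubC.
Qed.

Lemma pencil_rootE t (Z : nat -> R) u :
  P - t *: Q = (P - t *: Q)`_n *: \prod_(i < n) ('X - (Z i)%:P) ->
  0 < (P - t *: Q)`_n ->
  (P - t *: Q).[u] = 0 -> exists2 i, (i < n)%N & u = Z i.
Proof.
move=> /pencil_eval -> l0 /eqP; rewrite mulf_eq0 gt_eqF//=.
by rewrite prodf_seq_eq0 => /hasP[i _]/=; rewrite subr_eq0 => /eqP ->; exists i.
Qed.

Lemma pencil_root_cell t u : `|t| < 1 -> (P - t *: Q).[u] = 0 ->
  exists2 i, (i < n)%N & Y i < u < Y i.+1.
Proof.
move=> /pencil_roots[Z [YZ ZE l0]] /(pencil_rootE ZE l0)[i ltin ->].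
by exists i => //; exact: YZ.
Qed.

(** Since [u] is the only zero of this member of the pencil in its cell, the sign at [Y i] persists
    up to [u] and the opposite sign holds beyond. All monotonicity statements derive from this. *)
Lemma pencil_sign t i u v : `|t| < 1 -> (i < n)%N -> (P - t *: Q).[u] = 0 ->
  Y i < u < Y i.+1 -> Y i <= v <= Y i.+1 ->
  (v < u -> 0 < (-1) ^+ (n - i) * (P - t *: Q).[v]) /\
  (u < v -> (-1) ^+ (n - i) * (P - t *: Q).[v] < 0).
Proof.
move=> t1 ltin Pu ui vi.
have [Z [YZ ZE l0]] := pencil_roots t1.
have uZ : u = Z i.
  have [k kn uk] := pencil_rootE ZE l0 Pu; have := YZ k kn.
  rewrite -uk; move: ui => /andP[lo hi] /andP[lo' hi'].
  have [ik|ik|-> //] := ltngtP i k.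
  - have : Y i.+1 <= Y k by rewrite (alt_inc_le H)// ik ltnW.
    by lra.
  - have : Y k.+1 <= Y i by rewrite (alt_inc_le H)// ik ltnW.
    by lra.
have lo k : (k < i)%N -> Z k < v.
  move=> ki; have /andP[_ h] := YZ k (ltn_trans ki ltin).
  apply: lt_le_trans h _; have /andP[h _] := vi; apply: le_trans h.
  by rewrite (alt_inc_le H)// ki ltnW.
have hi k : (i < k < n)%N -> v < Z k.
  move=> /andP[ik kn]; have /andP[h _] := YZ k kn; apply: le_lt_trans h.
  have /andP[_ h] := vi; apply: le_trans h _.
  by rewrite (alt_inc_le H)// ik ltnW.
rewrite (pencil_eval _ ZE); move: (_`_n) l0 => l l0.
rewrite mulrCA; split => vu.
  rewrite pmulr_rgt0//; apply: prod_lt_sign => //; first exact: ltnW.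
  move=> k /andP[]; rewrite leq_eqVlt => /orP[/eqP <- _|ik kn]; first by rewrite -uZ.
  by apply: hi; rewrite ik.
have : 0 < (-1) ^+ (n - i.+1) * \prod_(k < n) (v - Z k).
  apply: prod_lt_sign => // k; rewrite ltnS leq_eqVlt => /orP[/eqP ->|]; last exact: lo.
  by rewrite -uZ.
rewrite -(subnSK ltin) exprS -mulrA mulN1r mulrN oppr_lt0 => ?.
by rewrite mulr_gt0.
Qed.
End Pencil.

Section PencilRoots.
Context {R : realType}.
Variables (n : nat) (P Q : {poly R}) (X Y : nat -> R).
Hypothesis H : altsys n P Q X Y.

Lemma pencil_root_real t (c : R[i]) : `|t| < 1 ->
  root (map_poly (real_complex R) (P - t *: Q)) c -> c = (complex.Re c)%:C.
Proof.
move=> t1; have [Z [_ ZE l0]] := pencil_roots H t1.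
rewrite ZE map_polyZ/= rootZ; last by rewrite eq_complex/= eqxx andbT gt_eqF.
rewrite rmorph_prod/= rootE horner_prod prodf_seq_eq0 => /hasP[i _]/=.
by rewrite map_polyXsubC hornerXsubC subr_eq0 => /eqP ->.
Qed.

(** Distinct zeros of one member lie in distinct cells. One of the two will be a common zero of [P]
    and [Q], which is a zero for every [t]. *)
Lemma pencil_roots_separated t u v : `|t| < 1 -> u < v ->
  (P - t *: Q).[u] = 0 -> (P - t *: Q).[v] = 0 ->
  exists2 i, (i <= n)%N & u < Y i < v.
Proof.
move=> t1 uv Pu Pv.
have [i ltin ui] := pencil_root_cell H t1 Pu.
have [j ltjn vj] := pencil_root_cell H t1 Pv.
have [ij|ij|ij] := ltngtP i j.
- exists i.+1 => //; have := andP ui; have := andP vj => -[vj1 _] [_ ->]/=.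
  by apply: le_lt_trans vj1; rewrite (alt_inc_le H)// ij ltnW.
- have : Y j.+1 <= Y i by rewrite (alt_inc_le H)// ij ltnW.
  by move: ui vj => /andP[? _] /andP[_ ?]; lra.
- move: vj; rewrite -ij => vj.
  have /andP[? ?] := vj.
  have [|_ /(_ uv)] := @pencil_sign _ _ _ _ _ _ H t i u v t1 ltin Pu ui.
    by rewrite !ltW.
  by rewrite Pv mulr0 ltxx.
Qed.

End PencilRoots.

(** * Cancelling common zeros *)

Section Reduction.
Context {R : realType}.

Lemma prod_XsubC_coef n (c : nat -> R) :
  (\prod_(i < n) ('X - (c i)%:P))`_n = 1.
Proof.
have /monicP := monic_prod_XsubC (index_enum 'I_n) xpredT (fun i => c (val i)).
by rewrite lead_coefE size_prod_XsubC /index_enum unlock -enumT size_enum_ord.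
Qed.

(* A common root [X i] of [P] and [Q] is divided out together with the
   oscillation point [Y i.+1]. *)
Lemma altsys_reduce n (P Q : {poly R}) X Y : altsys n P Q X Y ->
  exists N p q g X' Y', [/\ altsys N p q X' Y', coprimep p q, P = p * g,
    Q = q * g & forall k, (k <= N)%N -> exists2 j, (j <= n)%N & Y' k = Y j].
Proof.
elim: n P Q X Y => [|n IH] P Q X Y H.
  exists 0%N, P, Q, 1, X, Y; split; rewrite ?mulr1//; last by move=> k; exists k.
  rewrite (alt_factor H) big_ord0 coprimepZl ?coprime1p//.
  by rewrite gt_eqF// (alt_lead H).
have [[i ltin Qi]|nQ] := pselect (exists2 i, (i < n.+1)%N & Q.[X i] = 0); last first.
  exists n.+1, P, Q, 1, X, Y; split; rewrite ?mulr1//; last by move=> k; exists k.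
  rewrite (alt_factor H) coprimepZl ?gt_eqF ?(alt_lead H)//.
  apply: (big_ind (fun f => coprimep f Q)) => [|f g|k _].
  - exact: coprime1p.
  - by rewrite coprimepMl => -> ->.
  - by rewrite coprimep_sym coprimep_XsubC; apply/negP => /rootP Qk; apply: nQ; exists k.
pose p := P`_n.+1 *: \prod_(k < n) ('X - (X (bump i k))%:P).
have pn : p`_n = P`_n.+1 by rewrite coefZ (prod_XsubC_coef n (fun k => X (bump i k))) mulr1.
have PE : P = p * ('X - (X i)%:P).
  by rewrite {1}(alt_factor H) (bigD1_ord (Ordinal ltin))//= -scalerAl mulrC.
have /dvdpP[q QE] : 'X - (X i)%:P %| Q by rewrite dvdp_XsubCl; apply/rootP.
have Yb k : (k <= n)%N -> (bump i.+1 k <= n.+1)%N by rewrite /bump; case: leqP => /=; lia.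
have Hpq : altsys n p q (fun k => X (bump i k)) (fun k => Y (bump i.+1 k)).
  split.
  (* If [i < n], cell [i] of the new system is the union of the old cells [i] and [i.+1] and keeps
     the zero [X i.+1]; if [i = n], the last cell is simply dropped. *)
  - move=> k kn; have [ik|ki] := leqP i k.
      have -> : bump i k = k.+1 by rewrite /bump ik.
      have -> : bump i.+1 k.+1 = k.+2 by rewrite /bump ltnS ik.
      have /andP[h1 ->] := alt_lt H (i := k.+1) kn; rewrite andbT.
      rewrite /bump; case: (i < k)%N; rewrite /= ?add1n// add0n.
      by rewrite (lt_trans _ h1)// (alt_inc H)// ltnSn ltnS ltnW.
    have -> : bump i k = k by rewrite /bump leqNgt ki.
    have -> : bump i.+1 k.+1 = k.+1 by rewrite /bump ltnS leqNgt ki.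
    have -> : bump i.+1 k = k by rewrite /bump ltnNge (ltnW ki).
    by rewrite (alt_lt H)// ltnS ltnW.
  (* [P] does not vanish at the remaining points, hence neither does the cancelled factor, and
     [|P| = |Q|] can be divided by it. *)
  - move=> k kn; have := alt_touch H (Yb k kn).
    rewrite PE QE !hornerM !normrM => /mulIf; apply.
    rewrite normr_eq0 hornerXsubC subr_eq0; apply/negP => /eqP Yi.
    have := alt_neq0 H (Yb k kn).
    by rewrite PE hornerM hornerXsubC Yi subrr mulr0 eqxx.
  - by rewrite pn.
  - by rewrite pn (alt_lead H).
  - have [->|q0] := eqVneq q 0; first by rewrite size_poly0.
    have := alt_size H; rewrite QE size_mul ?polyXsubC_eq0// size_XsubC.
    by rewrite addn2.
have [N [p' [q' [g [X' [Y' [H' cop pE qE YY]]]]]]] := IH _ _ _ _ Hpq.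
exists N, p', q', (g * ('X - (X i)%:P)), X', Y'; split => //.
- by rewrite PE pE mulrA.
- by rewrite QE qE mulrA.
- by move=> k /YY[j jn ->]; exists (bump i.+1 j) => //; exact: Yb.
Qed.

End Reduction.

(** * Bands *)

Section Bands.
Context {R : realType}.
Variables (N : nat) (p q : {poly R}) (X Y : nat -> R).
Hypotheses (H : altsys N p q X Y) (cop : coprimep p q).

(** Kept free of division: the strict inequality already excludes the zeros of [q]. *)
Definition inband i w := Y i < w < Y i.+1 /\ `|p.[w]| < `|q.[w]|.

Let f w := p.[w] / q.[w].

Lemma band_den i w : inband i w -> q.[w] != 0.
Proof. by move=> [_]; apply: contraTneq => ->; rewrite normr0 ltNge normr_ge0. Qed.

Lemma coprimep_den w t : p.[w] = t * q.[w] -> q.[w] != 0.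
Proof.
move=> pq; apply/negP => q0.
have rp : root p w by rewrite rootE pq (eqP q0) mulr0.
by have := coprimep_root cop rp; rewrite q0.
Qed.

Lemma band_val i w : inband i w -> `|f w| < 1 /\ (p - f w *: q).[w] = 0.
Proof.
move=> bw; have q0 := band_den bw; case: bw => _ pq; split.
  by rewrite normrM normfV ltr_pdivrMr ?normr_gt0// mul1r.
by rewrite hornerD hornerN hornerZ divfK// subrr.
Qed.

(** Coprimality enters here: the zero of [p - t q] in the cell could otherwise be a zero of [q],
    where [p / q] does not take the value [t]. *)
Lemma band_solution i t : (i < N)%N -> `|t| < 1 ->
  exists2 w, inband i w & p.[w] = t * q.[w].
Proof.
move=> ltin t1; have [Z [YZ ZE l0]] := pencil_roots H t1.
have pZ : p.[Z i] = t * q.[Z i].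
  have /eqP := pencil_eval (Z i) ZE.
  rewrite (bigD1 (Ordinal ltin))//= subrr mul0r mulr0.
  by rewrite hornerD hornerN hornerZ subr_eq0 => /eqP.
exists (Z i) => //; split; first exact: YZ.
by rewrite pZ normrM gtr_pMl// normr_gt0 (coprimep_den pZ).
Qed.

Section OneBand.
Variable i : nat.
Hypothesis ltin : (i < N)%N.
Let sg : R := (-1) ^+ (N - i).

Lemma band_cross_right u v : inband i u -> u < v -> Y i <= v <= Y i.+1 ->
  sg * (p.[v] - f u * q.[v]) < 0.
Proof.
move=> bu uv vi; have [fu pu] := band_val bu; have [ui _] := bu.
have [_ /(_ uv)] := @pencil_sign _ _ _ _ _ _ H _ _ _ _ fu ltin pu ui vi.
by rewrite hornerD hornerN hornerZ.
Qed.

Lemma band_cross_left u v : inband i u -> v < u -> Y i <= v <= Y i.+1 ->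
  0 < sg * (p.[v] - f u * q.[v]).
Proof.
move=> bu uv vi; have [fu pu] := band_val bu; have [ui _] := bu.
have [/(_ uv) + _] := @pencil_sign _ _ _ _ _ _ H _ _ _ _ fu ltin pu ui vi.
by rewrite hornerD hornerN hornerZ.
Qed.

(** The pencil through [u] evaluated at [v] and the pencil through [v] evaluated at [u] give the
    signs of [(f v - f u) * q v] and [(f u - f v) * q u]. They are opposite, so [f u] and [f v]
    differ and [q] has the same sign at both points. *)
Lemma band_mono u v : inband i u -> inband i v -> u < v ->
  0 < q.[u] * q.[v] /\ sg * q.[u] * (f v - f u) < 0.
Proof.
move=> bu bv uv.
have ci w : inband i w -> Y i <= w <= Y i.+1 by case=> /andP[? ?] _; rewrite !ltW.
have := band_cross_right bu uv (ci _ bv); have := band_cross_left bv uv (ci _ bu).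
have -> : p.[v] = f v * q.[v] by rewrite divfK// (band_den bv).
have -> : p.[u] = f u * q.[u] by rewrite divfK// (band_den bu).
rewrite -!mulrBl; move: (f u) (f v) q.[u] q.[v] => a b c d.
set e := sg; have e2 : e * e = 1 by rewrite /e /sg -expr2 sqrr_sign.
move=> h1 h2; split; last by move: h1; lra.
have : 0 < (e * ((a - b) * c)) * - (e * ((b - a) * d)) by rewrite mulr_gt0// oppr_gt0.
have -> : (e * ((a - b) * c)) * - (e * ((b - a) * d)) = (e * e) * (a - b) ^+ 2 * (c * d) by ring.
rewrite e2 mul1r pmulr_rgt0// lt_neqAle sqr_ge0 andbT eq_sym sqrf_eq0.
by apply: contraTneq h1 => ->; rewrite mul0r mulr0 ltxx.
Qed.

(** The pencils through [u] and through [v] squeeze [sg * p] at [w] between [f v * (sg * q)] and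
    [f u * (sg * q)]. As [f u] and [f v] lie in [(-1, 1)], this gives [|p| < |q|] whatever the sign
    of [q], and [q = 0] is contradictory. *)
Lemma band_convex u v w : inband i u -> inband i v -> u < w < v -> inband i w.
Proof.
move=> bu bv /andP[uw wv].
have [[/andP[u1 u2] _] [/andP[v1 v2] _]] := (bu, bv).
have w1 : Y i < w by exact: lt_trans uw.
have w2 : w < Y i.+1 by exact: lt_trans wv _.
split; first by rewrite w1 w2.
have wi : Y i <= w <= Y i.+1 by rewrite !ltW.
have := band_cross_right bu uw wi; have := band_cross_left bv wv wi.
have [fu _] := band_val bu; have [fv _] := band_val bv.
move: fu fv; move: (f u) (f v) p.[w] q.[w] => a b c d.
have n1 : `|sg * d| = `|d| by rewrite normrM normrX normrN1 expr1n mul1r.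
have n2 : `|sg * c| = `|c| by rewrite normrM normrX normrN1 expr1n mul1r.
rewrite -n1 -n2 !mulrBr ![sg * (_ * d)]mulrCA.
move: (sg * c) (sg * d) {n1 n2} => {}c {}d.
rewrite subr_lt0 subr_gt0 !ltr_norml => /andP[a1 a2] /andP[b1 b2] bc ca.
case: (ltrgtP d 0) => d0.
- by rewrite (ltr0_norm d0) opprK; apply/andP; split; nra.
- by rewrite (gtr0_norm d0); apply/andP; split; nra.
- by move: bc ca; rewrite d0 !mulr0; lra.
Qed.

End OneBand.
End Bands.

(** * The ends of a band *)

Section BandEnds.
Context {R : realType}.

Lemma horner_ge0_itv_closure (h : {poly R}) (a b : R) : a < b ->
  (forall w, a < w < b -> 0 <= h.[w]) -> 0 <= h.[a] /\ 0 <= h.[b].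
Proof.
move=> ab h0; have near_lt c : h.[c] < 0 ->
    exists2 e : R, 0 < e & forall w, `|c - w| < e -> h.[w] < 0.
  move=> hc; have /nbhs_ballP[e /= e0 be] : nbhs c [set w | h.[w] < 0].
    by have /cvgr_lt := @continuous_horner R h c; exact.
  by exists e.
split; rewrite leNgt; apply/negP => /near_lt[e e0 he].
- pose w := a + Num.min ((b - a) / 2) (e / 2).
  have m0 : 0 < Num.min ((b - a) / 2) (e / 2) by rewrite lt_min; apply/andP; split; lra.
  have m1 : Num.min ((b - a) / 2) (e / 2) <= (b - a) / 2 by rewrite ge_min lexx.
  have m2 : Num.min ((b - a) / 2) (e / 2) <= e / 2 by rewrite ge_min lexx orbT.
  have /h0 : a < w < b by rewrite /w; apply/andP; split; lra.
  by rewrite leNgt he// /w opprD addrA subrr sub0r normrN gtr0_norm//; lra.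
- pose w := b - Num.min ((b - a) / 2) (e / 2).
  have m0 : 0 < Num.min ((b - a) / 2) (e / 2) by rewrite lt_min; apply/andP; split; lra.
  have m1 : Num.min ((b - a) / 2) (e / 2) <= (b - a) / 2 by rewrite ge_min lexx.
  have m2 : Num.min ((b - a) / 2) (e / 2) <= e / 2 by rewrite ge_min lexx orbT.
  have /h0 : a < w < b by rewrite /w; apply/andP; split; lra.
  by rewrite leNgt he// /w opprB addrCA subrr addr0 gtr0_norm//; lra.
Qed.

Variables (N : nat) (p q : {poly R}) (X Y : nat -> R).
Hypotheses (H : altsys N p q X Y) (cop : coprimep p q).
Local Notation inband := (inband p q Y).
Let f w := p.[w] / q.[w].

(** [e] is the direction in which [p / q] varies. It depends on the sign of [q] on the band, so it
    need not alternate from one band to the next. *)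
Record is_band i (a b e : R) : Prop := IsBand {
  band_sign : e = 1 \/ e = -1;
  band_lt : a < b;
  band_lo : Y i <= a;
  band_hi : b <= Y i.+1;
  band_mem : forall w, a < w < b <-> inband i w;
  band_incr : forall u v, a < u -> u < v -> v < b -> e * f u < e * f v;
  band_left : p.[a] = - e * q.[a];
  band_right : p.[b] = e * q.[b] }.

(** By convexity the band is the interval between its infimum and its supremum. Neither end belongs
    to it, because every value in [(-1, 1)] is attained and [p / q] is monotone. *)
Lemma band_exists i : (i < N)%N -> exists a b e, is_band i a b e.
Proof.
move=> ltin; pose sg : R := (-1) ^+ (N - i).
have sg2 : sg * sg = 1 by rewrite -expr2 sqrr_sign.
have [|w0 bw0] := @band_solution _ _ _ _ _ _ H cop i 0 ltin.
  by rewrite normr0.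
rewrite mul0r => pw0.
(* By [band_mono], [p / q] increases exactly where [sg * q < 0]; the sign of [q] is constant on the
   band, so it is read at the zero [w0] of [p]. *)
pose e : R := if sg * q.[w0] < 0 then 1 else -1.
have esg : e = 1 \/ e = -1 by rewrite /e; case: ifP; [left|right].
have e2 : e * e = 1 by case: esg => ->; rewrite ?mulr1// mulrNN mulr1.
have eq0 u : inband i u -> e * (sg * q.[u]) < 0.
  move=> bu; have q0 := band_den bw0.
  have s0 : sg * q.[w0] != 0 by rewrite mulf_neq0// -sqrf_eq0 expr2 sg2 oner_eq0.
  have : 0 < (sg * q.[u]) * (sg * q.[w0]).
    have -> : (sg * q.[u]) * (sg * q.[w0]) = q.[u] * q.[w0].
      by rewrite mulrACA sg2 mul1r.
    have [uw|wu|->] := ltgtP u w0.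
    - by have [] := band_mono H ltin bu bw0 uw.
    - by have [] := band_mono H ltin bw0 bu wu; rewrite mulrC.
    - by rewrite -expr2 exprn_even_gt0.
  rewrite /e; case: ifPn => [s1|]; first by rewrite nmulr_lgt0// mul1r.
  rewrite -leNgt le_eqVlt eq_sym (negPf s0)/= => s1.
  by rewrite pmulr_lgt0// mulN1r oppr_lt0.
have mono u v : inband i u -> inband i v -> u < v -> e * f u < e * f v.
  move=> bu bv uv; have := eq0 u bu; have [_] := band_mono H ltin bu bv uv.
  rewrite -/sg -/(f u) -/(f v); move: (sg * q.[u]) (f u) (f v) => c a b h1 h2.
  rewrite -subr_gt0 -mulrBr.
  have : 0 < (c * (b - a)) * (e * c) by rewrite nmulr_rgt0.
  have -> : (c * (b - a)) * (e * c) = c ^+ 2 * (e * (b - a)) by ring.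
  by rewrite pmulr_rgt0// exprn_even_gt0//=; apply: contraTneq h2 => ->; rewrite mulr0 ltxx.
have fval u t : inband i u -> p.[u] = t * q.[u] -> f u = t.
  by move=> /band_den q0 pu; rewrite /f pu mulfK.
have en : `|e| = 1 by case: esg => ->; rewrite ?normrN normr1.
(* The value halfway between [e * f u] and 1 is attained in the band, and by monotonicity further to
   the right. *)
have above u : inband i u -> exists2 v, inband i v & u < v.
  move=> bu; have [fu _] := band_val bu; rewrite -/(f u) in fu.
  have efu : e * f u < 1 by rewrite (le_lt_trans (ler_norm _))// normrM en mul1r.
  have efu' : -1 < e * f u.
    by have := ler_norm (- (e * f u)); rewrite normrN normrM en mul1r; lra.
  have [|v bv pv] := @band_solution _ _ _ _ _ _ H cop i (e * ((1 + e * f u) / 2)) ltin.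
    by rewrite normrM en mul1r ltr_norml; apply/andP; split; lra.
  have efv : e * f v = (1 + e * f u) / 2 by rewrite (fval _ _ bv pv) mulrA e2 mul1r.
  exists v => //; have [//|vu|uv] := ltgtP u v; last by move: efv efu efu'; rewrite uv; lra.
  by have := mono v u bv bu vu; lra.
have below u : inband i u -> exists2 v, inband i v & v < u.
  move=> bu; have [fu _] := band_val bu; rewrite -/(f u) in fu.
  have efu : e * f u < 1 by rewrite (le_lt_trans (ler_norm _))// normrM en mul1r.
  have efu' : -1 < e * f u.
    by have := ler_norm (- (e * f u)); rewrite normrN normrM en mul1r; lra.
  have [|v bv pv] := @band_solution _ _ _ _ _ _ H cop i (e * ((-1 + e * f u) / 2)) ltin.
    by rewrite normrM en mul1r ltr_norml; apply/andP; split; lra.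
  have efv : e * f v = (-1 + e * f u) / 2 by rewrite (fval _ _ bv pv) mulrA e2 mul1r.
  exists v => //; have [uv|//|uv] := ltgtP u v; last by move: efv efu efu'; rewrite uv; lra.
  by have := mono u v bu bv uv; lra.
pose S := [set w | inband i w].
have S0 : S !=set0 by exists w0.
have ubS : ubound S (Y i.+1) by move=> w [/andP[_ /ltW]].
have lbS : lbound S (Y i) by move=> w [/andP[/ltW]].
have hs : has_sup S by split => //; exists (Y i.+1).
have hi : has_inf S by split => //; exists (Y i).
pose a := inf S; pose b := sup S.
have ia : Y i <= a by apply: lb_le_inf.
have ib : b <= Y i.+1 by apply: ge_sup.
have mem w : a < w < b <-> inband i w.
  split=> [/andP[aw wb]|bw].
    have [u Su uw] := inf_lt hi.1 aw; have [v Sv wv] := sup_gt hs.1 wb.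
    by apply: (band_convex H ltin Su Sv); rewrite uw wv.
  have [v bv wv] := above w bw; have [u bu uw] := below w bw.
  apply/andP; split.
    by apply: le_lt_trans uw; apply: ge_inf => //; exact: hi.2.
  by apply: lt_le_trans wv _; apply: ub_le_sup => //; exact: hs.2.
have aw0b : a < w0 < b by apply/mem.
have /andP[aw0 w0b] := aw0b.
have ab : a < b by exact: lt_trans w0b.
(* By continuity the sign of [q] on the band persists weakly at its ends; with the sign of [p] there
   it decides between [p = q] and [p = - q]. *)
have [qa qb] : 0 <= (- (e * sg) *: q).[a] /\ 0 <= (- (e * sg) *: q).[b].
  apply: horner_ge0_itv_closure => // w /mem /eq0.
  by rewrite hornerZ mulNr oppr_ge0 -mulrA => /ltW.
have [ga gb] : 0 <= (q * q - p * p).[a] /\ 0 <= (q * q - p * p).[b].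
  apply: horner_ge0_itv_closure => // w /mem[_ pq].
  by rewrite !hornerE -!expr2 subr_ge0 -ler_norm_sqr ltW.
(* An end that is an oscillation point has [|p| = |q|] by alternation; any other end lies inside the
   cell and would belong to the band if [|p| < |q|]. *)
have ends c : ~ (a < c < b) -> Y i <= c <= Y i.+1 -> 0 <= (q * q - p * p).[c] ->
    `|p.[c]| = `|q.[c]|.
  move=> nc /andP[]; rewrite le_eqVlt => /orP[/eqP <- _ _|ic].
    exact/(alt_touch H)/ltnW.
  rewrite le_eqVlt => /orP[/eqP -> _|ci]; first exact: (alt_touch H).
  rewrite !hornerE -!expr2 subr_ge0 -ler_norm_sqr le_eqVlt => /orP[/eqP//|pq].
  by case: nc; apply/mem; split => //; rewrite ic ci.
have pqa : `|p.[a]| = `|q.[a]|.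
  by apply: ends => //; rewrite ?ltxx// ia (le_trans (ltW ab)).
have pqb : `|p.[b]| = `|q.[b]|.
  by apply: ends => //; rewrite ?ltxx ?andbF// ib (le_trans _ (ltW ab)).
have qnz c : `|p.[c]| = `|q.[c]| -> q.[c] != 0.
  move=> pq; apply/eqP => qc; have pc : p.[c] = 0 * q.[c].
    by apply/eqP; rewrite mul0r -normr_eq0 pq qc normr0.
  by have := coprimep_den cop pc; rewrite qc eqxx.
have fw0 : f w0 = 0 by rewrite /f pw0 mul0r.
have pa : 0 < sg * p.[a].
  have := band_cross_left H ltin bw0 aw0; rewrite -/(f w0) fw0 mul0r subr0; apply.
  by rewrite ia (le_trans (ltW ab)).
have pb : sg * p.[b] < 0.
  have := band_cross_right H ltin bw0 w0b; rewrite -/(f w0) fw0 mul0r subr0; apply.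
  by rewrite ib (le_trans _ (ltW ab)).
have sgn c : `|p.[c]| = `|q.[c]| -> p.[c] = q.[c] \/ p.[c] = - q.[c].
  by move/eqP; rewrite eqr_norm2 => /orP[] /eqP; [left|right].
have sgv : sg = 1 \/ sg = -1.
  by rewrite /sg -signr_odd; case: odd; [right|left]; rewrite ?expr1 ?expr0.
exists a, b, e; split => //.
- move=> u v au uv vb; apply: mono => //; apply/mem.
    by rewrite au (lt_trans uv).
  by rewrite vb (lt_trans au).
- move: qa pa (sgn _ pqa) (qnz _ pqa); rewrite hornerZ; move: p.[a] q.[a] => c d.
  by case: esg => ->; case: sgv => ->; lra.
- move: qb pb (sgn _ pqb) (qnz _ pqb); rewrite hornerZ; move: p.[b] q.[b] => c d.
  by case: esg => ->; case: sgv => ->; lra.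
Qed.

End BandEnds.

(** * Zeros of [p - q] and [p + q] *)

Section BandEndpoints.
Context {R : realType}.

Lemma cvg_prod_ord (N : nat) (u : nat -> nat -> R) (l : nat -> R) :
  (forall i, (i < N)%N -> u k i @[k --> \oo] --> l i) ->
  \prod_(i < N) u k i @[k --> \oo] --> \prod_(i < N) l i.
Proof.
elim: N => [|N IH] ul.
  rewrite big_ord0; under eq_fun do rewrite big_ord0; exact: cvg_cst.
rewrite big_ord_recr/=; under eq_fun do rewrite big_ord_recr/=.
by apply: cvgM; [apply: IH => i iN; apply: ul; exact: ltnW|exact: ul].
Qed.

Lemma poly_eq_horner (T : numDomainType) (f g : {poly T}) : (forall x, f.[x] = g.[x]) -> f = g.
Proof.
move=> fg; pose m := maxn (size f) (size g).
apply: (@poly_eq_of_many_roots T f g [seq (k%:R : T) | k <- iota 0 m]).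
- by rewrite map_inj_uniq ?iota_uniq// => i j /eqP; rewrite eqr_nat => /eqP.
- by rewrite size_map size_iota leq_maxl.
- by rewrite size_map size_iota leq_maxr.
- by move=> x _; exact: fg.
Qed.

Lemma natSinv_lt (d : R) : 0 < d ->
  exists K, forall k, (K <= k)%N -> k.+1%:R^-1 < d.
Proof.
by move=> d0; have [K _ HK] := near_infty_natSinv_lt (PosNum d0); exists K.
Qed.

Variables (N : nat) (p q : {poly R}) (X Y : nat -> R).
Hypotheses (H : altsys N p q X Y) (cop : coprimep p q) (N0 : (0 < N)%N).
Variables (a b e : nat -> R).
Hypothesis bd : forall i, (i < N)%N -> is_band p q Y i (a i) (b i) (e i).

Lemma size_altsys : size p = N.+1.
Proof.
rewrite (alt_factor H) size_scale ?gt_eqF ?(alt_lead H)//.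
by rewrite size_prod_XsubC /index_enum unlock -enumT size_enum_ord.
Qed.

(* The end of the [i]-th band at which [p / q] takes the value [s]. *)
Definition band_end (s : R) i := if e i == s then b i else a i.

(** The factorization is the limit of those at [t = s * (1 - 1 / (k + 1))]. In each band [p / q] is
    monotone and tends to [s] at exactly one end, to which the zeros must converge. A point where
    two bands meet occurs twice in the product. *)
Lemma band_endpoints s : s = 1 \/ s = -1 ->
  p - s *: q = (p - s *: q)`_N *: \prod_(i < N) ('X - (band_end s i)%:P) /\
  0 < (p - s *: q)`_N.
Proof.
move=> s1; have s2 : s * s = 1 by case: s1 => ->; rewrite ?mulr1// mulrNN mulr1.
have sn : `|s| = 1 by case: s1 => ->; rewrite ?normrN normr1.
pose t (k : nat) : R := s * (1 - k.+1%:R^-1).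
have st k : s * t k = 1 - k.+1%:R^-1 by rewrite mulrA s2 mul1r.
have inv0 k : 0 < k.+1%:R^-1 :> R by rewrite invr_gt0 ltr0n.
have inv1 k : k.+1%:R^-1 <= 1 :> R by rewrite invf_le1 ?ltr0n// ler1n.
have t1 k : `|t k| < 1.
  by rewrite normrM sn mul1r ger0_norm ?subr_ge0// gtrBl.
have tl : t k @[k --> \oo] --> s.
  rewrite -[X in _ --> X]mulr1 -[X in _ --> s * X]subr0; apply: cvgMr.
  by apply: cvgB; [exact: cvg_cst|exact: cvg_harmonic].
have /choice[Z HZ] k := pencil_roots H (t1 k).
have Zt k i : (i < N)%N -> p.[Z k i] = t k * q.[Z k i].
  move=> iN; have [_ ZE _] := HZ k.
  have /eqP := pencil_eval (Z k i) ZE.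
  rewrite (bigD1 (Ordinal iN))//= subrr mul0r mulr0.
  by rewrite hornerD hornerN hornerZ subr_eq0 => /eqP.
have Zb k i : (i < N)%N -> a i < Z k i < b i.
  move=> iN; have [YZ _ _] := HZ k; apply/(band_mem (bd iN)); split; first exact: YZ.
  by rewrite (Zt k i iN) normrM gtr_pMl// normr_gt0 (coprimep_den cop (Zt k i iN)).
have fZ k i : (i < N)%N -> p.[Z k i] / q.[Z k i] = t k.
  by move=> iN; rewrite Zt// mulfK// (coprimep_den cop (Zt k i iN)).
have Zl i : (i < N)%N -> Z k i @[k --> \oo] --> band_end s i.
  move=> iN; have B := bd iN; have ab := band_lt B.
  apply/cvgrPdist_lt => d d0; rewrite /band_end.
  have fin w : a i < w < b i -> -1 < e i * (p.[w] / q.[w]) < 1.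
    move/(band_mem B)/band_val => [+ _]; rewrite -ltr_norml [`|e i * _|]normrM.
    by case: (band_sign B) => ->; rewrite ?normrN normr1 mul1r.
  have incr w k : a i < w < b i -> e i * (p.[w] / q.[w]) < e i * t k -> w < Z k i.
    move=> /andP[aw wb]; rewrite -(fZ k i iN) => lt; rewrite ltNge; apply/negP.
    rewrite le_eqVlt => /orP[/eqP E|zw]; first by move: lt; rewrite E ltxx.
    have /andP[aZ _] := Zb k i iN.
    by have := band_incr B aZ zw wb; rewrite ltNge (ltW lt).
  have decr w k : a i < w < b i -> e i * t k < e i * (p.[w] / q.[w]) -> Z k i < w.
    move=> /andP[aw wb]; rewrite -(fZ k i iN) => lt; rewrite ltNge; apply/negP.
    rewrite le_eqVlt => /orP[/eqP E|zw]; first by move: lt; rewrite E ltxx.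
    have /andP[_ Zb'] := Zb k i iN.
    by have := band_incr B aw zw Zb'; rewrite ltNge (ltW lt).
  case: eqP => [es|es].
    (* [w] is in the band, within [d] of the right end. Once [t k] has passed the value of [p / q]
       at [w], monotonicity traps the zero between [w] and that end. *)
    pose w := Num.max ((a i + b i) / 2) (b i - d / 2).
    have w1 : (a i + b i) / 2 <= w by rewrite le_max lexx.
    have w2 : b i - d / 2 <= w by rewrite le_max lexx orbT.
    have w3 : w < b i by rewrite gt_max; apply/andP; split; lra.
    have wab : a i < w < b i by apply/andP; split; lra.
    have /andP[_ f1] := fin w wab.
    have w0 : 0 < 1 - e i * (p.[w] / q.[w]) by rewrite subr_gt0.
    have [K HK] := natSinv_lt w0.
    exists K => // k /= /HK Kk; have /andP[_ Zbi] := Zb k i iN.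
    have etk : e i * t k = 1 - k.+1%:R^-1 by rewrite es st.
    have wZ : w < Z k i by apply: incr => //; rewrite etk ltrBrDr addrC -ltrBrDr.
    by rewrite gtr0_norm ?subr_gt0//; lra.
  have es' : e i = - s by case: (band_sign B) s1 es => -> [] ->; rewrite ?opprK.
  pose w := Num.min ((a i + b i) / 2) (a i + d / 2).
  have w1 : w <= (a i + b i) / 2 by rewrite ge_min lexx.
  have w2 : w <= a i + d / 2 by rewrite ge_min lexx orbT.
  have w3 : a i < w by rewrite lt_min; apply/andP; split; lra.
  have wab : a i < w < b i by apply/andP; split; lra.
  have /andP[f1 _] := fin w wab.
  have w0 : 0 < 1 + e i * (p.[w] / q.[w]) by rewrite -ltrBlDl sub0r.
  have [K HK] := natSinv_lt w0.
  exists K => // k /= /HK Kk; have /andP[Zai _] := Zb k i iN.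
  have etk : e i * t k = - (1 - k.+1%:R^-1) by rewrite es' mulNr st.
  have wZ : Z k i < w by apply: decr => //; rewrite etk opprB ltrBlDl.
  by rewrite ltr0_norm ?subr_lt0//; lra.
have pts v r : (p - r *: q).[v] = p.[v] - r * q.[v].
  by rewrite hornerD hornerN hornerZ.
have ptc r : (p - r *: q)`_N = p`_N - r * q`_N by rewrite coefB coefZ.
have E : p - s *: q = (p - s *: q)`_N *: \prod_(i < N) ('X - (band_end s i)%:P).
  apply: poly_eq_horner => v; rewrite pts ptc hornerZ horner_prod.
  under eq_bigr do rewrite hornerXsubC.
  have L : p.[v] - t k * q.[v] @[k --> \oo] --> p.[v] - s * q.[v].
    by apply: cvgB; [exact: cvg_cst|exact: cvgMl].
  have L' : (p`_N - t k * q`_N) * \prod_(i < N) (v - Z k i) @[k --> \oo] -->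
      (p`_N - s * q`_N) * \prod_(i < N) (v - band_end s i).
    apply: cvgM; first by apply: cvgB; [exact: cvg_cst|exact: cvgMl].
    apply: (@cvg_prod_ord N (fun k i => v - Z k i) (fun i => v - band_end s i)) => i iN.
    by apply: cvgB; [exact: cvg_cst|exact: Zl].
  apply: (cvg_unique (@Rhausdorff R) L).
  have -> : (fun k => p.[v] - t k * q.[v]) =
      (fun k => (p`_N - t k * q`_N) * \prod_(i < N) (v - Z k i)) => //.
  by apply/funext => k; have [_ /(pencil_eval v)] := HZ k; rewrite pts ptc.
split => //; rewrite lt_neqAle eq_sym; apply/andP; split.
  (* A vanishing top coefficient would give [p = s q], against coprimality since [p] has degree
     [N > 0]. *)
  apply/eqP => l0; move: E; rewrite l0 scale0r => /eqP; rewrite subr_eq0 => /eqP pq.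
  have : q %| p by rewrite pq dvdpZr ?dvdpp// -normr_eq0 sn oner_eq0.
  have /eqP : size p = N.+1 := size_altsys; rewrite -(prednK N0).
  move=> sp /dvdp_gcd_idr; move: cop; rewrite coprimep_def => /eqP + gq.
  rewrite (eqp_size gq) => q1.
  by move: sp; rewrite pq size_scale ?q1// -normr_eq0 sn oner_eq0.
(* If it were negative, the quotient of the top coefficients of [p] and [q] would be a [t] with
   [|t| < 1] for which the top coefficient of [p - t q] is 0. *)
rewrite ptc leNgt; apply/negP => ls; have lp := alt_lead H.
have sq0 : 0 < s * q`_N by lra.
have [|Z' [_ _]] := @pencil_roots _ _ _ _ _ _ H (s * (p`_N / (s * q`_N))).
  rewrite normrM sn mul1r gtr0_norm ?divr_gt0// ltr_pdivrMr// mul1r; lra.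
by rewrite ptc -mulrA mulrCA divfK ?gt_eqF// subrr ltxx.
Qed.

End BandEndpoints.

(** * Uniqueness, and contact at the ends of gaps *)

Section Consequences.
Context {R : realType}.
Variables (K : set R) (Q : {poly R}) (n : nat).
Hypotheses (cK : compact K) (Q0 : forall y, K y -> Q.[y] != 0).
Hypotheses (sQ : (size Q <= n.+1)%N) (n0 : (0 < n)%N).

(** Stated over an extension of [R], to serve uniqueness over [R] and the reality of coefficients
    over [R[i]]. *)
Lemma altsys_ext P X Y (T : idomainType) (f g : {poly T}) (inj : {rmorphism R -> T}) :
  altsys n P Q X Y -> (size f <= n.+1)%N -> (size g <= n.+1)%N ->
  (forall i, (i <= n)%N -> f.[inj (Y i)] = g.[inj (Y i)]) -> f = g.
Proof.
move=> H sf sg fg.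
apply: (@poly_eq_of_many_roots _ _ _ [seq inj (Y i) | i <- iota 0 n.+1]).
- rewrite map_inj_in_uniq ?iota_uniq// => i j; rewrite !mem_iota !add0n !ltnS /=.
  move=> jn kn /fmorph_inj Yij; have [ij|ji|//] := ltngtP i j.
    by have := alt_inc H (i := i) (j := j); rewrite ij kn Yij ltxx => /(_ isT).
  by have := alt_inc H (i := j) (j := i); rewrite ji jn Yij ltxx => /(_ isT).
- by rewrite size_map size_iota.
- by rewrite size_map size_iota.
move=> x /mapP[i + ->]; rewrite mem_iota add0n ltnS /= => iN.
exact: fg.
Qed.

Lemma wextremal_unique P1 P2 : wextremal K Q n P1 -> wextremal K Q n P2 -> P1 = P2.
Proof.
move=> [s1 PQ1 M1] [s2 PQ2 M2].
have top : P1`_n = P2`_n by apply/eqP; rewrite eq_le M1 ?M2.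
pose P := 2^-1 *: (P1 + P2).
have PE y : P.[y] = (P1.[y] + P2.[y]) / 2 by rewrite hornerZ hornerD mulrC.
have sP : (size P <= n.+1)%N.
  rewrite (leq_trans (size_scale_leq _ _))// (leq_trans (size_polyD _ _))//.
  by rewrite geq_max s1 s2.
have maxP : wextremal K Q n P.
  split=> //.
    move=> y Ky; rewrite PE; have := PQ1 y Ky; have := PQ2 y Ky.
    move: (`|Q.[y]|) => q; rewrite !ler_norml => /andP[? ?] /andP[? ?].
    by apply/andP; split; lra.
  move=> G sG GQ; have := M1 G sG GQ; rewrite coefZ coefD -top; lra.
have [X [Y [H tY]]] := wextremal_altsys cK Q0 sQ n0 maxP.
(* At an oscillation point of the average, the mean of two numbers in [[-|Q|, |Q|]] is an end of
   that interval, so both equal it. *)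
apply: (altsys_ext (inj := idfun) H) => // i /tY[KY]; rewrite PE /=.
have := PQ1 _ KY; have := PQ2 _ KY; move: (Y i) => y.
move: (`|Q.[y]|) => q; rewrite !ler_norml => /andP[? ?] /andP[? ?] E.
have /eqP := E; rewrite eqr_norml => /andP[/orP[] /eqP ? _]; lra.
Qed.

Section One.
Variables (P : {poly R}) (X Y : nat -> R).
Hypotheses (PQ : forall y, K y -> `|P.[y]| <= `|Q.[y]|) (H : altsys n P Q X Y).
Hypothesis tY : forall i, (i <= n)%N -> touch K Q P (Y i).

Lemma ratio_lt1 y : `|P.[y]| < `|Q.[y]| ->
  exists2 t, `|t| < 1 & (P - t *: Q).[y] = 0.
Proof.
move=> pq; have q0 : 0 < `|Q.[y]| by exact: le_lt_trans pq.
exists (P.[y] / Q.[y]).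
  by rewrite normrM normfV ltr_pdivrMr// mul1r.
by rewrite hornerD hornerN hornerZ divfK ?subrr// -normr_gt0.
Qed.

Lemma lt_norm_cell y : `|P.[y]| < `|Q.[y]| ->
  exists2 i, (i < n)%N & Y i < y < Y i.+1.
Proof. by move=> /ratio_lt1[t t1 /(pencil_root_cell H t1)]. Qed.

Lemma touch_extreme y : K y -> (forall i, (i < n)%N -> ~ Y i < y < Y i.+1) ->
  touch K Q P y.
Proof.
move=> Ky ny; split => //; have := PQ Ky; rewrite le_eqVlt => /orP[/eqP//|].
by move=> /lt_norm_cell[i iN /(ny i iN)].
Qed.

Lemma P_root_cell u : P.[u] = 0 -> exists2 i, (i < n)%N & Y i < u < Y i.+1.
Proof.
move=> Pu; apply: (@pencil_root_cell _ _ _ _ _ _ H 0); first by rewrite normr0.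
by rewrite scale0r subr0.
Qed.

(** [A] is to the right of every [Y i], hence outside all cells, and [|P| < |Q|] only happens inside
    cells. The extremes of [K] will be the ends of the gap around [xs]. *)
Lemma touch_max A : K A -> (forall y, K y -> y <= A) -> touch K Q P A /\ 0 < P.[A].
Proof.
move=> KA mA; have YA i : (i <= n)%N -> Y i <= A by move=> /tY[/mA].
split.
  by apply: touch_extreme => // i iN /andP[_]; rewrite ltNge YA.
rewrite (alt_factor H) hornerZ horner_prod mulr_gt0 ?(alt_lead H)//.
apply: prodr_gt0 => i _; rewrite hornerXsubC subr_gt0.
have /andP[_ h] := alt_lt H (ltn_ord i); apply: lt_le_trans h _.
exact/YA/ltn_ord.
Qed.

Lemma touch_min B : K B -> (forall y, K y -> B <= y) ->
  touch K Q P B /\ 0 < (-1) ^+ n * P.[B].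
Proof.
move=> KB mB; have YB i : (i <= n)%N -> B <= Y i by move=> /tY[/mB].
split.
  apply: touch_extreme => // i iN /andP[h _]; move: h.
  by rewrite ltNge YB// ltnW.
rewrite (alt_factor H) hornerZ mulrCA mulr_gt0 ?(alt_lead H)// horner_prod.
under [X in _ * X]eq_bigr do rewrite hornerXsubC.
rewrite -[n in (-1) ^+ n]subn0; apply: prod_lt_sign => // k /= kn.
have /andP[h _] := alt_lt H kn; apply: le_lt_trans h.
by apply: YB; exact: ltnW.
Qed.

Lemma root_in_hull A B u : (forall y, K y -> B <= y <= A) -> P.[u] = 0 -> B < u < A.
Proof.
move=> hK /P_root_cell[i iN /andP[u1 u2]].
have [KY _] := tY (ltnW iN); have [KY' _] := tY iN.
have /andP[h1 _] := hK _ KY; have /andP[_ h2] := hK _ KY'.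
by rewrite (le_lt_trans h1)// (lt_le_trans u2).
Qed.

Variables (N : nat) (p q g : {poly R}) (X' Y' : nat -> R).
Hypotheses (H' : altsys N p q X' Y') (cop : coprimep p q).
Hypotheses (Pg : P = p * g) (Qg : Q = q * g).
Hypothesis YY : forall k, (k <= N)%N -> exists2 j, (j <= n)%N & Y' k = Y j.

(** [w] is a zero of every [P - t Q]. If [|P| < |Q|] at [u], then [u] is a second zero of one of
    them, and an oscillation point, which belongs to [K], would separate the two inside the gap. *)
Lemma zero_in_gap u v w : K u -> K v -> (forall y, u < y < v -> ~ K y) ->
  u < w < v -> P.[w] = 0 -> Q.[w] = 0 -> touch K Q P u /\ touch K Q P v.
Proof.
move=> Ku Kv gap /andP[uw wv] Pw Qw.
have Zw t : (P - t *: Q).[w] = 0 by rewrite hornerD hornerN hornerZ Pw Qw mulr0 subrr.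
split; split => //.
- have := PQ Ku; rewrite le_eqVlt => /orP[/eqP//|/ratio_lt1[t t1 Pu]].
  have [i iN /andP[h1 h2]] := pencil_roots_separated H t1 uw Pu (Zw t).
  have [KY _] := tY iN; case: (gap (Y i)) => //; by rewrite h1 (lt_trans h2).
- have := PQ Kv; rewrite le_eqVlt => /orP[/eqP//|/ratio_lt1[t t1 Pv]].
  have [i iN /andP[h1 h2]] := pencil_roots_separated H t1 wv (Zw t) Pv.
  have [KY _] := tY iN; case: (gap (Y i)) => //; by rewrite h2 (lt_trans uw).
Qed.

(** If neither end touched, both would lie in bands of the reduced system. Different bands are
    separated by an oscillation point in [K]; a common band would contain [w] by convexity, where
    [q] vanishes and [p] does not. *)
Lemma pole_in_gap u v w : K u -> K v -> (forall y, u < y < v -> ~ K y) ->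
  u < w < v -> Q.[w] = 0 -> touch K Q P u \/ touch K Q P v.
Proof.
move=> Ku Kv gap uwv Qw; have [Pw|Pw] := eqVneq P.[w] 0.
  by have [] := zero_in_gap Ku Kv gap uwv Pw Qw; left.
have := PQ Ku; rewrite le_eqVlt => /orP[/eqP tu|tu]; first by left.
have := PQ Kv; rewrite le_eqVlt => /orP[/eqP tv|tv]; first by right.
have red y : K y -> `|P.[y]| < `|Q.[y]| -> `|p.[y]| < `|q.[y]|.
  move=> /Q0; rewrite Pg Qg !hornerM mulf_eq0 negb_or => /andP[_ gy].
  by rewrite !normrM ltr_pM2r// normr_gt0.
have cell y : K y -> `|P.[y]| < `|Q.[y]| -> exists2 i, (i < N)%N & inband p q Y' i y.
  move=> Ky /(red _ Ky) pq.
  have q0 : 0 < `|q.[y]| by exact: le_lt_trans pq.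
  have [||i iN iy] := @pencil_root_cell _ _ _ _ _ _ H' (p.[y] / q.[y]) y.
  - by rewrite normrM normfV ltr_pdivrMr// mul1r.
  - by rewrite hornerD hornerN hornerZ divfK ?subrr// -normr_gt0.
  by exists i.
have [i iN bu] := cell u Ku tu; have [j jN bv] := cell v Kv tv.
have /andP[uw wv] := uwv.
have [ij|ij|ij] := ltngtP i j.
- have [k kn Yk] := YY iN; have [KY _] := tY kn; rewrite -Yk in KY.
  case: (gap _ _ KY); have [/andP[_ ->] _] := bu => /=.
  have [/andP[h _] _] := bv; apply: le_lt_trans h.
  by rewrite (alt_inc_le H')// ij ltnW.
- have [/andP[h1 _] _] := bu; have [/andP[_ h2] _] := bv.
  have : Y' j.+1 <= Y' i by rewrite (alt_inc_le H')// ij ltnW.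
  by move: h1 h2 uw wv; lra.
- rewrite -ij in bv; have [_] := band_convex H' iN bu bv uwv.
  move: Qw Pw; rewrite Qg Pg !hornerM => /eqP; rewrite mulf_eq0 => /orP[/eqP->|/eqP->].
    by rewrite normr0 ltNge normr_ge0.
  by rewrite mulr0 eqxx.
Qed.

End One.
End Consequences.

(** * Rational functions as quotients of forms *)

Section Forms.
Context {T : fieldType}.
Implicit Types (P Q R S : {poly T}) (z w : option T) (N : nat).

(* A polynomial [P] of degree at most [N] is read as the binary form
   [\sum_i P_i z^i w^(N - i)]; its value at infinity is the top coefficient. *)
Definition hform N P z := if z is Some w then P.[w] else P`_N.

Definition hval N P Q z : option T :=
  if hform N Q z != 0 then Some (hform N P z / hform N Q z) else None.

(** At infinity the order is the deficit of degree; the truncated subtraction is exact when [P] has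
    degree at most [N]. *)
Definition hord N P z := if z is Some w then mup w P else (N.+1 - size P)%N.

(** The linear form vanishing at [z]; at infinity this is the second variable, which is 1 in the
    affine chart. *)
Definition lin z : {poly T} := if z is Some w then 'X - w%:P else 1.

Lemma lin_neq0 z : lin z != 0.
Proof. by case: z => [w|]; rewrite ?polyXsubC_eq0// oner_eq0. Qed.

Lemma size_lin z : (size (lin z) <= 2)%N.
Proof. by case: z => [w|]; rewrite ?size_XsubC// size_poly1. Qed.

Lemma hformM a b P Q z : (size P <= a.+1)%N -> (size Q <= b.+1)%N ->
  hform (a + b) (P * Q) z = hform a P z * hform b Q z.
Proof.
case: z => [w|] sP sQ; first by rewrite /= hornerM.
rewrite /= coefM (bigD1 (inord a))//= inordK ?ltnS ?leq_addr// addKn.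
rewrite big1 ?addr0// => i /negP ia; have [ia'|ai] := ltnP i a.
  rewrite [Q`_ _]nth_default ?mulr0// (leq_trans sQ)//.
  by have := ltn_ord i; lia.
rewrite nth_default ?mul0r// (leq_trans sP)// ltn_neqAle ai andbT.
by apply/eqP => E; apply: ia; apply/eqP/val_inj; rewrite /= inordK ?ltnS ?leq_addr.
Qed.

(** Describing the order as the exponent of [lin z] in a factorization treats finite and infinite
    points alike; multiplicativity and coordinate changes then need a single argument. *)
Lemma hord_uniq N P z k R : (k <= N)%N -> (size R <= (N - k).+1)%N ->
  P = lin z ^+ k * R -> hform (N - k) R z != 0 -> hord N P z = k.
Proof.
case: z => [w|] kN sR -> /= R0.
  by rewrite mupMl// mup_XsubCX eqxx.
rewrite expr1n mul1r; have -> : size R = (N - k).+1; last lia.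
by apply/eqP; rewrite eqn_leq sR/= ltnNge; apply: contra R0 => sR'; rewrite nth_default.
Qed.

Lemma hord_factor N P z : P != 0 -> (size P <= N.+1)%N ->
  let k := hord N P z in (k <= N)%N /\
  exists R, [/\ (size R <= (N - k).+1)%N, P = lin z ^+ k * R & hform (N - k) R z != 0].
Proof.
move=> P0 sP; have P00 : (0 < size P)%N by rewrite size_poly_gt0.
case: z => [w|] /=.
  have /dvdpP[R PR] : ('X - w%:P) ^+ mup w P %| P by rewrite -mup_geq.
  have R0 : R != 0 by apply: contra_neq P0; rewrite PR => ->; rewrite mul0r.
  have sz : size P = (size R + mup w P)%N.
    by rewrite {1}PR size_Mmonic ?monicXn ?monic_exp ?monicXsubC// size_exp_XsubC addnS.
  have R00 : (0 < size R)%N by rewrite size_poly_gt0.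
  have {sz} : (size R + mup w P <= N.+1)%N by rewrite -sz.
  have arith (r k : nat) : (0 < r -> r + k <= N.+1 -> k <= N /\ r <= (N - k).+1)%N by lia.
  move=> /(arith _ _ R00)[-> sR]; split=> //; exists R; split => //.
    by rewrite mulrC.
  apply/negP => Rw; have /factor_theorem[S RS] : root R w by [].
  have : ((mup w P).+1 <= mup w P)%N.
    by rewrite mup_geq// exprS [X in _ %| X]PR RS -mulrA dvdp_mull.
  by rewrite ltnn.
have arith (r : nat) : (0 < r -> r <= N.+1 -> N.+1 - r <= N /\
    r <= (N - (N.+1 - r)).+1 /\ N - (N.+1 - r) = r.-1)%N by lia.
have [-> [sR NE]] := arith _ P00 sP.
by split => //; exists P; rewrite expr1n mul1r; split => //=; rewrite NE -lead_coefE lead_coef_eq0.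
Qed.

Lemma hordM a b P Q z : P != 0 -> Q != 0 -> (size P <= a.+1)%N ->
  (size Q <= b.+1)%N -> hord (a + b) (P * Q) z = (hord a P z + hord b Q z)%N.
Proof.
move=> P0 Q0 sP sQ; have [ka [R [sR PE R0]]] := hord_factor z P0 sP.
have [kb [S [sS QE S0]]] := hord_factor z Q0 sQ.
move: ka kb sR PE R0 sS QE S0; set k := hord a P z; set l := hord b Q z.
move=> ka kb sR PE R0 sS QE S0.
have e : (a + b - (k + l) = (a - k) + (b - l))%N by lia.
apply: (@hord_uniq _ _ _ _ (R * S)).
- by rewrite leq_add.
- by rewrite e (leq_trans (size_polyMleq _ _))//; move: (size R) (size S) sR sS => u v; lia.
- by rewrite PE QE exprD mulrACA.
- by rewrite e hformM// mulf_neq0.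
Qed.

Lemma hord_lin c z : hord 1 (lin c) z = (c == z).
Proof.
case: c z => [c|] [w|] //=; rewrite ?size_XsubC ?size_poly1//.
- by rewrite -['X - c%:P]expr1 mup_XsubCX -[Some c == _]/(c == w); case: eqP.
- by apply/eqP; rewrite -leqn0 leqNgt mup_geq ?oner_eq0// expr1 dvdp1 size_XsubC.
Qed.

End Forms.

(** * Coprime forms *)

Section Coprime.
Context {T : numClosedFieldType}.
Implicit Types (P Q R S p q : {poly T}) (z w : option T) (N M : nat).

(** A common zero at infinity is excluded as well, which makes [N] the larger of the two degrees. *)
Definition coprime_forms N p q :=
  [/\ (size p <= N.+1)%N, (size q <= N.+1)%N &
      forall z, hform N p z != 0 \/ hform N q z != 0].

Lemma coprime_forms_coprimep N p q : coprime_forms N p q -> coprimep p q.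
Proof.
move=> [_ _ cpq]; apply: Pdiv.ClosedField.root_coprimep => w /rootP pw.
by have [] := cpq (Some w); rewrite /= ?pw ?eqxx.
Qed.

Lemma coprime_forms_max N p q : coprime_forms N p q -> maxn (size p) (size q) = N.+1.
Proof.
move=> [sp sq /(_ None) /= cpq]; apply/eqP; rewrite eqn_leq geq_max sp sq/=.
rewrite ltnNge geq_max; apply/negP => /andP[sp' sq'].
by case: cpq; rewrite nth_default// eqxx.
Qed.

(** Gauss's lemma makes numerators and denominators associated, so the degrees agree; the values
    agree by cross multiplication of the forms at [z]. *)
Lemma hval_cross N M p q p' q' : coprime_forms N p q -> coprime_forms M p' q' ->
  p * q' = p' * q -> N = M /\ forall z, hval N p q z = hval M p' q' z.
Proof.
move=> cpq cpq' E.
have cop := coprime_forms_coprimep cpq; have cop' := coprime_forms_coprimep cpq'.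
have pp : p %= p'.
  apply/andP; split.
    by rewrite -(Gauss_dvdpl _ cop) -E dvdp_mulr.
  by rewrite -(Gauss_dvdpl _ cop') E dvdp_mulr.
have qq : q %= q'.
  apply/andP; split.
    by rewrite -(@Gauss_dvdpr _ q' p q) ?(coprimep_sym q)// E dvdp_mull.
  by rewrite -(@Gauss_dvdpr _ q p' q') ?(coprimep_sym q')// -E dvdp_mull.
split.
  apply: succn_inj; rewrite -(coprime_forms_max cpq) -(coprime_forms_max cpq').
  by rewrite (eqp_size pp) (eqp_size qq).
move=> z; have [sp sq /(_ z) cz] := cpq; have [sp' sq' /(_ z) cz'] := cpq'.
have := hformM z sp sq'; rewrite E addnC hformM// => {}E.
rewrite /hval; move: (hform _ p z) (hform _ q z) (hform _ p' z) (hform _ q' z) E cz cz'.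
move=> a b a' b' E cz cz'; have [b0|b0] := eqVneq b 0.
  move: E; rewrite b0 mulr0 => /esym/eqP; rewrite mulf_eq0.
  by case: cz => [/negPf->/= ->|]; rewrite ?b0 ?eqxx.
have b'0 : b' != 0.
  apply/eqP => b'0; move: E; rewrite b'0 mulr0 => /eqP; rewrite mulf_eq0 (negPf b0) orbF.
  by case: cz' => [/negPf->|]; rewrite ?b'0 ?eqxx.
by rewrite b'0/=; congr Some; apply: (canLR (mulfK b0)); rewrite mulrAC E mulfK.
Qed.

End Coprime.

(** * Moebius changes of coordinate on forms *)

Section Twist.
Context {T : numClosedFieldType}.
Variables (al be ga de : T).
Hypothesis det : al * de - be * ga = 1.
Implicit Types (P Q R S p q : {poly T}) (z w : option T) (N M : nat).

Definition mobC z : option T :=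
  match z with
  | Some r => if ga * r + de == 0 then None else Some ((al * r + be) / (ga * r + de))
  | None => if ga == 0 then None else Some (al / ga)
  end.

(* [tw N P] is the form [P] in the coordinate [w = mobC z]: substituting
   [z = (de w - be) / (al - ga w)] and clearing denominators. *)
Definition tw N P : {poly T} :=
  \sum_(i < N.+1) P`_i *: ((de *: 'X - be%:P) ^+ i * (al%:P - ga *: 'X) ^+ (N - i)).

Lemma tw_0 N : tw N 0 = 0.
Proof. by rewrite /tw big1// => i _; rewrite coef0 scale0r. Qed.

(** The automorphy factor: the scalar by which the value of a form of degree 1 changes. Its cases
    reflect that a value at infinity is a top coefficient. *)
Definition jac z : T :=
  match z with
  | Some r => if ga * r + de == 0 then - ga else (ga * r + de)^-1
  | None => if ga == 0 then de else ga^-1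
  end.

Lemma jac_neq0 z : jac z != 0.
Proof.
case: z => [r|] /=; case: ifPn => [/eqP E|E]; rewrite ?invr_eq0//.
- rewrite oppr_eq0; apply: contra_eqN det => /eqP g0; move: E.
  by rewrite g0 mul0r add0r => ->; rewrite !mulr0 subrr eq_sym oner_eq0.
- apply: contra_eqN det => /eqP d0.
  by rewrite E d0 !mulr0 subrr eq_sym oner_eq0.
Qed.

Lemma size_affine (a b : T) : (size (a *: 'X - b%:P)%R <= 2)%N.
Proof.
rewrite (leq_trans (size_polyD _ _))// geq_max size_polyN.
rewrite (leq_trans (size_scale_leq _ _)) ?size_polyX//=.
exact: leq_trans (size_polyC_leq1 _) _.
Qed.

Lemma size_affine_sub (a b : T) : (size (a%:P - b *: 'X)%R <= 2)%N.
Proof. by rewrite -opprB size_polyN size_affine. Qed.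

Lemma size_exp_lin (l : {poly T}) i : (size l <= 2)%N -> (size (l ^+ i)%R <= i.+1)%N.
Proof.
move=> sl; elim: i => [|i IH]; first by rewrite expr0 size_poly1.
rewrite exprS (leq_trans (size_polyMleq _ _))//.
by move: sl IH; move: (size _) (size _) => u v; lia.
Qed.

Lemma coef_exp_top (l : {poly T}) i : (size l <= 2)%N -> (l ^+ i)`_i = l`_1 ^+ i.
Proof.
move=> sl; elim: i => [|i IH]; first by rewrite !expr0 coefC.
have := @hformM _ 1 i l (l ^+ i) None sl (size_exp_lin i sl).
by rewrite !exprS /= IH add1n.
Qed.

Lemma size_tw N P : (size (tw N P) <= N.+1)%N.
Proof.
apply: (leq_trans (size_sum _ _ _)); apply/bigmax_leqP => i _.
rewrite (leq_trans (size_scale_leq _ _))// (leq_trans (size_polyMleq _ _))//.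
have := size_exp_lin i (size_affine de be); have := size_exp_lin (N - i) (size_affine_sub al ga).
by have := ltn_ord i; move: (size _) (size _) => u v; lia.
Qed.

(** By [det], the two linear forms substituted in [tw] take at [mobC z] the values [jac z * r] and
    [jac z] if [z] is a finite point [r], and [jac z] and 0 if [z] is infinite; homogeneity does the
    rest. *)
Lemma hform_tw N P z : (size P <= N.+1)%N ->
  hform N (tw N P) (mobC z) = jac z ^+ N * hform N P z.
Proof.
move=> sP.
have val (w : T) : (tw N P).[w] =
    \sum_(i < N.+1) P`_i * ((de * w - be) ^+ i * (al - ga * w) ^+ (N - i)).
  rewrite horner_sum; apply: eq_bigr => i _.
  by rewrite hornerZ hornerM !horner_exp !hornerE.
have lastterm (u : T) : \sum_(i < N.+1) P`_i * (u ^+ i * (0 : T) ^+ (N - i)) = P`_N * u ^+ N.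
  rewrite big_ord_recr/= subnn expr0 mulr1 big1 ?add0r// => i _.
  by rewrite expr0n subn_eq0 leqNgt ltn_ord/= !mulr0.
have homog (r k : T) : \sum_(i < N.+1) P`_i * ((r * k) ^+ i * k ^+ (N - i)) = k ^+ N * P.[r].
  rewrite (horner_coef_wide _ sP) mulr_sumr; apply: eq_bigr => i _.
  rewrite exprMn -mulrA -exprD subnKC; last by rewrite -ltnS.
  by rewrite mulrA mulrC.
have coefN : (tw N P)`_N = \sum_(i < N.+1) P`_i * (de ^+ i * (- ga) ^+ (N - i)).
  rewrite coef_sum; apply: eq_bigr => i _; rewrite coefZ; congr (_ * _).
  have iN : (i <= N)%N by rewrite -ltnS.
  have := @hformM _ i (N - i) ((de *: 'X - be%:P) ^+ i)
    ((al%:P - ga *: 'X) ^+ (N - i)%N) None.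
  rewrite (subnKC iN) /= => ->; rewrite ?size_exp_lin ?size_affine ?size_affine_sub//.
  rewrite !coef_exp_top ?size_affine ?size_affine_sub//.
  by rewrite !(coefB, coefZ, coefX, coefC)/= !(mulr1, subr0, sub0r).
case: z => [r|] /=.
  case: eqP => [E|/eqP E] /=.
    rewrite coefN -homog; apply: eq_bigr => i _; congr (_ * (_ ^+ _ * _)).
    by move: E; rewrite addrC => /eqP; rewrite addr_eq0 => /eqP ->; ring.
  rewrite val -homog; apply: eq_bigr => i _; congr (_ * (_ ^+ _ * _ ^+ _)).
    rewrite (_ : de * _ - be = (de * (al * r + be) - be * (ga * r + de)) / (ga * r + de)).
      by congr (_ / _); rewrite -[r in RHS]mul1r -det; ring.
    by field.
  rewrite (_ : al - _ = (al * (ga * r + de) - ga * (al * r + be)) / (ga * r + de)).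
    by rewrite -[RHS]mul1r -det; congr (_ / _); ring.
  by field.
case: eqP => [E|/eqP E] /=.
  by rewrite coefN E oppr0 lastterm// mulrC.
rewrite val (_ : al - _ = 0) ?lastterm//; last by rewrite mulrC divfK// subrr.
rewrite mulrC; congr (_ ^+ _ * _); rewrite -[RHS]mul1r -det.
by field.
Qed.

End Twist.

Section TwistTheory.
Context {T : numClosedFieldType}.
Implicit Types (P Q R S p q : {poly T}) (z w : option T) (N M : nat).

Lemma mobCK (al be ga de : T) : al * de - be * ga = 1 ->
  cancel (mobC al be ga de) (mobC de (- be) (- ga) al).
Proof.
move=> det [r|] /=.
  case: ifPn => [/eqP E|E] /=.
    rewrite oppr_eq0; case: eqP => [g0|/eqP g0].
      move: det E; rewrite g0 mulr0 mul0r add0r subr0 => + E.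
      by rewrite E mulr0 => /eqP; rewrite eq_sym oner_eq0.
    have -> : de = - (ga * r) by apply/eqP; rewrite -addr_eq0 addrC E.
    by congr Some; field.
  have -> : - ga * ((al * r + be) / (ga * r + de)) + al = (ga * r + de)^-1.
    by rewrite -[RHS]mul1r -det; field.
  rewrite invr_eq0 (negPf E) invrK mulrDl mulrA divfK// mulNr; congr Some.
  by rewrite -[r in RHS]mul1r -det; ring.
case: ifPn => [/eqP g0|g0] /=; first by rewrite g0 oppr0 eqxx.
by rewrite mulNr mulrC divfK// addNr eqxx.
Qed.

Section OneTwist.
Variables (al be ga de : T).
Hypothesis det : al * de - be * ga = 1.
Local Notation phi := (mobC al be ga de).
Local Notation psi := (mobC de (- be) (- ga) al).
Local Notation tw := (tw al be ga de).

Lemma mobCKV : cancel psi phi.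
Proof.
have := @mobCK de (- be) (- ga) al; rewrite !opprK; apply.
by rewrite mulrNN mulrC.
Qed.

Lemma twM a b P Q : (size P <= a.+1)%N -> (size Q <= b.+1)%N ->
  tw (a + b) (P * Q) = tw a P * tw b Q.
Proof.
move=> sP sQ; apply: poly_eq_horner => w.
have sPQ : (size (P * Q)%R <= (a + b).+1)%N.
  rewrite (leq_trans (size_polyMleq _ _))//.
  by move: sP sQ; move: (size _) (size _) => u v; lia.
have := hform_tw det (psi (Some w)) sPQ; have := hform_tw det (psi (Some w)) sP.
have := hform_tw det (psi (Some w)) sQ; rewrite mobCKV hornerM /= => -> -> ->.
by rewrite hformM// exprD mulrACA.
Qed.

Lemma tw0 P : (size P <= 1)%N -> tw 0 P = P.
Proof.
move=> sP; rewrite /tw big_ord_recl big_ord0 addr0 !expr0 mulr1.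
by rewrite -mul_polyC mulr1 -size1_polyC.
Qed.

Lemma twX k (l : {poly T}) : (size l <= 2)%N -> tw k (l ^+ k) = tw 1 l ^+ k.
Proof.
move=> sl; elim: k => [|k IH]; first by rewrite tw0 ?size_poly1.
by rewrite !exprS -add1n twM// ?IH// size_exp_lin.
Qed.

Lemma tw_lin z : exists2 c, c != 0 & tw 1 (lin z) = c *: lin (phi z).
Proof.
have E l : tw 1 l = l`_0 *: (al%:P - ga *: 'X) + l`_1 *: (de *: 'X - be%:P).
  rewrite /tw big_ord_recl big_ord_recl big_ord0 addr0 /= !expr0 !expr1.
  by rewrite mul1r mulr1.
rewrite E; case: z => [r|] /=.
  rewrite !(coefB, coefX, coefC)/= sub0r subr0 scale1r.
  case: ifPn => [/eqP D|D] /=.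
    exists (- (al * r + be)).
      rewrite oppr_eq0; apply: contra_eqN det => /eqP n0.
      suff -> : al * de - be * ga = 0 by rewrite eq_sym oner_eq0.
      rewrite (_ : de = - (ga * r)); last by apply/eqP; rewrite -addr_eq0 addrC D.
      rewrite (_ : be = - (al * r)); last by apply/eqP; rewrite -addr_eq0 addrC n0.
      by ring.
    apply/polyP => i; rewrite !(coefD, coefN, coefZ, coefX, coefC, coef1).
    have -> : de = - (ga * r) by apply/eqP; rewrite -addr_eq0 addrC D.
    by case: i => [|[|i]] /=; ring.
  exists (ga * r + de) => //; apply/polyP => i.
  rewrite !(coefD, coefN, coefZ, coefX, coefC, coef1).
  by case: i => [|[|i]] /=; field.
rewrite !coef1 /= scale0r addr0 scale1r; case: ifPn => [/eqP g0|g0] /=.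
  exists al; last by rewrite g0 scale0r subr0 -mul_polyC mulr1.
  by apply: contra_eqN det => /eqP ->; rewrite g0 mul0r mulr0 subrr eq_sym oner_eq0.
exists (- ga); first by rewrite oppr_eq0.
apply/polyP => i; rewrite !(coefD, coefN, coefZ, coefX, coefC, coef1).
by case: i => [|[|i]] /=; field.
Qed.

(** [tw] is multiplicative and carries [lin z] to a nonzero multiple of [lin (phi z)], so it
    preserves exponents. *)
Lemma hord_tw N P z : P != 0 -> (size P <= N.+1)%N ->
  hord N (tw N P) (phi z) = hord N P z.
Proof.
move=> P0 sP; have [kN [R [sR PE R0]]] := hord_factor z P0 sP.
move: kN sR PE R0; set k := hord N P z => kN sR PE R0.
have [c c0 lc] := tw_lin z.
have E : tw N P = lin (phi z) ^+ k * (c ^+ k *: tw (N - k) R).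
  rewrite -[X in tw X _](subnKC kN) PE twM ?size_exp_lin ?size_lin//.
  by rewrite twX ?size_lin// lc exprZn -scalerAl scalerAr.
apply: (hord_uniq kN _ E); first by rewrite (leq_trans (size_scale_leq _ _))// size_tw.
have := hform_tw det z sR; rewrite /hform; case: (phi z) => [w|] => h.
  by rewrite hornerZ h !mulf_neq0 ?expf_neq0// (jac_neq0 det).
by rewrite coefZ h !mulf_neq0 ?expf_neq0// (jac_neq0 det).
Qed.

Lemma coprime_forms_tw N p q : coprime_forms N p q ->
  coprime_forms N (tw N p) (tw N q).
Proof.
move=> [sp sq cpq]; split; rewrite ?size_tw// => z.
rewrite -[z]mobCKV !hform_tw//.
by have [h|h] := cpq (psi z); [left|right]; rewrite mulf_neq0// expf_neq0// (jac_neq0 det).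
Qed.

Lemma hval_tw N p q z : (size p <= N.+1)%N -> (size q <= N.+1)%N ->
  hval N (tw N p) (tw N q) (phi z) = hval N p q z.
Proof.
move=> sp sq; rewrite /hval !hform_tw//; have j0 := expf_neq0 N (jac_neq0 det z).
by rewrite mulf_eq0 (negPf j0)/= -mulf_div divff// mul1r.
Qed.

End OneTwist.
End TwistTheory.

Section MupDvdp.
Context {T : numClosedFieldType}.

Lemma mup_dvdp (p q : {poly T}) : p != 0 -> q != 0 ->
  (forall w, mup w p <= mup w q)%N -> p %| q.
Proof.
move=> p0 q0; have [r pr] := closed_field_poly_normal p.
have l0 : lead_coef p != 0 by rewrite lead_coef_eq0.
rewrite pr dvdpZl// => H.
have {H} : forall w, (mup w (\prod_(z <- r) ('X - z%:P)) <= mup w q)%N.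
  move=> w; apply: leq_trans (H w); rewrite -mul_polyC mupMr// rootC//.
elim: r q q0 {pr} => [|z r IH] q q0 H; first by rewrite big_nil dvd1p.
have m0 : \prod_(j <- r) ('X - j%:P) != 0 by rewrite monic_neq0 ?monic_prod_XsubC.
have : 'X - z%:P %| q.
  rewrite -[X in X %| _]expr1 -mup_geq// (leq_trans _ (H z))// big_cons.
  by rewrite mupM ?polyXsubC_eq0// -['X - z%:P]expr1 mup_XsubCX eqxx leq_addr.
move=> /dvdpP[q' qE]; rewrite qE big_cons.
have q'0 : q' != 0 by apply: contra_neq q0; rewrite qE => ->; rewrite mul0r.
rewrite mulrC dvdp_mul2r ?polyXsubC_eq0//.
apply: IH => // w; have := H w.
by rewrite qE big_cons !mupM ?polyXsubC_eq0// addnC leq_add2r.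
Qed.

Lemma hordZ N (c : T) p z : c != 0 -> p != 0 -> hord N (c *: p) z = hord N p z.
Proof.
move=> c0 p0; case: z => [w|] /=; last by rewrite size_scale.
by rewrite -mul_polyC mupMr// rootC.
Qed.

Lemma hvalZ N (c : T) p q z : c != 0 -> hval N (c *: p) (c *: q) z = hval N p q z.
Proof.
move=> c0; have E f : hform N (c *: f) z = c * hform N f z.
  by case: z => [w|]; rewrite /= ?hornerZ ?coefZ.
by rewrite /hval !E mulf_eq0 (negPf c0)/= -mulf_div divff// mul1r.
Qed.

Lemma tw_neq0 (al be ga de : T) N (p : {poly T}) : al * de - be * ga = 1 ->
  p != 0 -> (size p <= N.+1)%N -> tw al be ga de N p != 0.
Proof.
move=> det p0 sp; apply: contra_neq p0 => tp; apply: poly_eq_horner => w.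
have := hform_tw det (Some w) sp; rewrite tp.
rewrite (_ : hform _ 0 _ = 0); last by case: (mobC _ _ _ _ _) => [?|]; rewrite /= ?horner0 ?coef0.
move/esym/eqP; rewrite mulf_eq0 expf_eq0 (negPf (jac_neq0 det _)) andbF /=.
by move=> /eqP ->; rewrite horner0.
Qed.

End MupDvdp.

(** * Rational functions and their divisors through forms *)

Section Ratfun.
Context {R : realType}.
Implicit Types (F G : ratfun R) (z : Cbar R) (s : seq (Rbar R)).

Lemma rden_monic F : rden F \is monic.
Proof. by have /andP[] := valP F. Qed.

Lemma rden_neq0 F : rden F != 0.
Proof. exact/monic_neq0/rden_monic. Qed.

Lemma ratfun_coprimep F : coprimep (rnum F) (rden F).
Proof. by have /andP[] := valP F. Qed.

Lemma rdegE F : (rdeg F).+1 = maxn (size (rnum F)) (size (rden F)).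
Proof.
have : (0 < size (rden F))%N by rewrite size_poly_gt0 rden_neq0.
by rewrite /rdeg; move: (size _) (size _) => u v; lia.
Qed.

Lemma ratfun_forms F : coprime_forms (rdeg F) (rnum F) (rden F).
Proof.
split; rewrite ?rdegE ?leq_maxl ?leq_maxr// => -[w|] /=.
  have [|] := boolP (root (rnum F) w); last by left.
  by move=> /(coprimep_root (ratfun_coprimep F)); right.
have := rdegE F; rewrite /maxn; case: ifP => sz nE.
  by right; rewrite -[rdeg F]/(rdeg F).+1.-1 nE -lead_coefE lead_coef_eq0 rden_neq0.
left; rewrite -[rdeg F]/(rdeg F).+1.-1 nE -lead_coefE lead_coef_eq0.
by rewrite -size_poly_eq0 -nE.
Qed.

Lemma rval_hval F z : rval F z = hval (rdeg F) (rnum F) (rden F) z.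
Proof.
case: z => [w|]; first by [].
have nE := rdegE F; have lE (f : {poly R[i]}) : size f = (rdeg F).+1 -> f`_(rdeg F) = lead_coef f.
  by rewrite lead_coefE => ->.
have d1 : lead_coef (rden F) = 1 by apply/eqP/(rden_monic F).
rewrite /rval /hval /=; case: ltngtP => sz.
- rewrite [(rden F)`_ _]lE; last by move: nE sz; move: (size _) (size _) => u v; lia.
  rewrite d1 oner_eq0/= nth_default ?mul0r//.
  by move: nE sz; move: (size _) (size _) => u v; lia.
- by rewrite nth_default ?eqxx//; move: nE sz; move: (size _) (size _) => u v; lia.
- rewrite !lE ?d1 ?oner_eq0//; move: nE sz; move: (size _) (size _) => u v; lia.
Qed.

Lemma poldiv_hord F z : poldiv F z = hord (rdeg F) (rden F) z.
Proof.
case: z => [w|] //=; have := rdegE F.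
have : (0 < size (rden F))%N by rewrite size_poly_gt0 rden_neq0.
by move: (size _) (size _) => u v; lia.
Qed.

Lemma zerodiv_hord F z : rnum F != 0 -> zerodiv F z = hord (rdeg F) (rnum F) z.
Proof.
rewrite /zerodiv => n0; rewrite (negPf n0); case: z => [w|] //=.
have : (0 < size (rnum F))%N by rewrite size_poly_gt0.
by have := rdegE F; move: (size _) (size _) => u v; lia.
Qed.

Lemma ratfun_ext F G : (forall z, rval F z = rval G z) -> F = G.
Proof.
move=> FG; have E : rnum F * rden G = rnum G * rden F.
  apply: poly_eq_horner => w; have := FG (Some w); rewrite !hornerM /=.
  case: eqVneq => [-> |F0]; case: eqVneq => [->|G0] //=; first by rewrite !mulr0.
  by case=> /(canRL (divfK F0)) ->; rewrite mulrAC divfK.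
have dd : rden F %= rden G.
  apply/andP; split.
    rewrite -(@Gauss_dvdpr _ _ (rnum F)) ?E ?dvdp_mull//.
    by rewrite coprimep_sym ratfun_coprimep.
  rewrite -(@Gauss_dvdpr _ _ (rnum G)) -?E ?dvdp_mull//.
  by rewrite coprimep_sym ratfun_coprimep.
have dE : rden F = rden G.
  by apply/eqP; rewrite -eqp_monic ?rden_monic.
apply: val_inj => /=; move: E dE; rewrite /rnum /rden.
move: (rden_neq0 F); rewrite /rden; case: (sval F) (sval G) => [p q] [p' q'] /= q0 E dE.
by rewrite -dE in E *; rewrite (mulIf q0 E).
Qed.

Section Coordinates.
Variables (al be ga de : R[i]).
Hypothesis det : al * de - be * ga = 1.
Local Notation phi := (mobC al be ga de).
Local Notation twV := (tw de (- be) (- ga) al).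
Local Notation tw := (tw al be ga de).

(** The forms are pulled back by the inverse twist, then divided by the leading coefficient of the
    denominator, which has to be monic. *)
Lemma ratfun_of_forms N p q : coprime_forms N p q -> q != 0 ->
  exists G, (forall z, rval G z = hval N p q (phi z)) /\
    (forall z, poldiv G z = hord N q (phi z)).
Proof.
have det' : de * al - (- be) * (- ga) = 1 by rewrite mulrNN mulrC.
move=> cpq q0; have [sp sq _] := cpq.
have [sp1 sq1 _] := coprime_forms_tw det' cpq.
have cpq1 := coprime_forms_tw det' cpq; have q10 := tw_neq0 det' q0 sq.
have lc0 : lead_coef (twV N q) != 0 by rewrite lead_coef_eq0.
pose c := (lead_coef (twV N q))^-1; have c0 : c != 0 by rewrite invr_eq0.
have ok : ratfun_ok (c *: twV N p, c *: twV N q).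
  apply/andP; split => /=; first by apply/monicP; rewrite lead_coefZ mulVf.
  by rewrite coprimepZl// coprimepZr// (coprime_forms_coprimep cpq1).
pose G : ratfun R := exist (fun pq => is_true (ratfun_ok pq)) _ ok.
have NE : rdeg G = N.
  apply: succn_inj; rewrite rdegE -(coprime_forms_max cpq1) /rnum /rden /=.
  by rewrite !size_scale.
exists G; split=> z.
  rewrite rval_hval NE /rnum /rden /= hvalZ// -[in LHS](mobCK det z).
  exact: hval_tw.
rewrite poldiv_hord NE /rden /= hordZ// -[in LHS](mobCK det z).
exact: hord_tw.
Qed.

(* [F] is the quotient of [tw (rnum F) * r] by [Q], where the cofactor [r]
   accounts for the poles allowed by [s] that [F] does not have. *)
Lemma ratfun_forms_of n (Q : {poly R[i]}) s F : Q != 0 -> (size Q <= n.+1)%N ->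
  (forall z, hord n Q (phi z) = divC s z) ->
  (forall z, poldiv F z <= divC s z)%N ->
  (rdeg F <= n)%N /\ exists r : {poly R[i]}, [/\ (size r <= (n - rdeg F).+1)%N, r != 0,
    Q = tw (rdeg F) (rden F) * r &
    rnum F != 0 -> forall z,
      D0 s F z = hord n (tw (rdeg F) (rnum F) * r) (phi z)].
Proof.
move=> Q0 sQ Qs polF; set N := rdeg F.
have [sp sq _] := ratfun_forms F.
have hle w : (hord N (tw N (rden F)) w <= hord n Q w)%N.
  by rewrite -[w](mobCKV det) (hord_tw det)// ?rden_neq0// Qs -poldiv_hord.
have q0 := tw_neq0 det (rden_neq0 F) sq.
have /dvdpP[r rE] : tw N (rden F) %| Q.
  by apply: mup_dvdp => // w; exact: (hle (Some w)).
have r0 : r != 0 by apply: contra_neq Q0; rewrite rE => ->; rewrite mul0r.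
have szr : (0 < size r)%N by rewrite size_poly_gt0.
have szq : (0 < size (tw N (rden F)))%N by rewrite size_poly_gt0.
have szQ : size Q = (size r + size (tw N (rden F))).-1 by rewrite rE size_mul.
have szN := size_tw al be ga de N (rden F).
have := hle None; rewrite /= szQ => hN.
have [Nn szr'] : (N <= n /\ size r <= (n - N).+1)%N.
  move: hN szN szr szq sQ; rewrite szQ; move: (size r) (size _) => u v; lia.
split => //; exists r; split => //; first by rewrite mulrC.
move=> n0 z; have tn0 := tw_neq0 det n0 sp.
rewrite /D0 -Qs poldiv_hord zerodiv_hord// -/N.
rewrite -[in LHS](hord_tw det z n0 sp) -[in X in _ - X](hord_tw det z (rden_neq0 F) sq).
have -> : hord n Q (phi z) = (hord N (tw N (rden F)) (phi z) + hord (n - N) r (phi z))%N.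
  by rewrite -[X in hord X _ _](subnKC Nn) rE mulrC hordM.
rewrite -[X in _ = (hord X _ _)%:Z](subnKC Nn) hordM ?size_tw// !PoszD.
by ring.
Qed.

End Coordinates.
End Ratfun.

(** * Forms with a prescribed divisor, and growth at infinity *)

Section FormsOfDivisors.
Context {T : fieldType}.

Lemma monic_prod_lin (t : seq (option T)) : \prod_(c <- t) lin c \is monic.
Proof. by apply: monic_prod => -[c|] _ /=; rewrite ?monicXsubC ?monic1. Qed.

Lemma prod_lin_neq0 (t : seq (option T)) : \prod_(c <- t) lin c != 0.
Proof. exact/monic_neq0/monic_prod_lin. Qed.

Lemma size_prod_lin (t : seq (option T)) :
  (size (\prod_(c <- t) lin c)%R <= (size t).+1)%N.
Proof.
elim: t => [|c t IH]; first by rewrite big_nil size_poly1.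
rewrite big_cons (leq_trans (size_polyMleq _ _))//=.
by have := size_lin c; move: IH; move: (size _) (size _) (size _) => u v w; lia.
Qed.

Lemma hord_prod_lin (t : seq (option T)) z :
  hord (size t) (\prod_(c <- t) lin c) z = count_mem z t.
Proof.
elim: t => [|c t IH] /=.
  rewrite big_nil; case: z => [w|]; rewrite /= ?size_poly1//.
  by apply/eqP; rewrite -leqn0 leqNgt mup_geq ?oner_eq0// expr1 dvdp1 size_XsubC.
by rewrite big_cons -add1n hordM ?lin_neq0 ?prod_lin_neq0 ?size_lin ?size_prod_lin// IH hord_lin.
Qed.

End FormsOfDivisors.

Section Growth.
Context {T : numFieldType}.

Lemma horner_growth (f : {poly T}) k : (size f <= k.+1)%N ->
  exists2 C : T, 0 <= C & forall w, 1 <= `|w| -> `|f.[w]| <= C * `|w| ^+ k.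
Proof.
move=> sf; exists (\sum_(i < k.+1) `|f`_i|); first by apply: sumr_ge0.
move=> w w1; rewrite (horner_coef_wide _ sf) (le_trans (ler_norm_sum _ _ _))//.
rewrite mulr_suml ler_sum// => i _; rewrite normrM normrX ler_wpM2l//.
by rewrite ler_weXn2l// -ltnS.
Qed.

Lemma ratio_tends0 n (f g : {poly T}) (eps : T) : 0 < eps -> (size f <= n.+1)%N ->
  size g = n.+2 -> g \is monic ->
  exists2 M, 0 <= M & forall w, M < `|w| -> g.[w] != 0 /\ `|f.[w] / g.[w]| < eps.
Proof.
move=> e0 sf sg mg; have [C C0 fC] := horner_growth sf.
have sh : (size (g - 'X^(n.+1))%R <= n.+1)%N.
  apply/leq_sizeP => j; rewrite coefB coefXn leq_eqVlt => /orP[/eqP <-|nj].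
    by rewrite eqxx; move/monicP: mg; rewrite lead_coefE sg /= => ->; rewrite subrr.
  by rewrite nth_default ?sg// gtn_eqF// subrr.
have [D D0 hD] := horner_growth sh.
(* [D] bounds the lower terms of [g], so [|g w| >= |w|^n * (|w| - D)], to be compared with
   [|f w| <= C * |w|^n]. *)
exists (1 + D + C / eps); first by rewrite !addr_ge0// ?divr_ge0// ltW.
move=> w Mw; have Ce0 : 0 <= C / eps by rewrite divr_ge0// ltW.
have w1 : 1 <= `|w|.
  by rewrite (le_trans _ (ltW Mw))// -addrA lerDl addr_ge0.
have w0 : 0 < `|w| ^+ n by rewrite exprn_gt0// (lt_le_trans ltr01).
have wD : C / eps < `|w| - D.
  by rewrite ltrBrDr (le_lt_trans _ Mw)// -addrA [C / eps + D]addrC lerDr.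
have wD0 : 0 < `|w| - D by rewrite (le_lt_trans Ce0).
have gw : `|w| ^+ n * (`|w| - D) <= `|g.[w]|.
  have -> : g.[w] = w ^+ n.+1 - (- (g - 'X^(n.+1)).[w]).
    by rewrite hornerD hornerN hornerXn opprK addrCA subrr addr0.
  rewrite (le_trans _ (lerB_dist _ _))// normrN normrX mulrBr exprSr lerB//.
  by rewrite mulrC hD.
have g0 : 0 < `|g.[w]| by rewrite (lt_le_trans _ gw)// mulr_gt0.
split; first by rewrite -normr_gt0.
rewrite normrM normfV ltr_pdivrMr// (le_lt_trans (fC _ w1))//.
rewrite (lt_le_trans _ (_ : eps * (`|w| ^+ n * (`|w| - D)) <= _)) ?ler_pM2l//.
by rewrite mulrCA mulrC ltr_pM2l// -ltr_pdivrMl// mulrC.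
Qed.

End Growth.

Section Embedding.
Context {R : realType}.
Implicit Types (x y : Rbar R) (s : seq (Rbar R)).

Lemma ge0_complexE (z : R[i]) : 0 <= z -> z = (complex.Re z)%:C.
Proof. by case: z => a b; rewrite lecE /= => /andP[/eqP -> _]. Qed.

Lemma emb_inj : injective (@emb R).
Proof. by case=> [x|] [y|] //= [->]. Qed.

Lemma emb_mob (al be ga de : R) x :
  emb (mob al be ga de x) = mobC al%:C be%:C ga%:C de%:C (emb x).
Proof.
have C0 (t : R) : (t%:C == 0) = (t == 0) by rewrite (inj_eq (@complexI R) t 0).
case: x => [r|] /=.
  by rewrite -rmorphM -rmorphD C0; case: ifP => _ //=; rewrite !(rmorphM, rmorphD, fmorphV).
by rewrite C0; case: ifP => _ //=; rewrite rmorphM fmorphV.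
Qed.

Lemma mobE_det (al be ga de : R) : al * de - be * ga = 1 ->
  al%:C * de%:C - be%:C * ga%:C = 1.
Proof. by move=> det; rewrite -!rmorphM -rmorphB det rmorph1. Qed.

Lemma mobK (al be ga de : R) : al * de - be * ga = 1 ->
  cancel (mob al be ga de) (mob de (- be) (- ga) al).
Proof.
move=> det x; apply: emb_inj.
by rewrite !emb_mob !rmorphN (mobCK (mobE_det det)).
Qed.

Lemma mobKV (al be ga de : R) : al * de - be * ga = 1 ->
  cancel (mob de (- be) (- ga) al) (mob al be ga de).
Proof.
move=> det x; apply: emb_inj.
by rewrite !emb_mob !rmorphN (mobCKV (mobE_det det)).
Qed.

End Embedding.

(** * The normalized limit as a top coefficient *)

Section Limit.
Context {R : realType}.
Variable xs : Rbar R.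

(* Matrix of the Moebius map [r(., xs)], which sends [xs] to infinity. *)
Definition r_al : R := if xs is Some _ then 0 else 1.
Definition r_be : R := if xs is Some _ then 1 else 0.
Definition r_ga : R := if xs is Some _ then -1 else 0.
Definition r_de : R := if xs is Some x then x else 1.

Local Notation phi := (mob r_al r_be r_ga r_de).
Local Notation phiC := (mobC r_al%:C r_be%:C r_ga%:C r_de%:C).

Lemma r_det : r_al * r_de - r_be * r_ga = 1.
Proof. by rewrite /r_al /r_de /r_be /r_ga; case: xs => [x|]; ring. Qed.

Lemma r_detC : r_al%:C * r_de%:C - r_be%:C * r_ga%:C = 1.
Proof. exact/mobE_det/r_det. Qed.

Lemma phi_xs : phi xs = None.
Proof.
rewrite /r_al /r_de /r_be /r_ga; case: xs => [x|] /=; last by rewrite eqxx.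
by rewrite mulN1r addNr eqxx.
Qed.

Lemma phi_near (d x : R) : 0 < d -> near_pt xs d x ->
  exists w, [/\ phi (Some x) = Some w, rr x xs = w%:C & d^-1 < `|w|].
Proof.
rewrite /r_al /r_de /r_be /r_ga; case: xs => [c|] /= d0; last first.
  by move=> dx; exists x; rewrite !mul0r add0r oner_eq0 mul1r addr0 divr1.
move=> [xc cd]; have cx : c - x != 0 by rewrite subr_eq0 eq_sym.
exists (c - x)^-1; rewrite mul0r add0r mulN1r addrC (negPf cx) div1r fmorphV; split => //.
by rewrite normfV ltf_pV2 ?posrE ?normr_gt0// distrC.
Qed.

Lemma near_pt_exists (d : R) : 0 < d -> exists x, near_pt xs d x.
Proof.
move=> d0; case: xs => [c|] /=.
  exists (c + d / 2); have d2 : 0 < d / 2 by rewrite divr_gt0.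
  split; first by rewrite -subr_eq0 addrAC subrr add0r gt_eqF.
  by rewrite addrAC subrr add0r gtr0_norm// ltr_pdivrMr// ltr_pMr// ltr1n.
exists (d^-1 + 1); have d2 : 0 < d^-1 by rewrite invr_gt0.
by rewrite gtr0_norm ?addr_gt0// ltrDl.
Qed.

Lemma near_pt_le (d d' x : R) : 0 < d -> d <= d' -> near_pt xs d x -> near_pt xs d' x.
Proof.
move=> d0 dd'; case: xs => [c|] /=; first by move=> [-> /lt_le_trans->].
by apply: le_lt_trans; rewrite lef_pV2 ?posrE// (lt_le_trans d0).
Qed.

Lemma lim_quot_unique (F : ratfun R) k L L' :
  lim_quot F xs k L -> lim_quot F xs k L' -> L = L'.
Proof.
move=> FL FL'; apply/eqP; rewrite -subr_eq0; apply/negPn/negP => LL.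
have n0 : 0 < `|L - L'| by rewrite normr_gt0.
have nE : `|L - L'| = (complex.Re `|L - L'|)%:C.
  exact: ge0_complexE.
set e := complex.Re _ in nE; have e0 : 0 < e / 2.
  by rewrite divr_gt0//; move: n0; rewrite nE ltcR.
have [d [d0 Fd]] := FL _ e0; have [d' [d'0 Fd']] := FL' _ e0.
have m0 : 0 < Num.min d d' by rewrite lt_min d0.
have [x nx] := near_pt_exists m0.
have [|w [Fw wL]] := Fd x; first by apply: near_pt_le nx => //; rewrite ge_min lexx.
have [|w' [Fw' wL']] := Fd' x.
  by apply: near_pt_le nx => //; rewrite ge_min lexx orbT.
move: wL'; have <- : w = w' by move: Fw'; rewrite Fw => -[].
set u := w / _ => wL'; have : `|L - L'| < (e / 2)%:C + (e / 2)%:C.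
  rewrite -(subrK u L) -addrA (le_lt_trans (ler_normD _ _))// ltrD//.
  by rewrite distrC.
by rewrite -rmorphD -splitr nE ltxx.
Qed.

(** Each occurrence of [xs] in [s] contributes the linear form 1, so the product has degree [n - d].
    Dividing by the [d]-th power of the coordinate compares [p * r] with the monic [Q * 'X^d] of
    degree exactly [n]. *)
Lemma lim_quot_top (n N : nat) s (F : ratfun R) (p q r : {poly R[i]}) :
  (0 < n)%N -> size s = n ->
  (forall z, rval F z = hval N p q (phiC z)) ->
  \prod_(c <- s) lin (phiC (emb c)) = q * r -> (size (p * r)%R <= n.+1)%N ->
  lim_quot F xs (divR s xs) (p * r)`_n.
Proof.
case: n => [//|n] _ ss Fpq Qqr spr.
set Q := \prod_(c <- s) _ in Qqr.
set L := _`_ _; set d := divR s xs.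
have QE : Q = \prod_(c <- [seq phiC (emb c) | c <- s]) lin c by rewrite big_map.
have mQ : Q \is monic by rewrite QE monic_prod_lin.
have Q0 : Q != 0 by exact: monic_neq0.
have szQ : (size Q + d = n.+2)%N.
  have := hord_prod_lin [seq phiC (emb c) | c <- s] None.
  rewrite size_map ss -QE count_map /=.
  rewrite (_ : count _ s = d); last first.
    apply: eq_count => c /=; rewrite -emb_mob -[None]/(emb None) (inj_eq emb_inj).
    by rewrite -phi_xs (inj_eq (can_inj (mobK r_det))).
  have := size_prod_lin [seq phiC (emb c) | c <- s].
  rewrite size_map ss -QE; have : (0 < size Q)%N by rewrite size_poly_gt0.
  by move: (size Q) => u; lia.
pose g := Q * 'X^d.
have sg : size g = n.+2 by rewrite size_Mmonic ?monicXn// size_polyXn addnS szQ.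
have mg : g \is monic by rewrite monicMl ?monicXn.
pose f := p * r - L *: g.
have sf : (size f <= n.+1)%N.
  apply/leq_sizeP => j; rewrite coefB coefZ leq_eqVlt => /orP[/eqP <-|nj].
    by move/monicP: mg; rewrite lead_coefE sg /= => ->; rewrite mulr1 subrr.
  by rewrite [g`_j]nth_default ?sg// mulr0 subr0 nth_default// (leq_trans spr).
move=> eps e0; have e0C : 0 < eps%:C by rewrite ltcR.
have [M M0 HM] := ratio_tends0 e0C sf sg mg.
have ME : M = (complex.Re M)%:C by exact: ge0_complexE.
pose m := complex.Re M; have m0 : 0 <= m by move: M0; rewrite ME lecR.
exists (m + 1)^-1; split; first by rewrite invr_gt0 ltr_wpDl.
move=> x /phi_near[|w [phx -> wm]]; first by rewrite invr_gt0 ltr_wpDl.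
have Mw : M < `|w%:C|.
  rewrite ME normc_def /= expr0n addr0 sqrtr_sqr ltcR.
  by apply: lt_trans wm; rewrite invrK ltrDl.
have [gw fgw] := HM _ Mw.
have : (Q.[w%:C] != 0) && (w%:C ^+ d != 0).
  by move: gw; rewrite hornerM hornerXn mulf_eq0 negb_or.
rewrite {1}Qqr hornerM mulf_eq0 negb_or => /andP[/andP[qw rw] wd].
exists (p.[w%:C] / q.[w%:C]); split.
  by rewrite Fpq -[Some _]/(emb (Some x)) -emb_mob phx /hval /= qw.
rewrite (_ : _ - L = f.[w%:C] / g.[w%:C])// /f /g Qqr.
rewrite hornerD hornerN hornerZ !hornerM hornerXn.
by field; rewrite qw rw wd.
Qed.

End Limit.

(** * Cyclic order and topology of the extended line *)

Section CyclicOrder.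
Context {R : realType}.
Implicit Types (a b c x y : Rbar R).

(** The cyclic order decided by cases, without the existential over Moebius maps. *)
Definition cyc3 a c b : bool :=
  match a, c, b with
  | None, Some c, Some b => c < b
  | Some a, None, Some b => b < a
  | Some a, Some c, None => a < c
  | Some a, Some c, Some b => [|| a < c < b, c < b < a | b < a < c]
  | _, _, _ => false
  end.

Lemma ltV_cases (u v : R) : u != 0 -> v != 0 ->
  (v^-1 < u^-1) = [|| 0 < u < v, u < v < 0 | v < 0 < u].
Proof.
move=> u0 v0; have [uneg|upos|/eqP] := ltrgtP u 0; last by rewrite (negPf u0).
  have [vneg|vpos|/eqP] := ltrgtP v 0; last by rewrite (negPf v0).
  - by rewrite ltf_nV2 ?negrE//= andbT orbF.
  - rewrite andbF orbF/=; apply/negbTE; rewrite -leNgt.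
    by rewrite ltW// (@lt_trans _ _ 0) ?invr_lt0 ?invr_gt0.
have [vneg|vpos|/eqP] := ltrgtP v 0; last by rewrite (negPf v0).
- by rewrite (@lt_trans _ _ 0) ?invr_lt0 ?invr_gt0//= !orbT.
- by rewrite ltf_pV2 ?posrE//= andbF !orbF.
Qed.

Lemma mob_some (al be ga de a : R) : al * de - be * ga = 1 -> ga * a + de = 0 ->
  ga != 0 /\ forall t, a != t ->
    mob al be ga de (Some t) = Some (al / ga - (ga ^+ 2)^-1 * (t - a)^-1).
Proof.
move=> det D; have deE : de = - (ga * a) by apply/eqP; rewrite -addr_eq0 addrC D.
have g0 : ga != 0.
  apply: contra_eqN det => /eqP E.
  by rewrite deE E mul0r oppr0 !mulr0 subrr eq_sym oner_eq0.
split=> // t; rewrite eq_sym -subr_eq0 => ta.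
have DE : ga * t + de = ga * (t - a) by rewrite deE; ring.
have beE : be = - ga^-1 - al * a.
  by apply: (mulIf g0); move: det; rewrite deE mulrBl mulNr mulVf// => det; lra.
rewrite /= DE mulf_eq0 (negPf g0) (negPf ta)/=; congr Some.
by rewrite beE; field; rewrite g0 ta.
Qed.

Lemma mob_none (al be de : R) : al * de - be * 0 = 1 ->
  0 < al / de /\ forall t, mob al be 0 de (Some t) = Some (al / de * t + be / de).
Proof.
rewrite mulr0 subr0 => det; have d0 : de != 0.
  by apply: contra_eqN det => /eqP ->; rewrite mulr0 eq_sym oner_eq0.
have alE : al = de^-1 by apply: (mulIf d0); rewrite mulVf.
split; first by rewrite alE -expr2 exprn_even_gt0// invr_neq0.
by move=> t; rewrite /= mul0r add0r (negPf d0); congr Some; field.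
Qed.

Lemma cyc3P a c b : cyc_ordered [:: a; c; b] <-> cyc3 a c b.
Proof.
split.
  case=> _ [/= uq [al [be [ga [de [det [fa]]]]]]]; rewrite andbT.
  move: uq; rewrite !inE !andbT => /andP[/norP[ac ab] cb].
  case: a fa ac ab => [a|] fa ac ab.
    have D : ga * a + de = 0 by move: fa => /=; case: eqP.
    have [g0 val] := mob_some det D.
    have nz t : Some a != Some t -> t - a != 0 by rewrite subr_eq0 eq_sym.
    have g2 : 0 < (ga ^+ 2)^-1 by rewrite invr_gt0 exprn_even_gt0.
    have vN : mob al be ga de None = Some (al / ga) by rewrite /= (negPf g0).
    case: c b ac ab cb => [c|] [b|] // ac ab cb; rewrite ?val// ?vN /=.
    - rewrite ltrD2l ltrN2 ltr_pM2l// ltV_cases ?nz//.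
      by rewrite !subr_gt0 !subr_lt0 !ltrD2r.
    - by rewrite gtrDl oppr_lt0 pmulr_rgt0// invr_gt0 subr_gt0.
    - by rewrite ltrDl oppr_gt0 pmulr_rlt0// invr_lt0 subr_lt0.
  have g0 : ga = 0 by move: fa => /=; case: eqP.
  move: det; rewrite g0 => /mob_none[ad val].
  case: c b ac ab cb => [c|] [b|] // _ _ _.
  by rewrite !val/= ltrD2r ltr_pM2l.
move=> abc; split=> //; split.
  rewrite /= !inE !andbT; case: a c b abc => [a|] [c|] [b|] //= abc.
  - rewrite -[Some a == Some c]/(a == c) -[Some a == Some b]/(a == b).
    rewrite -[Some c == Some b]/(c == b) negb_or.
    by case/or3P: abc => /andP[h1 h2]; have h3 := lt_trans h1 h2;
      rewrite ?(lt_eqF h1) ?(lt_eqF h2) ?(lt_eqF h3) ?(gt_eqF h1) ?(gt_eqF h2) ?(gt_eqF h3).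
  - by rewrite -[Some a == Some c]/(a == c) lt_eqF.
  - by rewrite -[Some a == Some b]/(a == b) gt_eqF.
  - by rewrite -[Some c == Some b]/(c == b) lt_eqF.
case: a c b abc => [a|] [c|] [b|] //= abc; last first.
- by exists 1, 0, 0, 1; rewrite eqxx !mul0r !mul1r !addr0 add0r oner_eq0 subr0 /= !divr1 abc.
(* The map [t |-> -1 / (t - a)] has determinant 1 and sends [a] to infinity. *)
- exists 0, (-1), 1, (- a); rewrite !mul1r !mul0r subrr eqxx !add0r subr_eq0.
  rewrite (lt_eqF abc) oner_eq0 /= mulN1r opprK; split; first by ring.
  by split => //; rewrite ?mulN1r andbT oppr_gt0 invr_lt0 subr_lt0.
- exists 0, (-1), 1, (- a); rewrite !mul1r !mul0r subrr eqxx !add0r subr_eq0.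
  rewrite (gt_eqF abc) oner_eq0 /= mulN1r opprK; split; first by ring.
  by split => //; rewrite ?mulN1r andbT oppr_lt0 invr_gt0 subr_gt0.
have [ca ba] : c != a /\ b != a.
  by case/or3P: abc => /andP[h1 h2]; have h3 := lt_trans h1 h2; split;
    rewrite ?(lt_eqF h1) ?(lt_eqF h2) ?(lt_eqF h3) ?(gt_eqF h1) ?(gt_eqF h2) ?(gt_eqF h3).
exists 0, (-1), 1, (- a); rewrite !mul1r !mul0r subrr eqxx !add0r !subr_eq0.
rewrite (negPf ca) (negPf ba) /= mulN1r opprK; split => //; split => //.
rewrite !mulN1r andbT ltrN2 ltV_cases ?subr_eq0//.
by rewrite !subr_gt0 !subr_lt0 !ltrD2r.
Qed.

Lemma mobM (a1 b1 g1 d1 a2 b2 g2 d2 : R) x : a1 * d1 - b1 * g1 = 1 ->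
  a2 * d2 - b2 * g2 = 1 ->
  mob a1 b1 g1 d1 (mob a2 b2 g2 d2 x) =
  mob (a1 * a2 + b1 * g2) (a1 * b2 + b1 * d2) (g1 * a2 + d1 * g2) (g1 * b2 + d1 * d2) x.
Proof.
move=> det1 det2; case: x => [r|] /=.
  have num : (a1 * a2 + b1 * g2) * r + (a1 * b2 + b1 * d2) =
    a1 * (a2 * r + b2) + b1 * (g2 * r + d2) by ring.
  have den : (g1 * a2 + d1 * g2) * r + (g1 * b2 + d1 * d2) =
    g1 * (a2 * r + b2) + d1 * (g2 * r + d2) by ring.
  rewrite num den; have [D|D] := eqVneq (g2 * r + d2) 0 => /=.
    rewrite D !mulr0 !addr0.
    have n0 : a2 * r + b2 != 0.
      apply: contra_eqN det2 => /eqP n0; rewrite eq_sym.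
      suff -> : a2 * d2 - b2 * g2 = 0 by rewrite oner_eq0.
      have -> : d2 = - (g2 * r) by apply/eqP; rewrite -addr_eq0 addrC D.
      have -> : b2 = - (a2 * r) by apply/eqP; rewrite -addr_eq0 addrC n0.
      by ring.
    rewrite mulf_eq0 (negPf n0) orbF; case: ifPn => // g10; congr Some.
    by rewrite -mulf_div divff// mulr1.
  rewrite (_ : g1 * _ + d1 =
    (g1 * (a2 * r + b2) + d1 * (g2 * r + d2)) / (g2 * r + d2)); last by field.
  rewrite mulf_eq0 invr_eq0 (negPf D) orbF; case: ifPn => // D'; congr Some.
  by field; rewrite D D'.
have [g0|g0] := eqVneq g2 0 => /=.
  have a20 : a2 != 0.
    by apply: contra_eqN det2 => /eqP ->; rewrite g0 mul0r mulr0 subrr eq_sym oner_eq0.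
  rewrite g0 !mulr0 !addr0 mulf_eq0 (negPf a20) orbF; case: ifPn => // g10.
  by rewrite -mulf_div divff// mulr1.
rewrite (_ : g1 * _ + d1 = (g1 * a2 + d1 * g2) / g2); last by field.
rewrite mulf_eq0 invr_eq0 (negPf g0) orbF; case: ifPn => // D'; congr Some.
by field; rewrite g0 D'.
Qed.

Lemma cyc3_lt (u v w : R) : u < v -> cyc3 (Some u) (Some w) (Some v) = (u < w < v).
Proof.
move=> uv /=; rewrite [v < u]ltNge (ltW uv)/= !andbF /= orbF.
by [].
Qed.

Lemma cyc3_gt (u v w : R) : v < u ->
  cyc3 (Some u) (Some w) (Some v) = (u < w) || (w < v).
Proof.
by move=> vu /=; rewrite vu; case: (u < w); case: (w < v).
Qed.

Section Invariance.
Variables (al be ga de : R).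
Hypothesis det : al * de - be * ga = 1.
Local Notation phi := (mob al be ga de).
Local Notation psi := (mob de (- be) (- ga) al).

(** Going back to the definition by Moebius maps, it suffices to compose the witness with the
    inverse map; no case analysis on the points is needed. *)
Lemma cyc3_mob_impl a c b : cyc3 a c b -> cyc3 (phi a) (phi c) (phi b).
Proof.
have det' : de * al - (- be) * (- ga) = 1 by rewrite mulrNN mulrC.
move/cyc3P => [_ [/= uq [h1 [h2 [h3 [h4 [dh [ha hs]]]]]]]]; apply/cyc3P; split => //=.
have inj := can_inj (mobK det).
split; first by move: uq; rewrite !inE !(inj_eq inj).
exists (h1 * de + h2 * - ga), (h1 * - be + h2 * al), (h3 * de + h4 * - ga), (h3 * - be + h4 * al).
rewrite -!mobM// !(mobK det) ha; split => //.
have -> : (h1 * de + h2 * - ga) * (h3 * - be + h4 * al) -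
  (h1 * - be + h2 * al) * (h3 * de + h4 * - ga) =
  (h1 * h4 - h2 * h3) * (al * de - be * ga) by ring.
by rewrite dh det mulr1.
Qed.

End Invariance.

Lemma cyc3_mob (al be ga de : R) a c b : al * de - be * ga = 1 ->
  cyc3 (mob al be ga de a) (mob al be ga de c) (mob al be ga de b) = cyc3 a c b.
Proof.
move=> det; apply/idP/idP; last exact: cyc3_mob_impl.
have det' : de * al - (- be) * (- ga) = 1 by rewrite mulrNN mulrC.
by move/(cyc3_mob_impl det'); rewrite !(mobK det).
Qed.

End CyclicOrder.

(** * Continuity of Moebius maps on the extended line *)

Section MobiusTopology.
Context {R : realType}.

Lemma nbhs_RbarNone (V : set (Rbar R)) : nbhs (None : Rbar R) V <->
  V None /\ exists2 M : R, 0 < M & forall t, M < `|t| -> V (Some t).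
Proof.
split.
  move=> VN; split; first exact: nbhs_singleton VN.
  case: VN => C [cC _] CV.
  have [M [Mr HM]] := compact_bounded cC.
  exists (Num.max M 0 + 1); first by rewrite ltr_wpDl// le_max lexx orbT.
  move=> t Mt; apply: CV; left; exists t => //= Ct.
  have : M < Num.max M 0 + 1 by rewrite ltr_pwDr// le_max lexx.
  by move=> /HM /(_ t Ct) /=; rewrite leNgt Mt.
move=> [VN [M M0 MV]]; exists `[- M, M]%classic.
  by split; [exact: segment_compact|exact: interval_closed].
move=> [t|] /=; last by [].
move=> [[u nu [<-]]|//]; apply: MV; rewrite ltNge; apply/negP => uM; apply: nu.
by rewrite /= in_itv/= -ler_norml.
Qed.

Lemma nbhs_RbarSome (V : set (Rbar R)) r : nbhs (Some r : Rbar R) V <->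
  exists2 e : R, 0 < e & forall t, `|t - r| < e -> V (Some t).
Proof.
split.
  move=> /nbhs_ballP[e /= e0 eV]; exists e => // t tr; apply: eV.
  by rewrite /ball /= distrC.
move=> [e e0 eV]; apply/nbhs_ballP; exists e => //= t; rewrite /ball /= distrC.
exact: eV.
Qed.

Lemma mob_continuous (al be ga de : R) : al * de - be * ga = 1 ->
  continuous (mob al be ga de : Rbar R -> Rbar R).
Proof.
move=> det [r|] V.
  have [D|D] := eqVneq (ga * r + de) 0.
    have [g0 val] := mob_some det D.
    have -> : mob al be ga de (Some r) = None by rewrite /= D eqxx.
    move/nbhs_RbarNone => [VN [M M0 MV]]; apply/nbhs_RbarSome.
    (* With this [B], the polar term [1 / (ga^2 (t - r))] outweighs the constant [al / ga] by more
       than [M]. *)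
    pose B := ga ^+ 2 * (M + `|al / ga| + 1).
    have g2 : 0 < ga ^+ 2 by rewrite exprn_even_gt0.
    have B1 : 0 < M + `|al / ga| + 1 by rewrite addr_gt0// ltr_wpDr.
    have B0 : 0 < B by rewrite mulr_gt0.
    exists B^-1; first by rewrite invr_gt0.
    move=> t tB; have [->|rt] := eqVneq t r; first by rewrite /preimage/= D eqxx.
    rewrite /preimage /mkset val 1?eq_sym//; apply: MV.
    have t0 : 0 < `|t - r| by rewrite normr_gt0 subr_eq0.
    have : M + `|al / ga| + 1 < `|(ga ^+ 2)^-1 * (t - r)^-1|.
      have -> : `|(ga ^+ 2)^-1 * (t - r)^-1| = `|t - r|^-1 / ga ^+ 2.
        by rewrite normrM !normfV (gtr0_norm g2) mulrC.
      rewrite ltr_pdivlMr// mulrC -/B -(invrK B) ltf_pV2 ?posrE ?invr_gt0//.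
    have := lerB_dist ((ga ^+ 2)^-1 * (t - r)^-1) (al / ga); rewrite distrC.
    by move: (`|_|) (`|_|) (`|_|) => u v w; lra.
  move=> Vr; have {}Vr : nbhs ((al * r + be) / (ga * r + de)) [set t | V (Some t)].
    by move: Vr; rewrite /= (negPf D).
  have c1 : (al * t + be @[t --> r]) --> al * r + be.
    by apply: cvgD; [apply: cvgM; [exact: cvg_cst|exact: cvg_id]|exact: cvg_cst].
  have c2 : (ga * t + de @[t --> r]) --> ga * r + de.
    by apply: cvgD; [apply: cvgM; [exact: cvg_cst|exact: cvg_id]|exact: cvg_cst].
  have c3 : ((al * t + be) / (ga * t + de) @[t --> r]) --> (al * r + be) / (ga * r + de).
    by apply: cvgM => //; apply: cvgV.
  have := c3 _ Vr; have /cvgr_neq0/(_ D) := c2.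
  rewrite /= => h1 h2.
  have : nbhs r [set t | ga * t + de != 0 /\ V (Some ((al * t + be) / (ga * t + de)))].
    by apply: filterS2 h1 h2.
  move=> /nbhs_ballP[e /= e0 eV]; apply/nbhs_RbarSome; exists e => // t tr.
  have [] := eV t; first by rewrite /ball/= distrC.
  by rewrite /preimage /= => /negPf ->.
have [g0|g0] := eqVneq ga 0.
  move: det; rewrite g0 => /mob_none[ad0 val].
  have -> : mob al be 0 de None = None by rewrite /= eqxx.
  move/nbhs_RbarNone => [VN [M M0 MV]]; apply/nbhs_RbarNone.
  split; first by rewrite /preimage /= eqxx.
  exists ((M + `|be / de|) / (al / de)).
    by rewrite divr_gt0// ltr_wpDr.
  move=> t tM; rewrite /preimage /mkset val; apply: MV.
  move: tM; rewrite ltr_pdivrMr// => tM.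
  have := lerB_dist (al / de * t) (- (be / de)); rewrite opprK normrN normrM (gtr0_norm ad0).
  by apply: lt_le_trans; rewrite ltrBrDr [ltRHS]mulrC.
have vN : mob al be ga de None = Some (al / ga) by rewrite /= (negPf g0).
rewrite vN => /nbhs_RbarSome[e e0 eV]; apply/nbhs_RbarNone.
split; first by rewrite /preimage/= (negPf g0); apply: eV; rewrite subrr normr0.
have ag : 0 < `|ga| by rewrite normr_gt0.
exists ((`|de| + (`|ga| * e)^-1 + 1) / `|ga|).
  by rewrite divr_gt0// ltr_pwDr// addr_ge0// invr_ge0 mulr_ge0// ltW.
move=> t; rewrite ltr_pdivrMr// => tM.
have := lerB_dist (ga * t) (- de); rewrite opprK normrN normrM mulrC => DM.
have D1 : (`|ga| * e)^-1 < `|ga * t + de|.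
  by apply: lt_le_trans DM; rewrite ltrBrDr (le_lt_trans _ tM)// [leLHS]addrC lerDl.
have D0 : 0 < `|ga * t + de| by rewrite (lt_trans _ D1)// invr_gt0 mulr_gt0.
rewrite /preimage /= ; have Dn : ga * t + de != 0 by rewrite -normr_gt0.
rewrite (negPf Dn); apply: eV.
have -> : (al * t + be) / (ga * t + de) - al / ga = - (ga * (ga * t + de))^-1.
  have -> : (al * t + be) / (ga * t + de) - al / ga =
     - (al * de - be * ga) / (ga * (ga * t + de)) by field; rewrite g0 Dn.
  by rewrite det mulN1r.
rewrite normrN normfV normrM -ltf_pV2 ?posrE ?invr_gt0 ?mulr_gt0// invrK.
by rewrite -ltr_pdivrMl// -invfM.
Qed.

End MobiusTopology.

(** * Arcs and connected components *)

Section Arcs.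
Context {R : realType}.
Variables (al be ga de : R).
Hypothesis det : al * de - be * ga = 1.
Local Notation phi := (mob al be ga de).
Local Notation psi := (mob de (- be) (- ga) al).
Implicit Types (x y : Rbar R) (A E : set (Rbar R)).

Lemma det_inv : de * al - (- be) * (- ga) = 1.
Proof. by rewrite mulrNN mulrC. Qed.

Lemma ointE a b c : oint a b c <-> cyc3 (phi a) (phi c) (phi b).
Proof. by rewrite (cyc3_mob _ _ _ det); exact: cyc3P. Qed.

Lemma coord_compact E : compact E -> (forall x, E x -> phi x <> None) ->
  compact [set w : R | exists2 x, E x & phi x = Some w].
Proof.
move=> cE EN; pose f x : R := odflt 0 (phi x : option R).
have -> : [set w : R | exists2 x, E x & phi x = Some w] = f @` E.
  apply/seteqP; split=> w.
    by move=> [x Ex xw]; exists x => //; rewrite /f xw.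
  move=> [x Ex <-]; exists x => //; rewrite /f.
  by case: (phi x) (EN x Ex).
apply: continuous_compact => //; apply: continuous_in_subspaceT => x.
rewrite inE => Ex; have := EN x Ex; case px : (phi x) => [w|] // _.
move=> V; rewrite /f px /= => Vw.
have : nbhs (phi x) [set y : Rbar R | V (odflt 0 (y : option R))].
  by rewrite px /=.
by move/(mob_continuous det).
Qed.

Definition arc (u v : R) : set (Rbar R) :=
  [set x | exists2 w, phi x = Some w & u < w < v].

Lemma oint_arc u v : u < v -> oint (psi (Some u)) (psi (Some v)) = arc u v.
Proof.
move=> uv; apply/seteqP; split=> x.
  move/ointE; rewrite !(mobKV det); rewrite /arc /=.
  case: (phi x) => [w|] /=; last by rewrite ltNge (ltW uv).
  move=> /or3P[h|/andP[h1 h2]|/andP[h1 h2]]; first by exists w.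
    by have := lt_trans h2 uv; rewrite ltxx.
  by have := lt_trans h1 uv; rewrite ltxx.
by move=> [w px h]; apply/ointE; rewrite !(mobKV det) px /= h.
Qed.

Lemma arc_open u v : open (arc u v).
Proof.
have -> : arc u v = phi @^-1` (Some @` [set` `]u, v[%R]).
  apply/seteqP; split=> x; rewrite /arc /preimage /=.
    by move=> [w -> h]; exists w => //; rewrite in_itv.
  by move=> [w]; rewrite in_itv /= => h <-; exists w.
apply: open_comp; first by move=> x _; exact: mob_continuous.
by apply: one_point_compactification_open_some; exact: itv_open.
Qed.

Lemma arc_connected u v : connected (arc u v).
Proof.
have -> : arc u v = (psi \o Some) @` [set` `]u, v[%R].
  apply/seteqP; split=> x.
    move=> [w px h]; exists w; first by rewrite /= in_itv.
    by rewrite /comp -px (mobK det).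
  move=> [w wuv <-]; exists w; first by rewrite /comp (mobKV det).
  by move: wuv; rewrite /= in_itv.
apply: connected_continuous_connected.
  by apply/connected_intervalP/interval_is_interval.
apply: continuous_subspaceT => x; apply: continuous_comp.
  exact: one_point_compactification_some_continuous.
exact/mob_continuous/det_inv.
Qed.

(** Each arc is connected, open, and closed relative to [A], being the complement in [A] of the
    union of the other open arcs. *)
Lemma arcs_component A (N : nat) (a b : nat -> R) i x :
  (forall i j, (i < j < N)%N -> b i <= a j) ->
  (forall x, A x <-> exists2 i, (i < N)%N & arc (a i) (b i) x) ->
  (i < N)%N -> arc (a i) (b i) x -> connected_component A x = arc (a i) (b i).
Proof.
move=> ab AE iN xi; apply/seteqP; split; last first.
  apply: connected_component_max => //; last exact: arc_connected.
  by move=> y yi; apply/AE; exists i.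
have Ax : A x by apply/AE; exists i.
set C := connected_component A x.
have CA : C `<=` A by exact: connected_component_sub.
have cC : connected C by exact: component_connected.
have disj j y : (j < N)%N -> j <> i -> arc (a j) (b j) y -> ~ arc (a i) (b i) y.
  move=> jN ji [w yw /andP[w1 w2]] [w']; rewrite yw => -[<-] /andP[w3 w4].
  have [ij|ij|ij] := ltngtP i j; last by case: ji.
    by have := ab i j; rewrite ij jN => /(_ isT); lra.
  by have := ab j i; rewrite ij iN => /(_ isT); lra.
suff E : C `&` arc (a i) (b i) = C by rewrite -E; exact: subIsetr.
apply: cC.
- by exists x; split => //; exact: connected_component_refl.
- by exists (arc (a i) (b i)) => //; exact: arc_open.
exists (~` \bigcup_(j in [set j | (j < N)%N /\ j <> i]) arc (a j) (b j)).
  by apply: open_closedC; apply: bigcup_open => j _; exact: arc_open.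
apply/seteqP; split=> y [Cy h]; split => //.
  by move=> [j [jN ji]] /(disj j y jN ji).
have /AE[j jN yj] := CA _ Cy.
have [<-//|/eqP ji] := eqVneq j i.
by case: h; exists j.
Qed.

End Arcs.

Section CyclicSplit.
Context {R : realType}.

(** With [a] sent to infinity, [x] and [y] become ordered reals, and the arc from the smaller to the
    larger stays inside [(a, b)]. *)
Lemma cyc3_split (a b x y : Rbar R) : cyc3 a x b -> cyc3 a y b -> x <> y ->
  (forall e : Rbar R, cyc3 x e y -> cyc3 a e b) \/
  (forall e : Rbar R, cyc3 y e x -> cyc3 a e b).
Proof.
move=> axb ayb xy.
pose f := mob (r_al a) (r_be a) (r_ga a) (r_de a); have det := r_det a.
have cE3 u v w : cyc3 (f u) (f v) (f w) = cyc3 u v w := cyc3_mob u v w det.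
have fa : f a = None := phi_xs a.
have fxy : f x <> f y by move/(can_inj (mobK det)).
have key u v (b' : Rbar R) : cyc3 None u b' -> cyc3 None v b' ->
    ltRbar u v -> forall c, cyc3 u c v -> cyc3 None c b'.
  case: u v b' => [u|] [v|] [b'|] //= ub vb uv [c|] /=.
    by case/or3P => /andP[h1 h2]; [exact: lt_trans vb| |]; move: h1 h2; lra.
  by rewrite ltNge (ltW uv).
move: axb ayb; rewrite -cE3 -[cyc3 a y b]cE3 fa => axb ayb.
have [xy'|yx'] : ltRbar (f x) (f y) \/ ltRbar (f y) (f x).
  move: axb ayb fxy; case: (f x) (f y) (f b) => [u|] [v|] [w|] //= _ _ uv.
  by have [?|?|uv'] := ltgtP u v; [left|right|case: uv; rewrite uv'].
- by left=> c; rewrite -cE3 => /(key _ _ _ axb ayb xy'); rewrite -fa cE3.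
- by right=> c; rewrite -cE3 => /(key _ _ _ ayb axb yx'); rewrite -fa cE3.
Qed.

End CyclicSplit.

(** * Maximizers in the coordinate at infinity *)

Section RealForms.
Context {R : realType}.
Local Notation toC := (map_poly (real_complex R)).

Lemma toC_horner (f : {poly R}) (x : R) : (toC f).[x%:C] = (f.[x])%:C.
Proof. exact: horner_map. Qed.

Lemma toC_inj : injective toC.
Proof. exact: (map_inj_poly (@complexI R) (rmorph0 _)). Qed.

Lemma norm_realC (x : R) : `|x%:C| = `|x|%:C.
Proof. by rewrite normc_def /= expr0n addr0 sqrtr_sqr. Qed.

Lemma toC_lin (c : Rbar R) : toC (lin c) = lin (emb c).
Proof. by case: c => [c|] /=; rewrite ?map_polyXsubC// rmorph1. Qed.

Lemma toC_coprime_forms n (P Q : {poly R}) X Y : altsys n P Q X Y ->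
  coprimep P Q -> coprime_forms n (toC P) (toC Q).
Proof.
move=> H cop; split.
- by rewrite size_map_poly (size_altsys H).
- by rewrite size_map_poly (alt_size H).
case=> [w|] /=.
  have [|] := boolP (root (toC P) w); last by left.
  have cop' : coprimep (toC P) (toC Q) by rewrite coprimep_map.
  by move=> /(coprimep_root cop'); right.
by left; rewrite coef_map/= gt_eqF// ltcR (alt_lead H).
Qed.

Definition Repoly (f : {poly R[i]}) : {poly R} := \poly_(i < size f) complex.Re f`_i.

Lemma coef_Repoly (f : {poly R[i]}) i : (Repoly f)`_i = complex.Re f`_i.
Proof. by rewrite coef_poly; case: ltnP => // h; rewrite nth_default. Qed.

Lemma size_Repoly (f : {poly R[i]}) : (size (Repoly f) <= size f)%N.
Proof. exact: size_poly. Qed.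

Lemma horner_Repoly (f : {poly R[i]}) (x : R) : (Repoly f).[x] = complex.Re f.[x%:C].
Proof.
rewrite (horner_coef_wide _ (size_Repoly f)) [in RHS]horner_coef raddf_sum.
apply: eq_bigr => i _; rewrite coef_Repoly -rmorphXn /=.
by case: (f`_i) => u v /=; rewrite mulr0 subr0.
Qed.

Lemma normRe_le (z : R[i]) : `|complex.Re z|%:C <= `|z|.
Proof.
case: z => u v; rewrite normc_def lecR /= -sqrtr_sqr ler_wsqrtr//.
by rewrite lerDl sqr_ge0.
Qed.

Lemma real_of_norm_le (z : R[i]) (q : R) : `|z| <= q%:C -> `|complex.Re z| = q ->
  z = (complex.Re z)%:C.
Proof.
case: z => u v; rewrite normc_def lecR /= => zq uq.
have q0 : 0 <= q by rewrite -uq.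
have : u ^+ 2 + v ^+ 2 <= u ^+ 2.
  rewrite -[X in _ <= X ^+ 2]/(u) -[leRHS](real_normK (num_real u)) uq.
  by rewrite -[leLHS]sqr_sqrtr ?addr_ge0 ?sqr_ge0// ler_sqr ?nnegrE ?sqrtr_ge0.
rewrite gerDl => v0; have /eqP : v ^+ 2 == 0 by rewrite eq_le v0 sqr_ge0.
by move=> /eqP; rewrite sqrf_eq0 => /eqP ->.
Qed.

End RealForms.

(** * Functions with poles bounded by the divisor as quotients by [coordQ] *)

Section Representation.
Context {R : realType}.
Local Notation toC := (map_poly (real_complex R)).
Variables (E : set (Rbar R)) (n : nat) (s : seq (Rbar R)) (xs : Rbar R).
Hypotheses (n0 : (0 < n)%N) (ss : size s = n).
Hypothesis sE : forall c, c \in s -> ~ E c.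

Local Notation phi := (mob (r_al xs) (r_be xs) (r_ga xs) (r_de xs)).
Local Notation phiC := (mobC (r_al xs)%:C (r_be xs)%:C (r_ga xs)%:C (r_de xs)%:C).
Local Notation tw := (tw (r_al xs)%:C (r_be xs)%:C (r_ga xs)%:C (r_de xs)%:C).
Local Notation det := (r_det xs).
Local Notation detC := (r_detC xs).

Definition coordE : set R := [set w : R | exists2 x, E x & phi x = Some w].

Definition coordQ : {poly R} := \prod_(c <- s) lin (phi c).

Lemma coordQC : toC coordQ = \prod_(c <- s) lin (phiC (emb c)).
Proof. by rewrite rmorph_prod; apply: eq_bigr => c _; rewrite /= toC_lin emb_mob. Qed.

Lemma coordQC_map : toC coordQ = \prod_(c <- [seq phiC (emb c) | c <- s]) lin c.
Proof. by rewrite coordQC big_map. Qed.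

Lemma coordQC_neq0 : toC coordQ != 0.
Proof. by rewrite coordQC_map prod_lin_neq0. Qed.

Lemma size_coordQ : (size coordQ <= n.+1)%N.
Proof.
have := size_prod_lin [seq phi c | c <- s]; rewrite size_map ss.
by rewrite /coordQ big_map.
Qed.

Lemma coordQ_root (w : R) : (coordQ.[w] == 0) = (Some w \in [seq phi c | c <- s]).
Proof.
rewrite /coordQ -(big_map phi xpredT (fun c => lin c)).
elim: [seq phi c | c <- s] => [|c t IH]; first by rewrite big_nil hornerC oner_eq0.
rewrite big_cons hornerM mulf_eq0 IH inE; congr (_ || _).
by case: c => [c|] /=; rewrite ?hornerXsubC ?subr_eq0// hornerC oner_eq0.
Qed.

Lemma coordQ_on_E y : coordE y -> coordQ.[y] != 0.
Proof.
move=> [x Ex px]; rewrite coordQ_root -px; apply/negP => /mapP[c cs].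
by move/(can_inj (mobK det)) => xc; apply: (sE cs); rewrite -xc.
Qed.

Lemma hord_coordQ z : hord n (toC coordQ) (phiC z) = divC s z.
Proof.
rewrite coordQC_map -ss -[size s](size_map (fun c => phiC (emb c))) hord_prod_lin.
rewrite count_map; apply: eq_count => c /=.
by rewrite (inj_eq (can_inj (mobCK detC))).
Qed.

(* In the coordinate [phi] the function [F] is the quotient of the polynomials
   [P] and [coordQ], both of degree at most [n]. *)
Definition represents (F : ratfun R) (P : {poly R[i]}) :=
  (size P <= n.+1)%N /\ exists r : {poly R[i]},
    [/\ r != 0, toC coordQ = tw (rdeg F) (rden F) * r & P = tw (rdeg F) (rnum F) * r].

Lemma rval_tw (F : ratfun R) z :
  rval F z = hval (rdeg F) (tw (rdeg F) (rnum F)) (tw (rdeg F) (rden F)) (phiC z).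
Proof.
have [sp sq _] := ratfun_forms F.
by rewrite (hval_tw detC)// rval_hval.
Qed.

Lemma represents_exists F : (forall z, poldiv F z <= divC s z)%N ->
  exists P, [/\ represents F P, lim_quot F xs (divR s xs) P`_n &
    P != 0 -> forall z, D0 s F z = hord n P (phiC z)].
Proof.
move=> pF.
have sQ : (size (toC coordQ) <= n.+1)%N by rewrite size_map_poly size_coordQ.
have [Nn [r [sr r0 Qr DF]]] := ratfun_forms_of detC coordQC_neq0 sQ hord_coordQ pF.
have sP : (size (tw (rdeg F) (rnum F) * r)%R <= n.+1)%N.
  rewrite (leq_trans (size_polyMleq _ _))//.
  have := size_tw (r_al xs)%:C (r_be xs)%:C (r_ga xs)%:C (r_de xs)%:C (rdeg F) (rnum F).
  by move: sr Nn; move: (rdeg F) (size r) (size _) => N u v; lia.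
exists (tw (rdeg F) (rnum F) * r); split.
- by split => //; exists r.
- apply: (lim_quot_top n0 ss (rval_tw F)) => //.
  by rewrite -coordQC.
- move=> P0; apply: DF; apply: contra_neq P0 => ->.
  by rewrite tw_0 mul0r.
Qed.

Lemma represents_val F P x w : represents F P -> phi x = Some w ->
  coordQ.[w] != 0 -> rval F (emb x) = Some (P.[w%:C] / (coordQ.[w])%:C).
Proof.
move=> [_ [r [r0 Qr Pr]]] px Q0; rewrite rval_tw -emb_mob px /hval /=.
have : (toC coordQ).[w%:C] != 0 by rewrite toC_horner eq_complex/= eqxx andbT.
rewrite -toC_horner Qr Pr !hornerM mulf_eq0 negb_or => /andP[q0 rw].
by rewrite q0 -mulf_div divff// mulr1.
Qed.

Lemma represents_reduced F P N p q : represents F P -> coprime_forms N p q ->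
  P * q = p * toC coordQ -> rdeg F = N /\ forall z, rval F z = hval N p q (phiC z).
Proof.
move=> [_ [r [r0 Qr Pr]]] cpq; rewrite Qr Pr => pq.
have cF := coprime_forms_tw detC (ratfun_forms F).
have [|NN hN] := hval_cross cF cpq.
  by apply: (mulIf r0); rewrite mulrAC pq mulrA.
by split => // z; rewrite rval_tw hN.
Qed.

Lemma represents_inj F G P : represents F P -> represents G P -> F = G.
Proof.
move=> rF [sP [r [r0 Qr Pr]]]; apply: ratfun_ext => z; rewrite [RHS]rval_tw.
have cG := coprime_forms_tw detC (ratfun_forms G).
have [|_ ->//] := represents_reduced rF cG.
by rewrite Qr Pr mulrAC mulrA.
Qed.

(** Maximality of [F] is tested on rational functions in lowest terms, so [h / coordQ] is reduced by
    a gcd. The form cancelled has degree at most [n - N], whence the pole bound holds at infinity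
    too. *)
Lemma competitor (h : {poly R}) : (forall x, E x -> phi x <> None) ->
  (size h <= n.+1)%N ->
  (forall y, coordE y -> `|h.[y]| <= `|coordQ.[y]|) ->
  exists G, admissible E s G /\ lim_quot G xs (divR s xs) (h`_n)%:C.
Proof.
move=> EN sh hQ.
pose g := gcdp (toC h) (toC coordQ).
have g0 : g != 0 by rewrite gcdp_eq0 (negPf coordQC_neq0) andbF.
pose p := toC h %/ g; pose q := toC coordQ %/ g.
have pg : p * g = toC h by rewrite divpK// dvdp_gcdl.
have qg : q * g = toC coordQ by rewrite divpK// dvdp_gcdr.
have q0 : q != 0 by apply: contra_neq coordQC_neq0; rewrite -qg => ->; rewrite mul0r.
have cop : coprimep p q.
  by apply: coprimep_div_gcd; rewrite coordQC_neq0 orbT.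
pose N := (maxn (size p) (size q)).-1.
have NE : N.+1 = maxn (size p) (size q).
  have : (0 < size q)%N by rewrite size_poly_gt0.
  by rewrite /N; move: (size p) (size q) => u v; lia.
have cpq : coprime_forms N p q.
  split; rewrite ?NE ?leq_maxl ?leq_maxr// => -[w|] /=.
    have [|] := boolP (root p w); last by left.
    by move=> /(coprimep_root cop); right.
  have [qp|pq] := leqP (size p) (size q).
    right; have -> : N = (size q).-1 by rewrite /N (maxn_idPr qp).
    by rewrite -lead_coefE lead_coef_eq0.
  left; have -> : N = (size p).-1 by rewrite /N (maxn_idPl (ltnW pq)).
  rewrite -lead_coefE lead_coef_eq0 -size_poly_gt0.
  exact: leq_ltn_trans pq.
have szg : (0 < size g)%N by rewrite size_poly_gt0.
have szq : (0 < size q)%N by rewrite size_poly_gt0.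
have [Nn sg] : (N <= n)%N /\ (size g <= (n - N).+1)%N.
  have s1 : ((size q + size g).-1 <= n.+1)%N.
    by rewrite -size_mul// qg size_map_poly size_coordQ.
  have s2 : (0 < size p -> (size p + size g).-1 <= n.+1)%N.
    by rewrite size_poly_gt0 => p0; rewrite -size_mul// pg size_map_poly.
  move: NE s1 s2 szg szq; move: (N) (size p) (size q) (size g) => a b c d; lia.
have [G [Gv Gp]] := ratfun_of_forms detC cpq q0.
exists G; split; last first.
  have -> : (h`_n)%:C = (p * g)`_n by rewrite pg coef_map.
  apply: (lim_quot_top n0 ss Gv); last by rewrite pg size_map_poly.
  by rewrite -coordQC qg.
split=> [z|y Ey].
  rewrite Gp -hord_coordQ -qg -[X in (_ <= hord X _ _)%N](subnKC Nn) hordM ?leq_addr//.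
  by have [_ ->] := cpq.
case py : (phi y) (EN y Ey) => [w|] // _.
have Kw : coordE w by exists y.
have Qw := coordQ_on_E Kw.
have : (toC coordQ).[w%:C] != 0 by rewrite toC_horner eq_complex/= eqxx andbT.
rewrite -qg hornerM mulf_eq0 negb_or => /andP[qw gw].
exists (p.[w%:C] / q.[w%:C]); split.
  by rewrite Gv -emb_mob py /hval /= qw.
have -> : p.[w%:C] / q.[w%:C] = (h.[w] / coordQ.[w])%:C.
  rewrite rmorphM fmorphV /= -!toC_horner -pg -qg !hornerM.
  by field; rewrite qw gw.
rewrite norm_realC -[1]/(1%:C) lecR normrM normfV ler_pdivrMr ?normr_gt0//.
by rewrite mul1r hQ.
Qed.

End Representation.

(** * Normal form of a maximizer *)

Section NormalForm.
Context {R : realType}.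
Local Notation toC := (map_poly (real_complex R)).
Variables (E : set (Rbar R)) (n : nat) (s : seq (Rbar R)) (xs : Rbar R).
Hypotheses (cE : compact E) (n0 : (0 < n)%N) (ss : size s = n).
Hypotheses (sE : forall c, c \in s -> ~ E c) (Exs : ~ E xs).

Local Notation phi := (mob (r_al xs) (r_be xs) (r_ga xs) (r_de xs)).
Local Notation phiC := (mobC (r_al xs)%:C (r_be xs)%:C (r_ga xs)%:C (r_de xs)%:C).
Local Notation K := (coordE E xs).
Local Notation Q := (coordQ s xs).

Lemma phi_E x : E x -> phi x <> None.
Proof.
move=> Ex; rewrite -(phi_xs xs) => /(can_inj (mobK (r_det xs))) xE.
by apply: Exs; rewrite -xE.
Qed.

Lemma coordE_compact : compact K.
Proof. by apply: (coord_compact (r_det xs) cE) => x; exact: phi_E. Qed.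

Let cK := coordE_compact.
Let Q0 := coordQ_on_E sE (xs := xs).
Let sQ : (size Q <= n.+1)%N. Proof. exact: size_coordQ. Qed.

(* Replacing the coefficients of the complex polynomial [P] by their real parts
   keeps it maximal, and the two agree at [n.+1] oscillation points. *)
Lemma maximizer_wextremal F : is_maximizer E s xs F ->
  exists P, [/\ wextremal K Q n P, represents n s xs F (toC P) &
    forall z, D0 s F z = hord n (toC P) (phiC z)].
Proof.
move=> [[pF bF] [L [FL maxL]]].
have [P [rP FP DP]] := represents_exists xs n0 ss pF.
have LE := lim_quot_unique FL FP.
have PQ y : K y -> `|P.[y%:C]| <= `|Q.[y]|%:C.
  move=> Ky; have [x Ex px] := Ky; have [w []] := bF x Ex.
  rewrite (represents_val rP px (Q0 Ky)) => -[<-].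
  rewrite normrM normfV norm_realC ler_pdivrMr ?mul1r//.
  by rewrite ltcR normr_gt0 Q0.
have wP : wextremal K Q n (Repoly P).
  split.
  - by rewrite (leq_trans (size_Repoly _)) //; case: rP.
  - move=> y Ky; rewrite horner_Repoly -lecR; apply: le_trans (PQ y Ky).
    exact: normRe_le.
  move=> G sG GQ; have [G' [aG lG]] := competitor n0 ss sE phi_E sG GQ.
  by have := maxL _ _ aG lG; rewrite LE /= coef_Repoly.
have [X [Y [H tY]]] := wextremal_altsys cK Q0 sQ n0 wP.
have PE : P = toC (Repoly P).
  apply: (altsys_ext (inj := real_complex R) H).
  - by case: rP.
  - by rewrite size_map_poly (size_P cK Q0 wP).
  move=> i /tY[KY]; rewrite horner_Repoly => E1.
  rewrite (real_of_norm_le (PQ _ KY) E1) toC_horner horner_Repoly /=.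
  by case: (P.[_]).
exists (Repoly P); split; rewrite -?PE//; apply: DP.
by rewrite PE -(rmorph0 toC) (inj_eq toC_inj) (P_neq0 cK Q0 wP).
Qed.

Lemma maximizer_unique F G : is_maximizer E s xs F -> is_maximizer E s xs G -> G = F.
Proof.
move=> /maximizer_wextremal[P [wP rF _]] /maximizer_wextremal[P' [wP' rG _]].
apply: (represents_inj rG); rewrite (wextremal_unique cK Q0 sQ n0 wP' wP).
exact: rF.
Qed.

(** Both systems are kept: that of size [n] carries [D0] and the oscillation points in [K], the
    reduced one of size [rdeg F] carries the values of [F] and the bands. [nf_YY] ties them
    together. *)
Record normal_form F P X Y p q g X' Y' : Prop := NormalForm {
  nf_wext : wextremal K Q n P;
  nf_alt : altsys n P Q X Y;
  nf_touch : forall i, (i <= n)%N -> touch K Q P (Y i);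
  nf_P : P = p * g;
  nf_Q : Q = q * g;
  nf_cop : coprimep p q;
  nf_red : altsys (rdeg F) p q X' Y';
  nf_YY : forall k, (k <= rdeg F)%N -> exists2 j, (j <= n)%N & Y' k = Y j;
  nf_val : forall z, rval F z = hval (rdeg F) (toC p) (toC q) (phiC z);
  nf_D0 : forall z, D0 s F z = hord n (toC P) (phiC z) }.

Lemma maximizer_normal_form F : is_maximizer E s xs F ->
  exists P X Y p q g X' Y', normal_form F P X Y p q g X' Y'.
Proof.
move=> /maximizer_wextremal[P [wP rF DF]].
have [X [Y [H tY]]] := wextremal_altsys cK Q0 sQ n0 wP.
have [N [p [q [g [X' [Y' [H' cop Pg Qg YY]]]]]]] := altsys_reduce H.
have [|NE Fv] := represents_reduced rF (toC_coprime_forms H' cop).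
  by rewrite Pg Qg !rmorphM mulrA mulrAC.
by exists P, X, Y, p, q, g, X', Y'; split; rewrite ?NE.
Qed.

End NormalForm.

(** * Zeros, gaps and values at the ends of gaps *)

Section Items.
Context {R : realType}.
Local Notation toC := (map_poly (real_complex R)).
Variables (E : set (Rbar R)) (n : nat) (s : seq (Rbar R)) (xs : Rbar R).
Hypotheses (cE : compact E) (ss : size s = n).
Hypotheses (sE : forall c, c \in s -> ~ E c) (Exs : ~ E xs).
Variables (F : ratfun R) (P p q g : {poly R}) (X Y X' Y' : nat -> R).
Hypothesis NF : normal_form E n s xs F P X Y p q g X' Y'.

Local Notation phi := (mob (r_al xs) (r_be xs) (r_ga xs) (r_de xs)).
Local Notation psi := (mob (r_de xs) (- r_be xs) (- r_ga xs) (r_al xs)).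
Local Notation phiC := (mobC (r_al xs)%:C (r_be xs)%:C (r_ga xs)%:C (r_de xs)%:C).
Local Notation K := (coordE E xs).
Local Notation Q := (coordQ s xs).
Local Notation N := (rdeg F).

Let cK : compact K := coordE_compact cE Exs.
Let Q0 : forall y, K y -> Q.[y] != 0 := coordQ_on_E sE (xs := xs).
Let phiK := mobK (r_det xs).
Let psiK := mobKV (r_det xs).
Let wP := nf_wext NF.
Let HP := nf_alt NF.
Let HF := nf_red NF.

Lemma phiC_emb x z : phiC z = emb (phi x) -> z = emb x.
Proof. by rewrite emb_mob => /(can_inj (mobCK (r_detC xs))). Qed.

Lemma phi_in_K x u : E x -> phi x = Some u -> K u.
Proof. by exists x. Qed.

Lemma E_of_K u : K u -> E (psi (Some u)).
Proof. by move=> [x Ex xu]; rewrite -xu phiK. Qed.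

Lemma gap_coord x : E x -> exists2 u, phi x = Some u & K u.
Proof.
move=> Ex; case px : (phi x) (phi_E Exs Ex) => [u|] // _.
by exists u => //; exists x.
Qed.

Lemma D0_count z : D0 s F z = count_mem (phiC z) [seq Some (X i)%:C | i <- iota 0 n].
Proof.
rewrite (nf_D0 NF); congr Posz.
have -> : toC P = (P`_n)%:C *: \prod_(c <- [seq Some (X i)%:C | i <- iota 0 n]) lin c.
  rewrite {1}(alt_factor HP) map_polyZ/= rmorph_prod/= big_map; congr (_ *: _).
  rewrite -(big_mkord xpredT (fun i => map_poly _ ('X - (X i)%:P))) /index_iota subn0.
  by apply: eq_bigr => i _; rewrite map_polyXsubC.
rewrite hordZ ?prod_lin_neq0//; last by rewrite gt_eqF// ltcR (alt_lead HP).
by rewrite -[X in hord X _ _](size_iota 0) -(size_map (fun i => Some (X i)%:C)) hord_prod_lin.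
Qed.

Lemma X_inj i j : (i < n)%N -> (j < n)%N -> X i = X j -> i = j.
Proof.
have lt k l : (k < l)%N -> (l < n)%N -> X k < X l.
  move=> kl ln; have /andP[_ h] := alt_lt HP (ltn_trans kl ln).
  have /andP[h' _] := alt_lt HP ln; apply: lt_trans h (le_lt_trans _ h').
  by rewrite (alt_inc_le HP)// kl ltnW.
move=> iN jN; have [ij|ij|//] := ltngtP i j => XX.
  by have := lt _ _ ij jN; rewrite XX ltxx.
by have := lt _ _ ij iN; rewrite XX ltxx.
Qed.

Lemma D0_le1 z : D0 s F z <= 1.
Proof.
rewrite D0_count count_uniq_mem; first by case: (_ \in _).
rewrite map_inj_in_uniq ?iota_uniq// => i j; rewrite !mem_iota /= => iN jN.
by move=> [] /X_inj; apply.
Qed.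

Lemma P_root i : (i < n)%N -> P.[X i] = 0.
Proof.
move=> iN; rewrite (alt_factor HP) hornerZ horner_prod (bigD1 (Ordinal iN))//=.
by rewrite hornerXsubC subrr mul0r mulr0.
Qed.

Lemma D0_pos z : 0 < D0 s F z ->
  exists x u, [/\ z = emb x, phi x = Some u & P.[u] = 0].
Proof.
rewrite D0_count ltz_nat -has_count => /hasP[c /mapP[i + ->]]; rewrite mem_iota /= => iN.
move=> /eqP E1; exists (psi (Some (X i))), (X i); rewrite psiK P_root//; split => //.
by apply: phiC_emb; rewrite psiK /= -E1.
Qed.

Lemma nf_rval x w : phi x = Some w -> Q.[w] != 0 ->
  rval F (emb x) = Some (P.[w] / Q.[w])%:C.
Proof.
move=> px; rewrite (nf_Q NF) (nf_P NF) !hornerM mulf_eq0 negb_or => /andP[q0 g0].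
rewrite (nf_val NF) -emb_mob px /hval /= !toC_horner.
have -> : (q.[w])%:C != 0 :> R[i] by rewrite eq_complex/= eqxx andbT.
by rewrite -mulf_div divff// mulr1 rmorphM fmorphV.
Qed.

Lemma absone_touch x w : phi x = Some w -> touch K Q P w -> absone (rval F (emb x)).
Proof.
move=> px [Kw PQ]; rewrite (nf_rval px (Q0 Kw)); exists (P.[w] / Q.[w])%:C.
by split => //; rewrite norm_realC normrM normfV PQ divff// normr_eq0 Q0.
Qed.

(** The factor [(X - u) * (X - v)] is negative at some touching point and positive at another: one
    for each of the two cyclic arcs cut out by the zeros. *)
Lemma root_touch_between u v : u < v -> P.[u] = 0 -> P.[v] = 0 ->
  (exists2 y, touch K Q P y & u < y < v) /\
  (exists2 y, touch K Q P y & (y < u) || (v < y)).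
Proof.
move=> uv Pu Pv; pose S := ('X - u%:P) * ('X - v%:P).
have SP : S %| P.
  rewrite Gauss_dvdp; last by rewrite coprimep_XsubC root_XsubC gt_eqF.
  by rewrite !dvdp_XsubCl !rootE Pu Pv eqxx.
have sS : (1 < size S)%N by rewrite size_mul ?polyXsubC_eq0// !size_XsubC.
have SE y : S.[y] = (y - u) * (y - v) by rewrite hornerM !hornerXsubC.
split.
  have [y ty] := factor_changes_sign cK Q0 wP SP sS; rewrite SE => Sy; exists y => //.
  by apply/andP; split; rewrite ltNge; apply/negP => h; move: Sy; nra.
have [y ty] := factor_changes_sign_pos cK Q0 wP SP sS; rewrite SE => Sy; exists y => //.
rewrite !ltNge -negb_and; apply/negP => /andP[h1 h2]; move: Sy; nra.
Qed.

Lemma zeros_separated x1 x2 : x1 <> x2 -> 1 <= D0 s F (emb x1) -> 1 <= D0 s F (emb x2) ->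
  exists y, E y /\ oint x1 x2 y /\ absone (rval F (emb y)).
Proof.
move=> x12 /(lt_le_trans ltr01)/D0_pos[x [u [/emb_inj <- pu Pu]]].
move=> /(lt_le_trans ltr01)/D0_pos[x' [v [/emb_inj <- pv Pv]]].
have sol y : touch K Q P y -> cyc3 (Some u) (Some y) (Some v) ->
    exists y, E y /\ oint x1 x2 y /\ absone (rval F (emb y)).
  move=> ty uyv; exists (psi (Some y)); split; first by apply: E_of_K; case: ty.
  split; first by apply/(ointE (r_det xs)); rewrite psiK pu pv.
  by apply: (absone_touch (w := y)); rewrite ?psiK.
have [uv|vu|uv] := ltgtP u v.
- have [[y ty yuv] _] := root_touch_between uv Pu Pv.
  by apply: (sol y ty); rewrite /= yuv.
- have [_ [y ty /orP yuv]] := root_touch_between vu Pv Pu.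
  by apply: (sol y ty); rewrite /= vu !andbT; case: yuv => ->; rewrite ?orbT.
- by case: x12; apply: (can_inj phiK); rewrite pu pv uv.
Qed.

Lemma gap_free a b u v y : is_gap E a b -> phi a = Some u -> phi b = Some v ->
  K y -> ~ cyc3 (Some u) (Some y) (Some v).
Proof.
move=> [_ [_ [_ abE]]] au bv Ky uyv.
suff : (oint a b `&` E) (psi (Some y)) by rewrite abE.
split; last exact: E_of_K.
by apply/(ointE (r_det xs)); rewrite psiK au bv.
Qed.

(** When [v < u] the cyclic interval from [u] to [v] passes through infinity, so the gap is the
    outside of the convex hull of [K]. *)
Lemma outer_gap a b u v : is_gap E a b -> phi a = Some u -> phi b = Some v ->
  v < u -> forall y, K y -> v <= y <= u.
Proof.
move=> gab au bv vu y Ky; have := gap_free gab au bv Ky; rewrite /= vu !andbT.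
by move/negP; rewrite !negb_or -!leNgt => /and3P[_ -> ->].
Qed.

Lemma outer_touch a b u v : is_gap E a b -> phi a = Some u -> phi b = Some v ->
  v < u -> [/\ touch K Q P u, 0 < P.[u], touch K Q P v & 0 < (-1) ^+ n * P.[v]].
Proof.
move=> gab au bv vu; have hK := outer_gap gab au bv vu.
have [Ea [Eb _]] := gab; have [_ PQ _] := wP.
have [tu Pu] : touch K Q P u /\ 0 < P.[u].
  apply: (touch_max PQ HP (nf_touch NF)); first exact: phi_in_K au.
  by move=> y /hK/andP[].
have [tv Pv] : touch K Q P v /\ 0 < (-1) ^+ n * P.[v].
  apply: (touch_min PQ HP (nf_touch NF)); first exact: phi_in_K bv.
  by move=> y /hK/andP[].
by [].
Qed.

(** Both arcs between two zeros contain points of [E], yet one of these arcs lies inside the gap. *)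
Lemma gap_zero_unique a b x y : is_gap E a b -> oint a b x -> oint a b y ->
  0 < D0 s F (emb x) -> 0 < D0 s F (emb y) -> x = y.
Proof.
move=> [_ [_ [_ abE]]] abx aby x0 y0; apply: contrapT => xy.
have disj e : E e -> ~ oint a b e by move=> Ee abe; have : (oint a b `&` E) e by []; rewrite abE.
have [e1 [Ee1 [xe1 _]]] := zeros_separated xy x0 y0.
have [e2 [Ee2 [ye2 _]]] := zeros_separated (nesym xy) y0 x0.
have [h|h] := cyc3_split (iffLR (cyc3P _ _ _) abx) (iffLR (cyc3P _ _ _) aby) xy.
  by apply: (disj e1 Ee1); apply/cyc3P/h/cyc3P.
by apply: (disj e2 Ee2); apply/cyc3P/h/cyc3P.
Qed.

Lemma gap_xs a b : is_gap E a b -> oint a b xs ->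
  exists u v, [/\ phi a = Some u, phi b = Some v & v < u].
Proof.
move=> [Ea [Eb _]] /(ointE (r_det xs)); rewrite phi_xs.
have [u au _] := gap_coord Ea; have [v bv _] := gap_coord Eb.
by rewrite au bv => vu; exists u, v.
Qed.

Lemma outer_gap_zero_free a b x : is_gap E a b -> oint a b xs -> oint a b x -> D0 s F (emb x) = 0.
Proof.
move=> gab abxs abx; have [u [v [au bv vu]]] := gap_xs gab abxs.
have : 0 <= D0 s F (emb x) by rewrite D0_count.
rewrite le_eqVlt => /orP[/eqP <-//|/D0_pos[x' [w [/emb_inj <- xw Pw]]]].
have /andP[h1 h2] := root_in_hull HP (nf_touch NF) (outer_gap gab au bv vu) Pw.
move/(ointE (r_det xs)): abx; rewrite au bv xw cyc3_gt// ltNge (ltW h2)/=.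
by rewrite ltNge (ltW h1).
Qed.

Lemma coordQ_divR c w : phi c = Some w -> (0 < divR s c)%N -> Q.[w] = 0.
Proof.
move=> cw; rewrite -has_count has_pred1 => cs; apply/eqP.
by rewrite coordQ_root -cw map_f.
Qed.

Lemma D0_root c w : phi c = Some w -> D0 s F (emb c) = 1 -> P.[w] = 0.
Proof.
move=> cw E1; have : 0 < D0 s F (emb c) by rewrite E1.
by move=> /D0_pos[c' [w' [/emb_inj <-]]]; rewrite cw => -[<-].
Qed.

Lemma pole_gap_ends a b c : is_gap E a b -> oint a b c -> (0 < divR s c)%N ->
  (absone (rval F (emb a)) \/ absone (rval F (emb b))) /\
  (D0 s F (emb c) = 1 -> absone (rval F (emb a)) /\ absone (rval F (emb b))).
Proof.
move=> gab abc sc; have [Ea [Eb [ab _]]] := gab.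
have [u au Ku] := gap_coord Ea; have [v bv Kv] := gap_coord Eb.
have [_ PQ _] := wP.
have [uv|vu|uv] := ltgtP u v; last by case: ab; apply: (can_inj phiK); rewrite au bv uv.
- have gap y : u < y < v -> ~ K y.
    by move=> uyv /(gap_free gab au bv); apply; rewrite /= uyv.
  case cw : (phi c) => [w|]; last first.
    by move/(ointE (r_det xs)): abc; rewrite au bv cw /= ltNge (ltW uv).
  have uwv : u < w < v.
    by move/(ointE (r_det xs)): abc; rewrite au bv cw cyc3_lt.
  have Qw := coordQ_divR cw sc; split.
    have := pole_in_gap Q0 PQ HP (nf_touch NF) HF (nf_P NF) (nf_Q NF) (nf_YY NF) Ku Kv gap uwv Qw.
    by case=> t; [left; exact: absone_touch t|right; exact: absone_touch t].
  move=> /(D0_root cw) Pw.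
  have [t1 t2] := zero_in_gap PQ HP (nf_touch NF) Ku Kv gap uwv Pw Qw.
  by split; [exact: absone_touch t1|exact: absone_touch t2].
have [t1 _ t2 _] := outer_touch gab au bv vu.
have A1 := absone_touch au t1; have A2 := absone_touch bv t2.
by split; [left|].
Qed.

(** Each finite pole to the right of [w] contributes one sign; poles at infinity contribute the
    factor 1. *)
Lemma sign_coordQ (w : R) : Q.[w] != 0 ->
  0 < (-1) ^+ (count (fun c => if phi c is Some u then w < u else false) s) * Q.[w].
Proof.
rewrite /coordQ; elim: s => [|c t IH]; first by rewrite big_nil hornerC mulr1.
rewrite big_cons hornerM mulf_eq0 negb_or => /andP[c0 /IH {}IH] /=.
case: (phi c) c0 => [u|] /=; last by rewrite hornerC mul1r.
rewrite hornerXsubC subr_eq0 => wu; have [uw|uw|E1] := ltgtP w u; last by rewrite E1 eqxx in wu.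
  rewrite exprS mulrACA mulr_gt0// mulN1r opprB subr_gt0//.
by rewrite add0n mulrCA mulr_gt0// subr_gt0.
Qed.

Lemma sum_undup_count (pr : pred (Rbar R)) :
  (\sum_(c <- undup s | pr c) divR s c)%N = count pr s.
Proof.
rewrite -sum1_count -[RHS]big_undup_iterop_count /=; apply: eq_bigr => c _.
by rewrite /divR; elim: (count _ s) => // -[//|k] /= {1}->.
Qed.

(** At [u], [P > 0] and the sign of [Q] counts the poles beyond [u], that is those in [(a, xs)]. At
    [v], [P] has sign [(-1)^n], and with [k] poles beyond [v] the remaining [n - k] are those in
    [[xs, b)]. *)
Lemma outer_gap_values a b : is_gap E a b -> oint a b xs ->
  rval F (emb a) =
    Some ((-1) ^+ (\sum_(c <- undup s | `[< oint a xs c >]) divR s c)%N) /\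
  rval F (emb b) =
    Some ((-1) ^+ (\sum_(c <- undup s | (c == xs) || `[< oint xs b c >]) divR s c)%N).
Proof.
move=> gab abxs; have [u [v [au bv vu]]] := gap_xs gab abxs.
have [[Ku tu] Pu [Kv tv] Pv] := outer_touch gab au bv vu.
have sgn (m k : nat) w : Q.[w] != 0 -> `|P.[w]| = `|Q.[w]| -> 0 < (-1) ^+ m * P.[w] ->
    0 < (-1) ^+ k * Q.[w] -> P.[w] / Q.[w] = (-1) ^+ (m + k).
  move=> q0 pq mP kQ; have n1 (l : nat) y : `|(-1) ^+ l * y| = `|y| :> R.
    by rewrite normrM normrX normrN1 expr1n mul1r.
  have : (-1) ^+ m * P.[w] = (-1) ^+ k * Q.[w].
    by rewrite -(gtr0_norm mP) -(gtr0_norm kQ) !n1.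
  move/(congr1 (fun y => (-1) ^+ m * y)); rewrite !mulrA -expr2 sqrr_sign mul1r => ->.
  by rewrite -exprD mulfK.
have castN (k : nat) : ((-1) ^+ k : R)%:C = (-1) ^+ k.
  by rewrite rmorphXn rmorphN1.
rewrite !sum_undup_count (nf_rval au (Q0 Ku)) (nf_rval bv (Q0 Kv)).
split; congr Some.
  rewrite (sgn 0%N _ u (Q0 Ku) tu _ (sign_coordQ (Q0 Ku))) ?mul1r// castN.
  congr (_ ^+ _); apply: eq_count => c; apply/idP/asboolP.
    by move=> h; apply/(ointE (r_det xs)); rewrite au phi_xs; case: (phi c) h.
  by move/(ointE (r_det xs)); rewrite au phi_xs; case: (phi c).
rewrite (sgn n _ v (Q0 Kv) tv Pv (sign_coordQ (Q0 Kv))) castN.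
set k := count _ s.
have -> : count (fun c => (c == xs) || `[< oint xs b c >]) s = (n - k)%N.
  rewrite -ss -(count_predC (fun c => if phi c is Some u0 then v < u0 else false)) -/k addKn.
  apply: eq_in_count => c cs /=.
  have -> : `[< oint xs b c >] = cyc3 None (phi c) (Some v).
    by apply/asboolP/idP => [/(ointE (r_det xs))|h]; [|apply/(ointE (r_det xs))]; rewrite phi_xs bv.
  have -> : (c == xs) = (phi c == None).
    by rewrite -(phi_xs xs) (inj_eq (can_inj phiK)).
  case cw : (phi c) => [w|] //=; rewrite -leNgt le_eqVlt; case: eqP => // wv.
  have := coordQ_divR cw; rewrite -has_count has_pred1 cs wv => /(_ isT) Qv.
  by have := Q0 Kv; rewrite Qv eqxx.
have kn : (k <= n)%N by rewrite -ss count_size.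
(* [n + k] and [n - k] have the same parity. *)
by rewrite -[n in LHS](subnK kn) -addnA addnn exprD -muln2 exprM sqrr_sign mulr1.
Qed.

End Items.

Section ComplexIntervals.
Context {R : realType}.

Lemma conjc_div (x y : R[i]) : ((x / y)^*)%C = (x^*)%C / (y^*)%C.
Proof. exact: etrans (rmorphM (@conjc R) _ _) (congr1 _ (fmorphV (@conjc R) _)). Qed.

Lemma in_closed_bandP (v : Cbar R) : in_closed_band v <->
  exists2 t : R, v = Some t%:C & -1 <= t <= 1.
Proof.
split=> [[[u w] [-> ]]|[t -> tt]]; last first.
  exists t%:C; split => //.
  by rewrite -(rmorphN1 (real_complex R)) -(rmorph1 (real_complex R)) !lecR.
rewrite !lecE /= => /andP[/andP[/eqP w0 h1] /andP[_ h2]].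
by exists u; [rewrite w0 oppr0|rewrite h1 h2].
Qed.

Lemma in_open_bandP (v : Cbar R) : in_open_band v <->
  exists2 t : R, v = Some t%:C & `|t| < 1.
Proof.
split=> [[[u w] [-> ]]|[t -> tt]]; last first.
  exists t%:C; split => //.
  rewrite -(rmorphN1 (real_complex R)) -(rmorph1 (real_complex R)) !ltcR.
  by rewrite -ltr_norml.
rewrite !ltcE /= => /andP[/andP[/eqP w0 h1] /andP[_ h2]].
by exists u; [rewrite w0 oppr0|rewrite ltr_norml h1 h2].
Qed.

End ComplexIntervals.

(** * Reality and the open bands *)

Section BandItems.
Context {R : realType}.
Local Notation toC := (map_poly (real_complex R)).
Variables (E : set (Rbar R)) (n : nat) (s : seq (Rbar R)) (xs : Rbar R).
Variables (F : ratfun R) (P p q g : {poly R}) (X Y X' Y' : nat -> R).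
Hypothesis NF : normal_form E n s xs F P X Y p q g X' Y'.

Local Notation phi := (mob (r_al xs) (r_be xs) (r_ga xs) (r_de xs)).
Local Notation psi := (mob (r_de xs) (- r_be xs) (- r_ga xs) (r_al xs)).
Local Notation phiC := (mobC (r_al xs)%:C (r_be xs)%:C (r_ga xs)%:C (r_de xs)%:C).
Local Notation N := (rdeg F).

Let det := r_det xs.
Let phiK := mobK det.
Let psiK := mobKV det.
Let HF := nf_red NF.
Let cop := nf_cop NF.
Let F_val := nf_val NF.

Lemma phiC_conj z : phiC (conjCbar z) = conjCbar (phiC z).
Proof.
case: z => [w|] /=.
  have cD (a b : R) : a%:C * w^* + b%:C = (a%:C * w + b%:C)^*.
    by case: w => u v; apply/eqP; rewrite eq_complex /=; apply/andP; split; apply/eqP; ring.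
  rewrite !cD conjc_eq0; case: ifP => // _.
  by apply: (congr1 Some); exact/esym/conjc_div.
case: ifP => // _; apply: (congr1 Some).
by apply/esym; rewrite conjc_div !conjc_real.
Qed.

(** The coordinate and the forms [p] and [q] are real, so evaluation commutes with conjugation, at
    infinity included. *)
Lemma maximizer_real : is_real_ratfun F.
Proof.
move=> z; rewrite !F_val phiC_conj.
have cH (f : {poly R}) y : hform N (toC f) (conjCbar y) = (hform N (toC f) y)^*.
  case: y => [w|] /=; last by rewrite coef_map /= oppr0.
  rewrite -horner_map /=; congr (_.[_]).
  by apply/polyP => i; rewrite !coef_map /= oppr0.
rewrite /hval !cH conjc_eq0; case: ifP => // _.
by apply: (congr1 Some); exact/esym/conjc_div.
Qed.

Lemma bands_choice : exists ba bb be : nat -> R,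
  forall i, (i < N)%N -> is_band p q Y' i (ba i) (bb i) (be i).
Proof.
have /choice[f Hf] i : exists t : R * R * R,
    (i < N)%N -> is_band p q Y' i t.1.1 t.1.2 t.2.
  have [iN|] := boolP (i < N)%N; last by exists (0, 0, 0).
  by have [a [b [e B]]] := band_exists HF cop iN; exists (a, b, e).
by exists (fun i => (f i).1.1), (fun i => (f i).1.2), (fun i => (f i).2).
Qed.

Section Bands.
Hypothesis N0 : (0 < N)%N.
Variables ba bb be : nat -> R.
Hypothesis bd : forall i, (i < N)%N -> is_band p q Y' i (ba i) (bb i) (be i).

Lemma F_val_coord x w : phi x = Some w -> q.[w] != 0 ->
  rval F (emb x) = Some (p.[w] / q.[w])%:C.
Proof.
move=> xw q0; rewrite F_val -emb_mob xw /hval /= !toC_horner.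
have -> : (q.[w])%:C != 0 :> R[i] by rewrite eq_complex/= eqxx andbT.
by rewrite rmorphM fmorphV.
Qed.

(** Positivity of the top coefficients of both [p - q] and [p + q]. Hence [F] takes no value of
    [[-1, 1]] at [xs], and no band reaches infinity. *)
Lemma top_coef_lt : `|q`_N| < p`_N.
Proof.
have [_ h1] := band_endpoints HF cop N0 bd (or_introl (erefl 1)).
have [_ h2] := band_endpoints HF cop N0 bd (or_intror (erefl (-1))).
move: h1 h2; rewrite !coefB !coefZ ltr_norml => h1 h2.
by apply/andP; split; lra.
Qed.

(** For [|t| < 1] the pencil has only real zeros; for [t = 1] and [t = -1] they are the band ends;
    infinity is excluded by the top coefficients. *)
Lemma closed_band_root z t : `|t| <= 1 -> rval F z = Some t%:C ->
  exists x w, [/\ z = emb x, phi x = Some w, q.[w] != 0, p.[w] = t * q.[w] &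
    t = 1 \/ t = -1 -> exists2 i, (i < N)%N & w = band_end ba bb be t i].
Proof.
move=> t1; rewrite F_val /hval; case zw : (phiC z) => [w|]; last first.
  rewrite /hform !coef_map; case: ifPn => // q0 /Some_inj E1.
  have := top_coef_lt; have -> : p`_N = t * q`_N.
    have qN : q`_N != 0 by move: q0; rewrite fmorph_eq0.
    have -> : t = p`_N / q`_N; last by rewrite divfK.
    by apply: complexI; rewrite -E1 rmorphM fmorphV.
  move=> h; have := le_lt_trans (normr_ge0 _) h => tq0.
  by move: h; rewrite -[X in _ < X](gtr0_norm tq0) normrM ltNge ler_piMl.
rewrite /hform; case: ifPn => // q0 /Some_inj E1.
have pq : (toC p).[w] = t%:C * (toC q).[w] by rewrite -E1 divfK.
have rw : root (toC (p - t *: q)) w.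
  by rewrite rootE rmorphB/= map_polyZ/= hornerD hornerN hornerZ pq subrr.
have wR : exists2 u : R, w = u%:C &
    (t = 1 \/ t = -1 -> exists2 i, (i < N)%N & u = band_end ba bb be t i).
  have [t1'|] := boolP (`|t| < 1).
    exists (complex.Re w); first exact: (pencil_root_real HF t1').
    by case=> tE; move: t1'; rewrite tE ?normrN normr1 ltxx.
  rewrite -leNgt => t1'; have tpm : t = 1 \/ t = -1.
    have /eqP : `|t| = 1 by apply/eqP; rewrite eq_le t1 t1'.
    by rewrite eqr_norml => /andP[/orP[]/eqP]; [left|right].
  have [tE l0] := band_endpoints HF cop N0 bd tpm.
  move: rw; rewrite tE map_polyZ/= rootZ; last by rewrite eq_complex/= eqxx andbT gt_eqF.
  rewrite rmorph_prod/= rootE horner_prod prodf_seq_eq0 => /hasP[i _]/=.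
  rewrite map_polyXsubC hornerXsubC subr_eq0 => /eqP ->.
  by exists (band_end ba bb be t i) => // _; exists i.
have [u wu ends] := wR.
exists (psi (Some u)), u; split => //.
- by apply: (phiC_emb (xs := xs)); rewrite psiK /= -wu.
- by move: q0; rewrite wu toC_horner eq_complex/= eqxx andbT.
- apply: complexI; rewrite -toC_horner -wu pq wu toC_horner.
  exact/esym/(rmorphM (real_complex R)).
Qed.

Lemma closed_band_real : (forall z, in_closed_band (rval F z) -> exists x, z = emb x) /\
  (forall z, rval F z = Some 1 \/ rval F z = Some (-1) -> exists x, z = emb x).
Proof.
have cl z : in_closed_band (rval F z) -> exists x, z = emb x.
  move=> /in_closed_bandP[t Fz]; rewrite -ler_norml => t1.
  by have [x [w [-> _ _ _]]] := closed_band_root t1 Fz; exists x.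
split=> // z Fz; apply: cl; apply/in_closed_bandP.
case: Fz => ->; [exists 1|exists (-1)] => //.
- by rewrite lexx andbT; lra.
- by rewrite rmorphN1.
- by rewrite lexx /=; lra.
Qed.

Let A := [set x : Rbar R | in_open_band (rval F (emb x))].
Local Notation barc i := (arc (r_al xs) (r_be xs) (r_ga xs) (r_de xs) (ba i) (bb i)).

Lemma open_bandsP x : A x <-> exists2 i, (i < N)%N & barc i x.
Proof.
split.
  move=> /in_open_bandP[t Fx t1].
  have [y [w [/emb_inj <- yw q0 pq _]]] := closed_band_root (ltW t1) Fx.
  have ptq : (p - t *: q).[w] = 0 by rewrite hornerD hornerN hornerZ pq subrr.
  have [i iN wi] := pencil_root_cell HF t1 ptq.
  exists i => //; exists w => //; apply/(band_mem (bd iN)); split => //.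
  by rewrite pq normrM gtr_pMl// normr_gt0.
move=> [i iN [w xw /(band_mem (bd iN)) iw]]; apply/in_open_bandP.
exists (p.[w] / q.[w]); first exact/F_val_coord/(band_den iw).
by have [] := band_val iw.
Qed.

Lemma band_order i j : (i < j < N)%N -> bb i <= ba j.
Proof.
move=> /andP[ij jN]; have h1 := band_hi (bd (ltn_trans ij jN)).
have h2 := band_lo (bd jN); apply: le_trans h1 (le_trans _ h2).
by rewrite (alt_inc_le HF)// ij ltnW.
Qed.

Lemma band_component i x : (i < N)%N -> barc i x ->
  connected_component A x = barc i.
Proof. exact: (arcs_component det band_order open_bandsP). Qed.

Lemma barc_nonempty i : (i < N)%N -> exists2 x, barc i x & A x.
Proof.
move=> iN; have ab := band_lt (bd iN).
have h : barc i (psi (Some ((ba i + bb i) / 2))).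
  by exists ((ba i + bb i) / 2); rewrite ?psiK//; apply/andP; split; lra.
by exists (psi (Some ((ba i + bb i) / 2))) => //; apply/open_bandsP; exists i.
Qed.

Lemma band_count : [set connected_component A x | x in A] #= `I_N.
Proof.
have -> : [set connected_component A x | x in A] = [set barc i | i in `I_N].
  apply/seteqP; split=> S /=.
    move=> [x /open_bandsP[i iN xi] <-]; exists i => //.
    by rewrite (band_component iN xi).
  move=> [i iN <-]; have [x xi Ax] := barc_nonempty iN; exists x => //.
  exact: band_component iN xi.
apply: inj_card_eq => i j; rewrite !inE /= => iN jN ij.
have [x [w xw /andP[w1 w2]] _] := barc_nonempty iN.
have [w' ] : barc j x by rewrite -ij; exists w; rewrite ?w1.
rewrite xw => -[<-] /andP[w3 w4].
have [lt|lt|//] := ltngtP i j.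
  by have := @band_order i j; rewrite lt jN => /(_ isT) h; exfalso; move: h; lra.
by have := @band_order j i; rewrite lt iN => /(_ isT) h; exfalso; move: h; lra.
Qed.

(** A cyclic interval determines its end points. This is needed because the statement about end
    points allows any pair [a'], [b'] that describes the component. *)
Lemma oint_arc_ends a b u v : u < v ->
  oint a b = arc (r_al xs) (r_be xs) (r_ga xs) (r_de xs) u v ->
  phi a = Some u /\ phi b = Some v.
Proof.
move=> uv abE.
have mem w : cyc3 (phi a) (Some w) (phi b) <-> u < w < v.
  have <- : (arc (r_al xs) (r_be xs) (r_ga xs) (r_de xs) u v) (psi (Some w)) = (u < w < v).
    by apply/propext; split => [[w']|h]; [rewrite psiK => -[<-]|exists w; rewrite ?psiK].
  by rewrite -abE (ointE det) psiK.
have memN : ~ cyc3 (phi a) None (phi b).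
  move=> h; have : oint a b (psi None) by apply/(ointE det); rewrite psiK.
  by rewrite abE => -[w]; rewrite psiK.
have itv_ends (u' v' : R) : (forall w, u' < w < v' <-> u < w < v) -> u' < v' ->
    u' = u /\ v' = v.
  move=> me uv'; split; apply/eqP; rewrite eq_le; apply/andP; split; rewrite leNgt; apply/negP => h.
  - have [_ me'] := me ((u + Num.min u' v) / 2).
    have m1 : Num.min u' v <= u' by rewrite ge_min lexx.
    have m2 : Num.min u' v <= v by rewrite ge_min lexx orbT.
    have m3 : u < Num.min u' v by rewrite lt_min h uv.
    have : u < (u + Num.min u' v) / 2 < v by apply/andP; split; lra.
    by move/me' => /andP[]; lra.
  - have [me' _] := me ((u' + Num.min u v') / 2).
    have m1 : Num.min u v' <= u by rewrite ge_min lexx.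
    have m2 : Num.min u v' <= v' by rewrite ge_min lexx orbT.
    have m3 : u' < Num.min u v' by rewrite lt_min h uv'.
    have : u' < (u' + Num.min u v') / 2 < v' by apply/andP; split; lra.
    by move/me' => /andP[]; lra.
  - have [me' _] := me ((v' + Num.max v u') / 2).
    have m1 : v <= Num.max v u' by rewrite le_max lexx.
    have m2 : u' <= Num.max v u' by rewrite le_max lexx orbT.
    have m3 : Num.max v u' < v' by rewrite gt_max h uv'.
    have : u' < (v' + Num.max v u') / 2 < v' by apply/andP; split; lra.
    by move/me' => /andP[]; lra.
  - have [_ me'] := me ((v + Num.max v' u) / 2).
    have m1 : v' <= Num.max v' u by rewrite le_max lexx.
    have m2 : u <= Num.max v' u by rewrite le_max lexx orbT.
    have m3 : Num.max v' u < v by rewrite gt_max h uv.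
    have : u < (v + Num.max v' u) / 2 < v by apply/andP; split; lra.
    by move/me' => /andP[]; lra.
case: (phi a) (phi b) mem memN => [u'|] [v'|] mem memN.
- have [uv'|vu'|ee] := ltgtP u' v'.
  + by have [||-> ->] := itv_ends u' v' => // w; rewrite -mem cyc3_lt.
  + by case: memN.
  + have : u < (u + v) / 2 < v by apply/andP; split; lra.
    by move/mem; rewrite ee /= => /or3P[] /andP[] ? ?; exfalso; lra.
- have m1 : u' <= Num.max u' v by rewrite le_max lexx.
  have m2 : v <= Num.max u' v by rewrite le_max lexx orbT.
  have : u' < Num.max u' v + 1 by lra.
  by move/(mem (Num.max u' v + 1)) => /andP[] ? ?; exfalso; lra.
- have m1 : Num.min v' u <= v' by rewrite ge_min lexx.
  have m2 : Num.min v' u <= u by rewrite ge_min lexx orbT.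
  have : Num.min v' u - 1 < v' by lra.
  by move/(mem (Num.min v' u - 1)) => /andP[] ? ?; exfalso; lra.
- have : u < (u + v) / 2 < v by apply/andP; split; lra.
  by move/mem.
Qed.

Lemma band_eval i t : (i < N)%N -> t = 1 \/ t = -1 ->
  q.[band_end ba bb be t i] != 0 /\
  p.[band_end ba bb be t i] = t * q.[band_end ba bb be t i].
Proof.
move=> iN t1; have B := bd iN.
have pq : p.[band_end ba bb be t i] = t * q.[band_end ba bb be t i].
  rewrite /band_end; case: eqP => [<-|et]; first exact: band_right B.
  rewrite (band_left B); congr (_ * _).
  by case: (band_sign B) t1 et => -> [] ->; rewrite ?opprK.
by split => //; apply: (coprimep_den cop pq).
Qed.

Lemma band_structure x : A x -> exists a' b', a' <> b' /\
  connected_component A x = oint a' b' /\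
  ((forall y1 y2, oint a' b' y1 -> oint a' b' y2 -> cyc_ordered [:: a'; y1; y2] ->
      ltCbar (rval F (emb y1)) (rval F (emb y2))) \/
   (forall y1 y2, oint a' b' y1 -> oint a' b' y2 -> cyc_ordered [:: a'; y1; y2] ->
      ltCbar (rval F (emb y2)) (rval F (emb y1)))) /\
  (forall t : R, -1 < t < 1 -> exists y, oint a' b' y /\ rval F (emb y) = Some t%:C).
Proof.
move=> /open_bandsP[i iN xi]; have B := bd iN; have ab := band_lt B.
exists (psi (Some (ba i))), (psi (Some (bb i))); split.
  by move/(can_inj psiK) => -[] e; move: ab; rewrite e ltxx.
split; first by rewrite (band_component iN xi) oint_arc.
rewrite oint_arc//; split; last first.
  move=> t; rewrite -ltr_norml => t1.
  have [w iw pw] := band_solution HF cop iN t1.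
  exists (psi (Some w)); split.
    by exists w; [rewrite psiK|apply/(band_mem B)].
  rewrite (F_val_coord (w := w)) ?psiK// ?(band_den iw)// pw mulfK//.
  exact: band_den iw.
have mono y1 y2 : barc i y1 -> barc i y2 -> cyc_ordered [:: psi (Some (ba i)); y1; y2] ->
    exists r1 r2 : R, [/\ rval F (emb y1) = Some r1%:C, rval F (emb y2) = Some r2%:C &
      be i * r1 < be i * r2].
  move=> [w1 yw1 h1] [w2 yw2 h2] /(ointE det); rewrite psiK yw1 yw2.
  have /andP[a1 b1] := h1; have /andP[a2 b2] := h2; rewrite cyc3_lt// a1 /= => w12.
  exists (p.[w1] / q.[w1]), (p.[w2] / q.[w2]); split.
  - by apply: F_val_coord => //; apply: band_den; apply/(band_mem B)/h1.
  - by apply: F_val_coord => //; apply: band_den; apply/(band_mem B)/h2.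
  - exact: (band_incr B).
case: (band_sign B) => eE; [left|right] => y1 y2 h1 h2 h3;
  have [r1 [r2 [-> -> ]]] := mono y1 y2 h1 h2 h3; rewrite eE /ltCbar.
- by rewrite !mul1r ltcR.
- by rewrite !mulN1r ltrN2 ltcR.
Qed.

Lemma band_ends_values z : rval F z = Some 1 \/ rval F z = Some (-1) <->
  exists x a' b', A x /\ connected_component A x = oint a' b' /\
    (z = emb a' \/ z = emb b').
Proof.
have castN : (-1 : R)%:C = -1 by rewrite rmorphN1.
split.
  move=> Fz; have [t [t1 Ft]] : exists t : R, (t = 1 \/ t = -1) /\ rval F z = Some t%:C.
    by case: Fz => ->; [exists 1|exists (-1)]; rewrite ?castN; split => //; [left|right].
  have tn : `|t| <= 1 by case: t1 => ->; rewrite ?normrN normr1.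
  have [x [w [-> xw q0 pq /(_ t1)[i iN wE]]]] := closed_band_root tn Ft.
  have [y yi Ay] := barc_nonempty iN; have B := bd iN.
  exists y, (psi (Some (ba i))), (psi (Some (bb i))); split => //; split.
    by rewrite (band_component iN yi) oint_arc// (band_lt B).
  have xE : x = psi (Some w) by rewrite -xw phiK.
  by rewrite xE wE /band_end; case: eqP => _; [right|left].
move=> [x [a' [b' [/open_bandsP[i iN xi] [cE zE]]]]]; have B := bd iN.
have [pa pb] : phi a' = Some (ba i) /\ phi b' = Some (bb i).
  by apply: oint_arc_ends (band_lt B) _; rewrite -cE (band_component iN xi).
have val c t : t = 1 \/ t = -1 -> phi c = Some (band_end ba bb be t i) ->
    rval F (emb c) = Some t%:C.
  move=> t1 cE'; have [q0 pq] := band_eval iN t1.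
  by rewrite (F_val_coord cE' q0) pq mulfK.
have ee : (be i == - be i) = false.
  by apply/negbTE/eqP; case: (band_sign B) => ->; lra.
case: zE => ->.
  have h : - be i = 1 \/ - be i = -1.
    by case: (band_sign B) => ->; [right|left]; rewrite ?opprK.
  rewrite (val a' (- be i)) //; last by rewrite /band_end ee.
  by case: h => ->; [left|right; rewrite castN].
rewrite (val b' (be i)) //; [|exact: band_sign B|by rewrite /band_end eqxx].
by case: (band_sign B) => ->; [left|right; rewrite castN].
Qed.

End Bands.
End BandItems.

Theorem theorem2p3 (R : realType) (E : set (Rbar R)) (n : nat)
    (s : seq (Rbar R)) (xs : Rbar R) (F : ratfun R) (a b : Rbar R) :
  compact E -> E <> setT -> ~ finite_set E ->
  (1 <= n)%N -> size s = n -> (forall c, c \in s -> ~ E c) ->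
  ~ E xs ->
  is_maximizer E s xs F ->
  is_gap E a b -> oint a b xs ->
  let D0n := D0 s F in
  (* (i) *)
  (forall z, 0 < D0n z -> exists x : Rbar R, z = emb x) /\
  (* (ii) *)
  is_real_ratfun F /\
  (* (iii) *)
  (forall x1 x2 : Rbar R, x1 <> x2 -> 1 <= D0n (emb x1) -> 1 <= D0n (emb x2) ->
     exists y, E y /\ oint x1 x2 y /\ absone (rval F (emb y))) /\
  (* (iv) *)
  (forall z, D0n z <= 1) /\
  (* (v) *)
  (forall a' b', is_gap E a' b' -> forall x y, oint a' b' x -> oint a' b' y ->
     0 < D0n (emb x) -> 0 < D0n (emb y) -> x = y) /\
  (* (vi) *)
  (forall x, oint a b x -> D0n (emb x) = 0) /\
  (* (vii) *)
  (forall G, is_maximizer E s xs G -> G = F) /\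
  (* (viii) *)
  ((0 < rdeg F)%N ->
     (forall z, in_closed_band (rval F z) -> exists x : Rbar R, z = emb x) /\
     (forall z, rval F z = Some 1 \/ rval F z = Some (-1) ->
        exists x : Rbar R, z = emb x)) /\
  (* (ix) *)
  ((0 < rdeg F)%N ->
     let A := [set x : Rbar R | in_open_band (rval F (emb x))] in
     ([set connected_component A x | x in A] #= `I_(rdeg F)) /\
     (forall x, A x -> exists a' b', a' <> b' /\
        connected_component A x = oint a' b' /\
        ((forall y1 y2, oint a' b' y1 -> oint a' b' y2 -> cyc_ordered [:: a'; y1; y2] ->
            ltCbar (rval F (emb y1)) (rval F (emb y2))) \/
         (forall y1 y2, oint a' b' y1 -> oint a' b' y2 -> cyc_ordered [:: a'; y1; y2] ->
            ltCbar (rval F (emb y2)) (rval F (emb y1)))) /\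
        (forall t : R, -1 < t < 1 ->
           exists y, oint a' b' y /\ rval F (emb y) = Some t%:C)) /\
     (forall z, rval F z = Some 1 \/ rval F z = Some (-1) <->
        exists x a' b', A x /\ connected_component A x = oint a' b' /\
          (z = emb a' \/ z = emb b'))) /\
  (* (x) *)
  rval F (emb a) =
    Some ((-1) ^+ (\sum_(c <- undup s | `[< oint a xs c >]) divR s c)) /\
  rval F (emb b) =
    Some ((-1) ^+ (\sum_(c <- undup s | (c == xs) || `[< oint xs b c >]) divR s c)) /\
  (* (xi) *)
  (forall ai bi ci, is_gap E ai bi -> oint ai bi ci -> (0 < divR s ci)%N ->
     (absone (rval F (emb ai)) \/ absone (rval F (emb bi))) /\
     (D0n (emb ci) = 1 -> absone (rval F (emb ai)) /\ absone (rval F (emb bi)))).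

Proof.
move=> cE _ _ n0 ss sE Exs maxF gab abxs.
have [P [X [Y [p [q [g [X' [Y' NF]]]]]]]] := maximizer_normal_form cE n0 ss sE Exs maxF.
split; first by move=> z /(D0_pos NF)[x [_ [-> _ _]]]; exists x.
split; first exact: maximizer_real NF.
split; first exact: (zeros_separated cE sE Exs NF).
split; first exact: (D0_le1 NF).
split; first by move=> a' b' gab' x y; exact: (gap_zero_unique cE sE Exs NF gab').
split; first by move=> x; exact: (outer_gap_zero_free Exs NF gab abxs).
split; first by move=> G; apply: (maximizer_unique cE n0 ss sE Exs maxF).
have [ba [bb [be bd]]] := bands_choice NF.
split; first by move=> N0; exact: (closed_band_real NF N0 bd).
split.
  move=> N0 A; split; first exact: (band_count NF N0 bd).
  split; first by move=> x; exact: (band_structure NF N0 bd).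
  exact: (band_ends_values NF N0 bd).
have [xa xb] := outer_gap_values ss sE Exs NF gab abxs.
split=> //; split=> //.
by move=> ai bi ci; exact: (pole_gap_ends sE Exs NF).
Qed.
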